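(* Let $\sigma_{\rm t}\in\mathcal X_{h,0}$ and $\sigma_{\rm t}\ge\sigma_{\rm a}>0$ on $X$. Let $f^{{\rm u},(j)}\in\mathcal W^{\rm u}_{h,0}$ and $f^{{\rm c},(j)}\in\mathcal W^{\rm c}_{h,1}$ for $j\in\{0,1,2\}$, and let $f^{(0)}\in\mathcal W^{\rm u}_{h,0}$. Write $\Phi^{(j)}_{\rm n}=A^{\rm n}f^{{\rm n},(j)}$ for ${\rm n}\in\{{\rm u},{\rm c}\}$. Suppose that the following equations hold for all $v^{\rm u}\in\mathcal W^{\rm u}_{h,0}$ and all $v^{\rm c}\in\mathcal W^{\rm c}_{h,1}$. Order $\epsilon^{-1}$: $$\sum_{i=1}^{N_{\rm u}^*}w_i^{\rm u}\int_X\sigma_{\rm t}f_i^{{\rm u},(0)}v_i^{\rm u}\,dr=0,$$ $$\sum_{i=1}^{N_{\rm c}^*}w_i^{\rm c}\int_X\sigma_{\rm t}\big(f_i^{{\rm c},(0)}-\Phi_{\rm c}^{(0)}\big)v_i^{\rm c}\,dr=\sum_{i=1}^{N_{\rm c}^*}w_i^{\rm c}\int_X\sigma_{\rm t}\Phi_{\rm u}^{(0)}v_i^{\rm c}\,dr,$$ $$\sum_{i=1}^{N_{\rm u}^*}w_i^{\rm u}\int_X\sigma_{\rm t}f_i^{(0)}v_i^{\rm u}\,dr=\sum_{i=1}^{N_{\rm u}^*}w_i^{\rm u}\int_X\sigma_{\rm t}\big(\Phi_{\rm u}^{(0)}+\Phi_{\rm c}^{(0)}\big)v_i^{\rm u}\,dr.$$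 Order $\epsilon^{0}$: $$\sum_{i=1}^{N_{\rm u}^*}w_i^{\rm u}\Big[\int_X\sigma_{\rm t}f_i^{{\rm u},(1)}v_i^{\rm u}\,dr+\sum_{e\in\mathcal E_h}\int_e\Omega_i^{\rm u}\cdot n_e\,(Rf^{{\rm u},(0)})_i^{\uparrow}[\![v_i^{\rm u}]\!]\,dS\Big]=0,$$ $$\sum_{i=1}^{N_{\rm c}^*}w_i^{\rm c}\Big[\int_X\Big(-f_i^{{\rm c},(0)}\,\Omega_i^{\rm c}\cdot\nabla_r v_i^{\rm c}+\sigma_{\rm t}\big(f_i^{{\rm c},(1)}-\Phi_{\rm c}^{(1)}\big)v_i^{\rm c}\Big)dr+\sum_{e\in\mathcal E_h}\int_e\Omega_i^{\rm c}\cdot n_e\,(f_i^{{\rm c},(0)})^{\uparrow}[\![v_i^{\rm c}]\!]\,dS\Big]=\sum_{i=1}^{N_{\rm c}^*}w_i^{\rm c}\int_X\sigma_{\rm t}\Phi_{\rm u}^{(1)}v_i^{\rm c}\,dr.$$ Order $\epsilon^{1}$: $$\sum_{i=1}^{N_{\rm u}^*}w_i^{\rm u}\Big[\int_X\sigma_{\rm t}f_i^{{\rm u},(2)}v_i^{\rm u}\,dr+\sum_{e\in\mathcal E_h}\int_e\Omega_i^{\rm u}\cdot n_e\,(Rf^{{\rm u},(1)})_i^{\uparrow}[\![v_i^{\rm u}]\!]\,dS\Big]=\sum_{i=1}^{N_{\rm u}^*}w_i^{\rm u}\int_Xq_iv_i^{\rm u}\,dr,$$ $$\sum_{i=1}^{N_{\rm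 c}^*}w_i^{\rm c}\Big[\int_X\Big(-f_i^{{\rm c},(1)}\,\Omega_i^{\rm c}\cdot\nabla_r v_i^{\rm c}+\sigma_{\rm t}\big(f_i^{{\rm c},(2)}-\Phi_{\rm c}^{(2)}\big)v_i^{\rm c}+\sigma_{\rm a}\Phi_{\rm c}^{(0)}v_i^{\rm c}\Big)dr+\sum_{e\in\mathcal E_h}\int_e\Omega_i^{\rm c}\cdot n_e\,(f_i^{{\rm c},(1)})^{\uparrow}[\![v_i^{\rm c}]\!]\,dS\Big]=\sum_{i=1}^{N_{\rm c}^*}w_i^{\rm c}\int_X\big(\sigma_{\rm t}\Phi_{\rm u}^{(2)}-\sigma_{\rm a}\Phi_{\rm u}^{(0)}\big)v_i^{\rm c}\,dr.$$ Define $J^{(0)}_{{\rm c},h}=\sum_{i=1}^{N_{\rm c}^*}w_i^{\rm c}\,\Omega_i^{\rm c}f_i^{{\rm c},(1)}$ and $\bar{\mathbf q}=A^{\rm u}\mathbf q$, where $\mathbf q=[q_1,\dots,q_{N_{\rm u}^*}]^T$. Then $f_i^{(0)}=P_0\Phi_{\rm c}^{(0)}$ for all $1\le i\le N_{\rm u}^*$. Moreover, for all $v\in\mathcal C_{h,1}$ and all $\varphi\in(\mathcal X_{h,1})^3$, $$\int_X\Big(-J^{(0)}_{{\rm c},h}\cdot\nabla_r v+4\pi\sigma_{\rm a}\Phi_{\rm c}^{(0)}v\Big)dr=4\pi\int_X(P_0\bar{\mathbf q})\,v\,dr,$$ $$\int_X\Big(\frac{4\pi}{3}\nabla_r\Phi_{\rm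 c}^{(0)}+\sigma_{\rm t}J^{(0)}_{{\rm c},h}\Big)\cdot\varphi\,dr=0.$$
   Context: Mesh and spaces. $X\subset\mathbb R^3$ is an open domain with Lipschitz boundary, partitioned by a mesh $\mathcal T_h$ into open elements $K$ that form a Cartesian grid or a triangular (simplicial) grid. For $k\in\{0,1\}$, $Q_k(K)$ is the set of polynomials on $K$ of degree at most $k$ in each variable, and $P_k(K)$ is the set of polynomials on $K$ of total degree at most $k$. Put $\mathcal X_{h,k}=\{v\in L^2(X): v|_K\in Z_k(K)\ \forall K\in\mathcal T_h\}$, with $Z=Q$ for Cartesian grids and $Z=P$ for triangular grids. $\mathcal C_{h,1}$ is the subspace of $\mathcal X_{h,1}$ in which every element is continuous. For functions that are discontinuous across cells, $\nabla_r$ is the cellwise gradient. $P_0$ is the $L^2(X)$-orthogonal projection onto $\mathcal X_{h,0}$. Edges. $\mathcal E_h=\mathcal E_h^{\rm in}\cup\mathcal E_h^{\rm ex}$ is the set of interior and exterior edges (i.e. faces) of the mesh. Each edge $e$ has a fixed unit normal $n_e$: the direction is chosen by convention for interior edges, and $n_e$ points out of $X$ for exterior edges. For $r\in e$, $v^{\pm}(r)=\lim_{\varepsilon\to0^+}v(r\pm\varepsilon n_e)$. The jump is $[\![v]\!]=v^--v^+$. Jumps and upwind values on exterior edges are computed with a zero value on the exterior of $X$, i.e. with $v^+=0$ (so $[\![v]\!]=v^-$ there). Angular quadratures. For ${\rm n}\in\{{\rm u},{\rm c}\}$ (uncollided, collided), $\{(\Omega_i^{\rm n},w_i^{\rm n})\}_{i=1}^{N_{\rm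 n}^*}$ is a quadrature on the unit sphere $\mathbb S^2$ with weights $w_i^{\rm n}>0$ satisfying $\sum_iw_i^{\rm n}=4\pi$, $\sum_iw_i^{\rm n}\Omega_i^{\rm n}=0$, and $\sum_iw_i^{\rm n}\,\Omega_i^{\rm n}\otimes\Omega_i^{\rm n}=\frac{4\pi}{3}I$, where $I$ is the $3\times 3$ identity matrix. Set $\mathcal W^{\rm n}_{h,k}=(\mathcal X_{h,k})^{N_{\rm n}^*}$, with elements $v^{\rm n}=[v_1^{\rm n},\dots,v_{N_{\rm n}^*}^{\rm n}]^T$. The discrete angular average is $A^{\rm n}v=\frac1{4\pi}\sum_{i=1}^{N_{\rm n}^*}w_i^{\rm n}v_i$. For the component with index $i$ of an ${\rm n}$-angular vector function, the upwind value on $e$ is $v_i^{\uparrow}=v_i^-$ if $\Omega_i^{\rm n}\cdot n_e>0$ and $v_i^{\uparrow}=v_i^+$ if $\Omega_i^{\rm n}\cdot n_e<0$. Data. $R:\mathcal W^{\rm u}_{h,0}\to\mathcal W^{\rm u}_{h,1}$ is a linear finite-volume reconstruction operator (with zero boundary data). $q_i\in L^2(X)$, $1\le i\le N_{\rm u}^*$, are given sources, and $\sigma_{\rm a}$ is a measurable function on $X$. The displayed equations are the balance equations, at orders $\epsilon^{-1},\epsilon^0,\epsilon^1$, of the formal Hilbert expansion in $\epsilon$ of a finite volume (uncollided) / discontinuous Galerkin (collided) scheme with zero inflow boundary data; here $f$ with no superscript u or c denotes the final hybrid approximation, with leading term $f^{(0)}$. The contributions of the equation for $f$ at orders $\epsilon^0$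 and $\epsilon^1$ are not needed and are omitted.
   Formalization: The test space C_{h,1} is taken to consist of the functions in X_{h,1} whose extension by zero outside X is continuous, i.e. which also vanish on the boundary of X; for continuous v not vanishing there, the first balance equation fails in general because of a boundary flux term. *)

(* Defs.v *)
From HB Require Import structures.
From mathcomp Require Import all_boot all_order all_algebra.
From mathcomp Require Import all_classical all_reals all_analysis.
Set Implicit Arguments.
Unset Strict Implicit.
Unset Printing Implicit Defensive.
Import Order.TTheory GRing.Theory Num.Theory.
Import numFieldNormedType.Exports.
Local Open Scope classical_set_scope.
Local Open Scope ring_scope.

(* Points of space are triples of reals. [mvec3 R] is the same type seen with
   the Borel sigma-algebra over which [lebesgue_measure] is defined. *)
Notation vec3 R := (R * R * R)%type.
Notation mvec3 R :=
  (measurableTypeR R * measurableTypeR R * measurableTypeR R)%type.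

Section Euclidean.
Variable R : realType.
Implicit Types r x y : vec3 R.

Definition crd r (i : 'I_3) : R := [:: r.1.1; r.1.2; r.2]`_i.

Definition mkpt (f : 'I_3 -> R) : vec3 R := (f 0, f 1, f 2).

Definition dot x y : R := \sum_(i < 3) crd x i * crd y i.

Definition basis (i : 'I_3) : vec3 R := mkpt (fun j => (j == i)%:R).

Definition grad (v : vec3 R -> R) r : vec3 R :=
  mkpt (fun i => 'D_(basis i) v r).

Definition lebesgue3 : {measure set (mvec3 R) -> \bar R} :=
  (@lebesgue_measure R \x @lebesgue_measure R \x @lebesgue_measure R)%E.

Definition lebesgue2 :
    {measure set (measurableTypeR R * measurableTypeR R) -> \bar R} :=
  (@lebesgue_measure R \x @lebesgue_measure R)%E.

Definition volint (X : set (vec3 R)) (f : vec3 R -> R) : R :=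
  \int[lebesgue3]_(r in X) f r.

Definition measurable_on (X : set (vec3 R)) (f : vec3 R -> R) : Prop :=
  measurable_fun (X : set (mvec3 R)) f.

Definition L2 (X : set (vec3 R)) (f : vec3 R -> R) : Prop :=
  measurable_on X f /\ lebesgue3.-integrable X (fun r => (f r ^+ 2)%:E).

(* Near each boundary point, in a suitable orthonormal frame b, the set lies
   strictly above the graph of a Lipschitz function. *)
Definition lipschitz_boundary (X : set (vec3 R)) : Prop :=
  forall x, (closure X `\` interior X) x ->
  exists (e L : R) (b : 'I_3 -> vec3 R) (g : R * R -> R),
    [/\ 0 < e,
        forall i j, dot (b i) (b j) = (i == j)%:R,
        forall s t, `|g s - g t| <= L * `|s - t|
      & forall y, ball x e y ->
          (X y <-> g (dot y (b 0), dot y (b 1)) < dot y (b 2))].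

End Euclidean.

Variant grid_kind := Cartesian | Triangular.

(* A face is parametrized by (s,t) |-> a + s u + t v over the open unit square
   (Cartesian) or the open unit triangle (Triangular), where
   [face_frame] = (a, u, v). [face_of e K] says that e is a face of K. *)
Record mesh (R : realType) := Mesh {
  kind : grid_kind;
  cellT : finType;
  faceT : finType;
  cells : {set cellT};
  cell_pts : cellT -> set (vec3 R);
  face_frame : faceT -> vec3 R * vec3 R * vec3 R;
  face_of : faceT -> cellT -> bool }.

Section Grids.
Variable R : realType.

(* The grid lines in direction d are x d 0 < ... < x d N; the grid consists of
   the boxes prod_d ]x d (K d), x d (K d).+1[ for K in C. Not all boxes need be
   used, so taking the same N for all three directions is no restriction.
   The face (d, k) lies in the plane r_d = x d (k d). *)
Definition cartesian_mesh N (x : 'I_3 -> nat -> R)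
    (C : {set {ffun 'I_3 -> 'I_N}}) : mesh R :=
  let side (k : {ffun 'I_3 -> 'I_N.+1}) (d : 'I_3) :=
    (x d (k d).+1 - x d (k d)) *: basis R d in
  @Mesh R Cartesian {ffun 'I_3 -> 'I_N}
    ('I_3 * {ffun 'I_3 -> 'I_N.+1})%type C
    (fun K => [set r | forall d, x d (K d) < crd r d < x d (K d).+1])
    (fun e => (mkpt (fun d => x d (e.2 d)),
               side e.2 (e.1 + 1), side e.2 (e.1 + 2)))
    (fun e K => [forall d,
       if d == e.1 then (e.2 d == K d :> nat) || (e.2 d == (K d).+1 :> nat)
       else e.2 d == K d :> nat]).

Definition is_cartesian_grid (M : mesh R) : Prop :=
  exists N (x : 'I_3 -> nat -> R) (C : {set {ffun 'I_3 -> 'I_N}}),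
    (forall d i j, (i < j <= N)%N -> x d i < x d j) /\ M = cartesian_mesh x C.

Section Simplices.
Variables (N : nat) (p : 'I_N -> vec3 R).
Implicit Types S K L : {set 'I_N}.

Definition open_simplex S : set (vec3 R) :=
  [set r | exists l : 'I_N -> R,
    [/\ forall j, j \in S -> 0 < l j, \sum_(j in S) l j = 1
      & r = \sum_(j in S) l j *: p j]].

Definition closed_simplex S : set (vec3 R) :=
  [set r | exists l : 'I_N -> R,
    [/\ forall j, j \in S -> 0 <= l j, \sum_(j in S) l j = 1
      & r = \sum_(j in S) l j *: p j]].

Definition affinely_independent S : Prop :=
  forall l : 'I_N -> R, \sum_(j in S) l j = 0 ->
    \sum_(j in S) l j *: p j = 0 -> forall j, j \in S -> l j = 0.

(* Cells are tetrahedra given by their sets of 4 vertices, faces are triangles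
   given by their sets of 3 vertices. *)
Definition triangular_mesh (C : {set {set 'I_N}}) : mesh R :=
  @Mesh R Triangular {set 'I_N} {set 'I_N} C open_simplex
    (fun e => let q := [seq p j | j <- enum e] in
              (q`_0, q`_1 - q`_0, q`_2 - q`_0))
    (fun e K => (#|e| == 3) && (e \subset K)).

Definition conforming_triangulation (C : {set {set 'I_N}}) : Prop :=
  (forall K, K \in C -> #|K| = 4%N /\ affinely_independent K) /\
  (forall K L, K \in C -> L \in C ->
     closed_simplex K `&` closed_simplex L = closed_simplex (K :&: L)%SET).

End Simplices.

Definition is_triangular_grid (M : mesh R) : Prop :=
  exists N (p : 'I_N -> vec3 R) (C : {set {set 'I_N}}),
    conforming_triangulation p C /\ M = triangular_mesh p C.

Definition partitions (X : set (vec3 R)) (M : mesh R) : Prop :=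
  [/\ forall K, K \in cells M -> cell_pts K `<=` X,
      forall K L, K \in cells M -> L \in cells M -> K != L ->
        cell_pts K `&` cell_pts L = set0
    & X `<=` \bigcup_(K in [set K | K \in cells M]) closure (cell_pts K)].

Definition mesh_of (X : set (vec3 R)) (M : mesh R) : Prop :=
  partitions X M /\ (is_cartesian_grid M \/ is_triangular_grid M).

End Grids.

Section Spaces.
Variables (R : realType) (X : set (vec3 R)) (M : mesh R).

(* The monomials of Q_k (Cartesian) or P_k (Triangular). *)
Definition monomial_in k (a : {ffun 'I_3 -> 'I_k.+1}) : bool :=
  match kind M with
  | Cartesian => true
  | Triangular => (\sum_i a i <= k)%N
  end.

Definition poly_space k (p : vec3 R -> R) : Prop :=
  exists c : {ffun 'I_3 -> 'I_k.+1} -> R,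
    forall r, p r = \sum_(a | monomial_in a) c a * \prod_(i < 3) crd r i ^+ a i.

(* The space X_{h,k}. Its elements are represented by functions that are equal
   to a polynomial at every point of every open cell; the values on the mesh
   skeleton (a null set) are irrelevant. *)
Definition dg_space k (v : vec3 R -> R) : Prop :=
  L2 X v /\
  forall K, K \in cells M ->
    exists2 p, poly_space k p & forall r, cell_pts K r -> v r = p r.

(* Equality of elements of X_{h,k}. *)
Definition dg_eq (v w : vec3 R -> R) : Prop :=
  forall K, K \in cells M -> forall r, cell_pts K r -> v r = w r.

(* The space C_{h,1}. The value on the exterior of X is zero, for continuity as
   for the jumps on exterior faces: v, extended by zero, is continuous. *)
Definition cg_space (v : vec3 R -> R) : Prop :=
  dg_space 1 v /\
  exists g : vec3 R -> R,
    [/\ continuous g, dg_eq v g & forall r, ~ X r -> g r = 0].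

Definition cellwise_grad (v : vec3 R -> R) (r : vec3 R) : vec3 R :=
  \1_(\bigcup_(K in [set K | K \in cells M]) cell_pts K) r *: grad v r.

Definition is_L2_proj0 (f g : vec3 R -> R) : Prop :=
  dg_space 0 g /\
  forall w, dg_space 0 w -> volint X (fun r => (f r - g r) * w r) = 0.

Definition L2_proj0 (f : vec3 R -> R) : vec3 R -> R :=
  xget (fun=> 0) [set g | is_L2_proj0 f g].

End Spaces.

Section Faces.
Variables (R : realType) (M : mesh R).

Definition faces : {pred faceT M} :=
  [pred e | [exists K in cells M, face_of e K]].

(* A face of exactly one cell; interior faces are shared by two cells. *)
Definition exterior (e : faceT M) : bool :=
  #|[pred K in cells M | face_of e K]| == 1%N.

Definition ref_face : set (R * R) :=
  match kind M with
  | Cartesian => [set s | 0 < s.1 < 1 /\ 0 < s.2 < 1]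
  | Triangular => [set s | [/\ 0 < s.1, 0 < s.2 & s.1 + s.2 < 1]]
  end.

Definition face_map (e : faceT M) (s : R * R) : vec3 R :=
  (face_frame e).1.1 + s.1 *: (face_frame e).1.2 + s.2 *: (face_frame e).2.

(* The area of the parallelogram spanned by u and v (Gram determinant). *)
Definition area_factor (e : faceT M) : R :=
  let u := (face_frame e).1.2 in let v := (face_frame e).2 in
  Num.sqrt (dot u u * dot v v - dot u v ^+ 2).

Definition faceint (e : faceT M) (g : vec3 R -> R) : R :=
  area_factor e * \int[@lebesgue2 R]_(s in ref_face) g (face_map e s).

Definition unit_normals (X : set (vec3 R)) (n : faceT M -> vec3 R) : Prop :=
  forall e, e \in faces ->
    [/\ dot (n e) (n e) = 1,
        dot (n e) (face_frame e).1.2 = 0,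
        dot (n e) (face_frame e).2 = 0
      & exterior e -> forall r, (face_map e @` ref_face) r ->
          \forall eps \near 0^'+, X (r - eps *: n e) /\ ~ X (r + eps *: n e)].

Variable n : faceT M -> vec3 R.
Implicit Types v f : vec3 R -> R.

Definition trace_minus v (e : faceT M) (r : vec3 R) : R :=
  lim (v (r - eps *: n e) @[eps --> 0^'+]).

Definition trace_plus v (e : faceT M) (r : vec3 R) : R :=
  if exterior e then 0 else lim (v (r + eps *: n e) @[eps --> 0^'+]).

Definition jump v (e : faceT M) (r : vec3 R) : R :=
  trace_minus v e r - trace_plus v e r.

(* The case of a direction tangent to e is immaterial: upwind values only occur
   multiplied by the normal component of the direction. *)
Definition upwind (Om : vec3 R) f (e : faceT M) (r : vec3 R) : R :=
  if 0 < dot Om (n e) then trace_minus f e r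
  else if dot Om (n e) < 0 then trace_plus f e r else 0.

Definition face_flux (Om : vec3 R) f v : R :=
  \sum_(e in faces)
    faceint e (fun r => dot Om (n e) * upwind Om f e r * jump v e r).

End Faces.

Record quadrature (R : realType) := Quadrature {
  qsize : nat;
  dir : 'I_qsize -> vec3 R;
  wgt : 'I_qsize -> R;
  dir_sphere : forall i, dot (dir i) (dir i) = 1;
  wgt_gt0 : forall i, 0 < wgt i;
  moment0 : \sum_i wgt i = 4 * pi;
  moment1 : \sum_i wgt i *: dir i = 0;
  moment2 : \sum_i wgt i *: (\matrix_(a < 3, b < 3)
      (crd (dir i) a * crd (dir i) b)) = (4 * pi / 3)%:M }.

Notation angular Q R := ('I_(qsize Q) -> vec3 R -> R).

Section Angular.
Variables (R : realType) (X : set (vec3 R)) (M : mesh R) (Q : quadrature R).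

Definition ang_space k (f : angular Q R) : Prop :=
  forall i, dg_space X M k (f i).

Definition ang_avg (f : angular Q R) (r : vec3 R) : R :=
  (4 * pi)^-1 * \sum_i wgt i * f i r.

(* A linear operator from W_{h,0} to W_{h,1}, acting on representatives and
   compatible with the equality of these spaces. *)
Definition linear_reconstruction (Rec : angular Q R -> angular Q R) : Prop :=
  [/\ forall f, ang_space 0 f -> ang_space 1 (Rec f),
      forall f g, ang_space 0 f -> ang_space 0 g ->
        (forall i, dg_eq M (f i) (g i)) -> forall i, dg_eq M (Rec f i) (Rec g i)
    & forall (a : R) f g, ang_space 0 f -> ang_space 0 g ->
        forall i, dg_eq M (Rec (fun j r => a * f j r + g j r) i)
                          (fun r => a * Rec f i r + Rec g i r)].

End Angular.

(* Main.v *)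
From HB Require Import structures.
Require Import Defs.
From mathcomp Require Import all_boot all_order all_algebra.
From mathcomp Require Import all_classical all_reals all_analysis.
From mathcomp Require Import measurable_realfun ring lra.
Set Implicit Arguments.
Unset Strict Implicit.
Unset Printing Implicit Defensive.
Import Order.TTheory GRing.Theory Num.Theory.
Import numFieldNormedType.Exports.
Local Open Scope classical_set_scope.
Local Open Scope ring_scope.

(** The hypotheses are variational identities, and the unknowns are determined
    order by order through the choice of test functions.

    At order -1 the bilinear forms are weighted by sigma_t w_i > 0, so testing
    with the unknown itself gives f^{u,(0)} = 0 and f_i^{c,(0)} = Phi_c^{(0)} for
    every direction i ([mass_zero]). As sigma_t is constant on each cell, it
    cancels from the equation for f^{(0)}, which then characterizes the
    projection P_0 Phi_c^{(0)} ([L2_proj0_eq]). A linear reconstruction maps zero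
    to zero, so the uncollided flux of order 0 drops out, f^{u,(1)} = 0 by the
    same argument, and the uncollided flux of order 1 drops out as well.

    At order 0, the upwind flux splits into Omega . n v^- plus the jump of v
    weighted by max(0, - Omega . n) ([upwindE]). In the collided equation,
    tested with the isotropic function Phi_c^{(0)}, the vanishing first moment
    of the quadrature removes the volume terms and the first part of the flux.
    What remains is a sum over the faces of c_e times the integral of the
    squared jump of Phi_c^{(0)}, where c_e = sum_i w_i max(0, - Omega_i . n_e) is
    positive ([quadrature_inflow_gt0]). Hence Phi_c^{(0)} has no jumps and
    vanishes on the boundary ([jump_orthogonal]). Tested with Omega_i . phi, the
    second moments turn the same equation into the balance of
    - (4 pi / 3) int Phi_c^{(0)} div phi + int sigma_t J . phi and
    (4 pi / 3) sum_e int_e Phi_c^{(0),-} n . [[phi]]. In the absence of jumps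
    Phi^- [[phi]] = [[Phi phi]], and integration by parts on the cells ([green])
    gives the equation relating J and the gradient of Phi_c^{(0)}.

    At order 1, an isotropic test function in C_{h,1} has no jumps, not even on
    the boundary, so all the fluxes vanish ([flux_cg_eq0]). The uncollided
    equation says sigma_t Phi_u^{(2)} = P_0 qbar, and summing the collided
    equation over the directions gives the conservation equation.

    Behind this lies the divergence theorem on the cells, with the faces in
    their given parametrizations. A cell is the set where finitely many affine
    forms, one for each facet, are positive ([polyhedral]), and it can be swept
    out in three independent directions, each of which carries one facet to
    another one and is parallel to the remaining facets. Fubini's theorem and
    the fundamental theorem of calculus express the integral of a directional
    derivative by the integrals over these two facets ([integral_sweep],
    [cell_sweep]); this uses the change of variables formula for affine maps,
    obtained by decomposing them into shears ([substitution_affine_map]). Since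
    the sweep directions are dual to the gradients of the forms, the three
    identities combine into the divergence theorem ([cell_gauss]). For a box
    the sweeps are its edges, for a tetrahedron the edges P0 P1, P1 P2, P2 P3
    ([box_polyhedral], [simplex_polyhedral]). Comparing the gradients of the
    forms with the unit normals ([cell_normals]) and pairing the two sides of
    every face ([mesh_sides]) yields the formula on the mesh. *)

(** * Affine changes of variables in space *)

Section ChangeOfVariables.
Variable R : realType.
Local Notation mR := (measurableTypeR R).
Local Notation mu := (@lebesgue_measure R).
Local Open Scope ereal_scope.

Lemma lebesgue_measure_affine (c b : R) (A : set mR) : c != 0%R ->
  measurable A ->
  mu A = `|c|%:E * mu ((fun x : mR => (c * x + b)%R : mR) @^-1` A).
Proof.
move=> c0 mA.
have mphi : measurable_fun setT (fun x : mR => (c * x + b)%R : mR).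
  apply: measurable_funD => //; exact: measurable_funM.
pose nc : {nonneg R} := NngNum (normr_ge0 c).
pose pm : {measure set mR -> \bar R} :=
  measure_function_pushforward__canonical__measure_function_Measure mu mphi.
pose m' : {measure set mR -> \bar R} := mscale nc pm.
rewrite (lebesgue_measure_unique (mu := m')) //.
move=> _ [[x y]] _ <- /=.
rewrite /m' /mscale /= /pushforward lebesgue_measure_itv /= lte_fin.
have pre : (fun z : R => c * z + b)%R @^-1` `]x, y]%classic =
  if (0 < c)%R then `](x - b) / c, (y - b) / c]%classic%R
  else `[(y - b) / c, (x - b) / c[%classic%R.
  have [cs|cs] := ltP 0%R c.
    apply/seteqP; split => z; rewrite /= !in_itv /=.
    - by rewrite ltr_pdivrMr// ler_pdivlMr// ltrBlDr lerBrDr mulrC.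
    - by rewrite ltr_pdivrMr// ler_pdivlMr// ltrBlDr lerBrDr mulrC.
  have {}cs : (c < 0)%R by rewrite lt_neqAle c0.
  apply/seteqP; split => z; rewrite /= !in_itv /=.
  - by rewrite ltr_ndivlMr// ler_ndivrMr// ltrBlDr lerBrDr mulrC andbC.
  - by rewrite ltr_ndivlMr// ler_ndivrMr// ltrBlDr lerBrDr mulrC andbC.
rewrite [X in mu X]pre.
have [cs|cs] := ltP 0%R c; rewrite lebesgue_measure_itv /= lte_fin.
  rewrite ltr_pM2r ?invr_gt0// ltrD2r; case: ifP => _; last by rewrite mule0.
  rewrite -EFinB -EFinB -EFinM gtr0_norm//; congr EFin; field.
  by rewrite c0.
have {}cs : (c < 0)%R by rewrite lt_neqAle c0.
rewrite ltr_nM2r ?invr_lt0// ltrD2r; case: ifP => _; last by rewrite mule0.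
rewrite -EFinB -EFinB -EFinM ltr0_norm//; congr EFin; field.
by rewrite c0.
Qed.

Lemma integral_affine (c b : R) (f : mR -> \bar R) : c != 0%R ->
  measurable_fun setT f -> (forall x, 0 <= f x) ->
  \int[mu]_x f x = `|c|%:E * \int[mu]_x f (c * x + b)%R.
Proof.
move=> c0 mf f0.
have mphi : measurable_fun setT (fun x : mR => (c * x + b)%R : mR).
  apply: measurable_funD => //; exact: measurable_funM.
pose nc : {nonneg R} := NngNum (normr_ge0 c).
pose pm : {measure set mR -> \bar R} :=
  measure_function_pushforward__canonical__measure_function_Measure mu mphi.
pose m' : {measure set mR -> \bar R} := mscale nc pm.
rewrite (eq_measure_integral m'); last first.
  by move=> A mA _; exact: lebesgue_measure_affine.
rewrite ge0_integral_mscale//; congr (_ * _).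
by rewrite ge0_integral_pushforward.
Qed.

(** Tonelli's theorem over the third coordinate requires the sigma-finiteness of
    Lebesgue measure on the plane. *)
Definition plane_measure : set (mR * mR)%type -> \bar R := (mu \x mu).

Lemma plane_measure_sigma_finite : sigma_finite setT plane_measure.
Proof.
by case: (lebesgue_integral_fubini.measure_function_Measure_isSigmaFinite__to__measure_function_isSigmaFinite mu mu).
Qed.
HB.instance Definition _ := Measure.copy plane_measure (mu \x mu).
HB.instance Definition _ :=
  Measure_isSigmaFinite.Build _ _ _ plane_measure plane_measure_sigma_finite.

Lemma lebesgue3_fubini1 (f : mvec3 R -> \bar R) : measurable_fun setT f ->
  (forall x, 0 <= f x) ->
  \int[lebesgue3 R]_x f x = \int[lebesgue2 R]_p \int[mu]_z f (p, z).
Proof. exact: (@fubini_tonelli1 _ _ _ _ R plane_measure mu f). Qed.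

Lemma lebesgue3_fubini2 (f : mvec3 R -> \bar R) : measurable_fun setT f ->
  (forall x, 0 <= f x) ->
  \int[lebesgue3 R]_x f x = \int[mu]_z \int[lebesgue2 R]_p f (p, z).
Proof. exact: (@fubini_tonelli2 _ _ _ _ R plane_measure mu f). Qed.

Lemma lebesgue2_fubini1 (f : mR * mR -> \bar R) : measurable_fun setT f ->
  (forall x, 0 <= f x) ->
  \int[lebesgue2 R]_p f p = \int[mu]_x \int[mu]_y f (x, y).
Proof. exact: (@fubini_tonelli1 _ _ _ _ R mu mu f). Qed.

Lemma lebesgue2_fubini2 (f : mR * mR -> \bar R) : measurable_fun setT f ->
  (forall x, 0 <= f x) ->
  \int[lebesgue2 R]_p f p = \int[mu]_y \int[mu]_x f (x, y).
Proof. exact: (@fubini_tonelli2 _ _ _ _ R mu mu f). Qed.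

(** Restricting to nonnegative functions makes substitutions compose without
    integrability conditions; [substitution_integral] covers signed functions. *)
Definition substitution (T : mvec3 R -> mvec3 R) (c : R) :=
  [/\ (0 <= c)%R, measurable_fun setT T &
  forall f : mvec3 R -> \bar R, measurable_fun setT f -> (forall x, 0 <= f x) ->
    \int[lebesgue3 R]_x f x = c%:E * \int[lebesgue3 R]_x f (T x)].

Lemma substitution_comp S T c d : substitution S c -> substitution T d ->
  substitution (S \o T) (c * d)%R.
Proof.
move=> [c0 mS hS] [d0 mT hT]; split; first exact: mulr_ge0.
  exact: measurableT_comp.
move=> f mf f0; rewrite hS// EFinM -muleA; congr (_ * _).
by rewrite hT//; exact: measurableT_comp.
Qed.

Lemma substitution_z (c : R) (b : mR * mR -> mR) : c != 0%R ->
  measurable_fun setT b ->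
  substitution (fun r => (r.1, c * r.2 + b r.1)%R) `|c|.
Proof.
move=> c0 mb.
have mT : measurable_fun setT
    (fun r : mvec3 R => (r.1, c * r.2 + b r.1)%R : mvec3 R).
  apply/measurable_fun_pair => //=; apply: measurable_funD.
    exact: measurable_funM.
  exact: measurableT_comp.
split => // f mf f0.
have mg := measurableT_comp mf mT.
rewrite (lebesgue3_fubini1 mf f0) (lebesgue3_fubini1 mg (fun _ => f0 _)).
rewrite -ge0_integralZl//; last 2 first.
- exact: measurable_fun_fubini_tonelli_F mg (fun _ => f0 _).
- by move=> x _; apply: integral_ge0 => y _; exact: f0.
apply: eq_integral => p _; rewrite /fubini_F /=.
rewrite (@integral_affine c (b p))//.
exact: measurableT_comp mf (measurable_pair1 p).
Qed.

Lemma substitution_ext S T c d : S =1 T -> c = d ->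
  substitution S c -> substitution T d.
Proof. by move=> /funext -> ->. Qed.

Lemma substitution_y (c : R) (b : mR * mR -> mR) : c != 0%R ->
  measurable_fun setT b ->
  substitution (fun r => (r.1.1, c * r.1.2 + b (r.1.1, r.2), r.2)%R) `|c|.
Proof.
move=> c0 mb.
have mT : measurable_fun setT (fun r : mvec3 R =>
    (r.1.1, c * r.1.2 + b (r.1.1, r.2), r.2)%R : mvec3 R).
  apply/measurable_fun_pair => //=; apply/measurable_fun_pair => //=.
    exact: measurableT_comp.
  apply: measurable_funD.
    by apply: measurable_funM => //; exact: measurableT_comp.
  apply: measurableT_comp => //; apply/measurable_fun_pair => //=.
  exact: measurableT_comp.
split => // f mf f0.
have mg := measurableT_comp mf mT.
rewrite (lebesgue3_fubini2 mf f0) (lebesgue3_fubini2 mg (fun _ => f0 _)).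
rewrite -ge0_integralZl//; last 2 first.
- exact: (@measurable_fun_fubini_tonelli_G _ _ _ _ R plane_measure _ mg (fun _ => f0 _)).
- by move=> x _; apply: integral_ge0 => y _; exact: f0.
apply: eq_integral => z _; rewrite /fubini_G /=.
have mfz : measurable_fun setT (fun p : mR * mR => f (p, z)).
  exact: measurableT_comp mf (measurable_pair2 z).
have mgz : measurable_fun setT (fun p : mR * mR =>
    f (p.1, (c * p.2 + b (p.1, z))%R, z)).
  exact: measurableT_comp (measurableT_comp mf mT) (measurable_pair2 z).
rewrite (lebesgue2_fubini1 mfz (fun _ => f0 _)).
rewrite (lebesgue2_fubini1 mgz (fun _ => f0 _)).
rewrite -ge0_integralZl//; last 2 first.
- exact: measurable_fun_fubini_tonelli_F mgz (fun _ => f0 _).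
- by move=> x _; apply: integral_ge0 => y _; exact: f0.
apply: eq_integral => x _; rewrite /fubini_F /=.
rewrite (@integral_affine c (b (x, z)))//.
exact: measurableT_comp mfz (measurable_pair1 x).
Qed.

Lemma substitution_x (c : R) (b : mR * mR -> mR) : c != 0%R ->
  measurable_fun setT b ->
  substitution (fun r => (c * r.1.1 + b (r.1.2, r.2), r.1.2, r.2)%R) `|c|.
Proof.
move=> c0 mb.
have mT : measurable_fun setT (fun r : mvec3 R =>
    (c * r.1.1 + b (r.1.2, r.2), r.1.2, r.2)%R : mvec3 R).
  apply/measurable_fun_pair => //=; apply/measurable_fun_pair => //=; last first.
    exact: measurableT_comp.
  apply: measurable_funD.
    by apply: measurable_funM => //; exact: measurableT_comp.
  apply: measurableT_comp => //; apply/measurable_fun_pair => //=.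
  exact: measurableT_comp.
split => // f mf f0.
have mg := measurableT_comp mf mT.
rewrite (lebesgue3_fubini2 mf f0) (lebesgue3_fubini2 mg (fun _ => f0 _)).
rewrite -ge0_integralZl//; last 2 first.
- exact: (@measurable_fun_fubini_tonelli_G _ _ _ _ R plane_measure _ mg (fun _ => f0 _)).
- by move=> x _; apply: integral_ge0 => y _; exact: f0.
apply: eq_integral => z _; rewrite /fubini_G /=.
have mfz : measurable_fun setT (fun p : mR * mR => f (p, z)).
  exact: measurableT_comp mf (measurable_pair2 z).
have mgz : measurable_fun setT (fun p : mR * mR =>
    f ((c * p.1 + b (p.2, z))%R, p.2, z)).
  exact: measurableT_comp (measurableT_comp mf mT) (measurable_pair2 z).
rewrite (lebesgue2_fubini2 mfz (fun _ => f0 _)).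
rewrite (lebesgue2_fubini2 mgz (fun _ => f0 _)).
rewrite -ge0_integralZl//; last 2 first.
- exact: measurable_fun_fubini_tonelli_G mgz (fun _ => f0 _).
- by move=> x _; apply: integral_ge0 => y _; exact: f0.
apply: eq_integral => y _; rewrite /fubini_G /=.
rewrite (@integral_affine c (b (y, z)))//.
exact: measurableT_comp mfz (measurable_pair2 y).
Qed.

Lemma measurable_affine2 (p q s : R) :
  measurable_fun setT (fun r : mR * mR => (p * r.1 + q * r.2 + s)%R : mR).
Proof.
by apply: measurable_funD => //; apply: measurable_funD => //;
  apply: measurable_funM.
Qed.
Local Open Scope ring_scope.

(** An LU decomposition: with a nonzero lower right entry, the map is a shear
    along the second axis followed by one along the first. *)
Let affine_xy_pivot (k0 l0 al be ka ga de la : R) :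
  de != 0 -> al * de - be * ga != 0 ->
  substitution (fun r : mvec3 R =>
    (al * r.1.1 + be * r.1.2 + ka * r.2 + k0,
     ga * r.1.1 + de * r.1.2 + la * r.2 + l0, r.2)) `|al * de - be * ga|.
Proof.
move=> de0 det0.
have c0 : al - be * ga / de != 0.
  apply: contra_neq det0 => h.
  by rewrite -[LHS]mulr1 -(divff de0) mulrCA mulrBl -mulrA mulrC -!mulrA;
    move/eqP: h; rewrite subr_eq0 => /eqP ->; field.
have h2 := substitution_y de0 (measurable_affine2 ga la l0).
have h1 := substitution_x c0
  (measurable_affine2 (be / de) (ka - be / de * la) (k0 - be / de * l0)).
apply: substitution_ext (substitution_comp h1 h2).
  by case=> [[x y] z] /=; congr (_, _, _); [field | ring].
by rewrite -normrM; congr `| _ |; field.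
Qed.

(** If the pivot vanishes, splitting off the shear (x, y) |-> (x - y, y) on the
    right replaces it by the entry to its left, which is then nonzero. *)
Let affine_xy (k0 l0 al be ka ga de la : R) :
  al * de - be * ga != 0 ->
  substitution (fun r : mvec3 R =>
    (al * r.1.1 + be * r.1.2 + ka * r.2 + k0,
     ga * r.1.1 + de * r.1.2 + la * r.2 + l0, r.2)) `|al * de - be * ga|.
Proof.
move=> det0; have [de0|] := eqVneq de 0; last by move=> ?; exact: affine_xy_pivot.
have ga0 : ga + de != 0.
  by apply: contra_neq det0; rewrite de0 addr0 => ->; rewrite !mulr0 subrr.
have det' : al * (ga + de) - (al + be) * ga != 0.
  by rewrite (_ : _ - _ = al * de - be * ga)//; ring.
have h1 := affine_xy_pivot k0 l0 ka la ga0 det'.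
have h2 := substitution_x (oner_neq0 R) (measurable_affine2 (-1) 0 0).
apply: substitution_ext (substitution_comp h1 h2).
  by case=> [[x y] z] /=; congr (_, _, _); ring.
by rewrite normr1 mulr1; congr `| _ |; ring.
Qed.

Definition det3 (u v w : vec3 R) : R :=
  u.1.1 * (v.1.2 * w.2 - v.2 * w.1.2) - v.1.1 * (u.1.2 * w.2 - u.2 * w.1.2)
  + w.1.1 * (u.1.2 * v.2 - u.2 * v.1.2).

Definition affine_map (a u v w : vec3 R) (r : mvec3 R) : mvec3 R :=
  a + r.1.1 *: u + r.1.2 *: v + r.2 *: w.

Lemma affine_mapE a u v w x y z : affine_map a u v w (x, y, z) =
  (a.1.1 + x * u.1.1 + y * v.1.1 + z * w.1.1,
   a.1.2 + x * u.1.2 + y * v.1.2 + z * w.1.2,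
   a.2 + x * u.2 + y * v.2 + z * w.2).
Proof. by []. Qed.

(** Elimination along the third axis, with pivot the third coordinate of [w],
    leaves an affine map that fixes the third coordinate. *)
Let affine_map_pivot (a u v w : vec3 R) : w.2 != 0 -> det3 u v w != 0 ->
  substitution (affine_map a u v w) `|det3 u v w|.
Proof.
case: a u v w => [[a1 a2] a3] [[u1 u2] u3] [[v1 v2] v3] [[w1 w2] w3] /= w0 det0.
have h3 := substitution_z w0 (measurable_affine2 u3 v3 a3).
have det' : (u1 - w1 / w3 * u3) * (v2 - w2 / w3 * v3) -
    (v1 - w1 / w3 * v3) * (u2 - w2 / w3 * u3) != 0.
  apply: contra_neq det0 => h.
  rewrite /det3 /=; transitivity (w3 *
   ((u1 - w1 / w3 * u3) * (v2 - w2 / w3 * v3) -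
    (v1 - w1 / w3 * v3) * (u2 - w2 / w3 * u3))); last by rewrite h mulr0.
  by field.
have h := affine_xy (a1 - w1 / w3 * a3) (a2 - w2 / w3 * a3) (w1 / w3) (w2 / w3)
  det'.
apply: substitution_ext (substitution_comp h h3).
  case=> [[x y] z]; congr (_, _, _); rewrite /= /GRing.scale /=; by [field|ring].
by rewrite -normrM; congr `| _ |; rewrite /det3 /=; field.
Qed.

(** If [w] offers no pivot, adding [u] or [v] to it creates one and preserves the
    determinant; this amounts to precomposing with a shear. *)
Lemma substitution_affine_map (a u v w : vec3 R) : det3 u v w != 0 ->
  substitution (affine_map a u v w) `|det3 u v w|.
Proof.
move=> det0; have [w0|] := eqVneq w.2 0; last by move=> ?; exact: affine_map_pivot.
have [v0|v0] := eqVneq v.2 0.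
  have u0 : (w + u).2 != 0.
    apply: contra_neq det0 => /=; rewrite w0 add0r /det3 v0 w0 => ->; ring.
  have det' : det3 u v (w + u) = det3 u v w by rewrite /det3 /=; ring.
  rewrite -det' in det0.
  have h2 := substitution_x (oner_neq0 R) (measurable_affine2 0 (-1) 0).
  apply: substitution_ext (substitution_comp (affine_map_pivot a u0 det0) h2).
    case=> [[x y] z]; rewrite /= !affine_mapE.
    by congr (_, _, _); rewrite /=; ring.
  by rewrite normr1 mulr1 det'.
have v0' : (w + v).2 != 0 by rewrite /= w0 add0r.
have det' : det3 u v (w + v) = det3 u v w by rewrite /det3 /=; ring.
rewrite -det' in det0.
have h2 := substitution_y (oner_neq0 R) (measurable_affine2 0 (-1) 0).
apply: substitution_ext (substitution_comp (affine_map_pivot a v0' det0) h2).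
  case=> [[x y] z]; rewrite /= !affine_mapE.
  by congr (_, _, _); rewrite /=; ring.
by rewrite normr1 mulr1 det'.
Qed.

End ChangeOfVariables.

(** * Polynomial functions and their integrals along a direction *)

Section Polynomials.
Variable R : realType.
Local Notation mR := (measurableTypeR R).
Implicit Types (f g : vec3 R -> R) (r w : vec3 R).

(** An inductive presentation, so that continuity, measurability, boundedness and
    the existence of polynomial derivatives are proved by structural
    induction. *)
Inductive polyfun : (vec3 R -> R) -> Prop :=
| polyfun_cst c : polyfun (fun=> c)
| polyfun_crd i : polyfun (fun r => crd r i)
| polyfunD f g : polyfun f -> polyfun g -> polyfun (fun r => f r + g r)
| polyfunM f g : polyfun f -> polyfun g -> polyfun (fun r => f r * g r).

Lemma polyfunN f : polyfun f -> polyfun (fun r => - f r).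
Proof.
by move=> pf; have := polyfunM (polyfun_cst (-1)) pf;
  under eq_fun do rewrite mulN1r.
Qed.

Lemma polyfunB f g : polyfun f -> polyfun g -> polyfun (fun r => f r - g r).
Proof. by move=> pf pg; apply: polyfunD pf (polyfunN pg). Qed.

Lemma polyfun_sum (I : Type) (s : seq I) (P : pred I) (F : I -> vec3 R -> R) :
  (forall i, P i -> polyfun (F i)) -> polyfun (fun r => \sum_(i <- s | P i) F i r).
Proof.
move=> pF; elim: s => [|i s ih].
  by under eq_fun do rewrite big_nil; exact: polyfun_cst.
under eq_fun do rewrite big_cons.
by case: (boolP (P i)) => Pi //; apply: polyfunD => //; exact: pF.
Qed.

Lemma polyfunX f n : polyfun f -> polyfun (fun r => f r ^+ n).
Proof.
move=> pf; elim: n => [|n ih].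
  by under eq_fun do rewrite expr0; exact: polyfun_cst.
by under eq_fun do rewrite exprS; exact: polyfunM.
Qed.

Lemma poly_space_polyfun (M : mesh R) k p : poly_space M k p -> polyfun p.
Proof.
case=> c cE; rewrite (funext cE); apply: polyfun_sum => al _.
apply: polyfunM; first exact: polyfun_cst.
under eq_fun do rewrite !big_ord_recl big_ord0.
by do ?apply: polyfunM => //; do 1?[apply: polyfunX; exact: polyfun_crd];
  exact: polyfun_cst.
Qed.

Lemma crd0 r : crd r 0 = r.1.1. Proof. by []. Qed.
Lemma crd1 r : crd r 1 = r.1.2. Proof. by []. Qed.
Lemma crd2 r : crd r 2 = r.2. Proof. by []. Qed.

Lemma I3_ind (P : 'I_3 -> Prop) : P 0 -> P 1 -> P 2 -> forall i, P i.
Proof.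
move=> P0 P1 P2 [[|[|[|//]]] lti].
- by rewrite (_ : Ordinal _ = 0)//; exact: val_inj.
- by rewrite (_ : Ordinal _ = 1)//; exact: val_inj.
- by rewrite (_ : Ordinal _ = 2)//; exact: val_inj.
Qed.

Lemma crdD r w i : crd (r + w) i = crd r i + crd w i.
Proof. by elim/I3_ind: i. Qed.

Lemma crdZ c r i : crd (c *: r) i = c * crd r i.
Proof. by elim/I3_ind: i. Qed.

Lemma crdN r i : crd (- r) i = - crd r i.
Proof. by elim/I3_ind: i. Qed.

Lemma crdB r w i : crd (r - w) i = crd r i - crd w i.
Proof. by rewrite crdD crdN. Qed.

Lemma crd_basis i j : crd (Defs.basis R i) j = (j == i)%:R.
Proof. by elim/I3_ind: j. Qed.

Lemma continuous_crd i : continuous (fun r => crd r i).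
Proof.
elim/I3_ind: i => r.
- by apply: continuous_comp; [exact: cvg_fst | exact: cvg_fst].
- by apply: continuous_comp; [exact: cvg_fst | exact: cvg_snd].
- exact: cvg_snd.
Qed.

Lemma polyfun_continuous f : polyfun f -> continuous f.
Proof.
elim=> [c|i|{}f g _ ihf _ ihg|{}f g _ ihf _ ihg] r.
- exact: cvg_cst.
- exact: continuous_crd.
- by apply: continuousD; [exact: ihf | exact: ihg].
- by apply: continuousM; [exact: ihf | exact: ihg].
Qed.

Lemma polyfun_measurable (D : set (mvec3 R)) f : polyfun f -> measurable_fun D f.
Proof.
elim=> [c|i|{}f g _ ihf _ ihg|{}f g _ ihf _ ihg].
- exact: measurable_cst.
- apply: measurable_funTS; elim/I3_ind: i.
  + exact: measurableT_comp.
  + exact: measurableT_comp.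
  + exact: measurable_snd.
- exact: measurable_funD.
- exact: measurable_funM.
Qed.

Lemma is_derive_crd r w i : is_derive r w (fun r => crd r i) (crd w i).
Proof.
have h : (fun h : R => h^-1 *: (crd (h *: w + r) i - crd r i)) @ 0^' --> crd w i.
  apply: cvg_near_cst; near=> h.
  rewrite crdD crdZ addrK; apply: mulKf.
  by near: h; exact: nbhs_dnbhs_neq.
apply: DeriveDef; first by apply/cvg_ex; exists (crd w i).
exact: cvg_lim h.
Unshelve. all: by end_near. Qed.

Lemma polyfun_derive f : polyfun f -> exists2 G : 'I_3 -> vec3 R -> R,
  forall i, polyfun (G i) &
  forall r w, is_derive r w f (\sum_(i < 3) crd w i * G i r).
Proof.
elim=> [c|i|{}f g _ [F pF hF] pg [G pG hG]|{}f g pf [F pF hF] pg [G pG hG]].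
- exists (fun _ _ => 0); first by move=> ?; exact: polyfun_cst.
  move=> r w; rewrite big1; first exact: is_derive_cst.
  by move=> *; rewrite mulr0.
- exists (fun j _ => (j == i)%:R); first by move=> ?; exact: polyfun_cst.
  move=> r w; rewrite (_ : \sum_(_ < _) _ = crd w i); first exact: is_derive_crd.
  rewrite (bigD1 i)//= eqxx mulr1 big1 ?addr0// => j /negPf ->.
  by rewrite mulr0.
- exists (fun i r => F i r + G i r); first by move=> i; exact: polyfunD.
  move=> r w; rewrite (_ : \sum_(_ < _) _ =
      \sum_(i < 3) crd w i * F i r + \sum_(i < 3) crd w i * G i r); last first.
    by rewrite -big_split; apply: eq_bigr => i _; rewrite mulrDr.
  by have ? := hF r w; have ? := hG r w; apply: is_deriveD.
- exists (fun i r => f r * G i r + g r * F i r).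
    by move=> i; apply: polyfunD; exact: polyfunM.
  move=> r w; rewrite (_ : \sum_(_ < _) _ =
      f r *: (\sum_(i < 3) crd w i * G i r) +
      g r *: (\sum_(i < 3) crd w i * F i r)); last first.
    rewrite !scaler_sumr -big_split; apply: eq_bigr => i _ /=.
    by rewrite /GRing.scale /=; ring.
  by have ? := hF r w; have ? := hG r w; apply: is_deriveM.
Qed.

Definition bounded3 (K : set (vec3 R)) :=
  exists C : R, forall r i, K r -> `|crd r i| <= C.

Lemma polyfun_bounded (K : set (vec3 R)) f : bounded3 K -> polyfun f ->
  exists C : R, forall r, K r -> `|f r| <= C.
Proof.
move=> [C hC]; elim=> [c|i|{}f g _ [F hF] _ [G hG]|{}f g _ [F hF] _ [G hG]].
- by exists `|c|.
- by exists C => r Kr; exact: hC.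
- exists (F + G) => r Kr.
  by apply: le_trans (ler_normD _ _) _; apply: lerD; [exact: hF|exact: hG].
- by exists (F * G) => r Kr; rewrite normrM ler_pM// ?hF ?hG.
Qed.

Lemma bounded3_finite (K : set (mvec3 R)) : bounded3 K -> measurable K ->
  (lebesgue3 R K < +oo)%E.
Proof.
move=> [C hC] mK.
pose I : set mR := `[-C, C]%classic.
have mI : measurable I by exact: measurable_itv.
apply: (@le_lt_trans _ _ (lebesgue3 R (I `*` I `*` I))).
  apply: le_measure; rewrite ?inE//.
    by apply: measurableX => //; exact: measurableX.
  move=> r Kr; have h i := hC r i Kr.
  by split; first split; rewrite /I /= in_itv /= -ler_norml;
    [exact: (h 0)|exact: (h 1)|exact: (h 2)].
have -> : lebesgue3 R (I `*` I `*` I) =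
    (lebesgue_measure I * lebesgue_measure I * lebesgue_measure I)%E.
  apply: etrans; first by apply: product_measure1E => //; exact: measurableX.
  by congr (_ * _)%E; exact: product_measure1E.
rewrite /I lebesgue_measure_itv /=.
by case: ifP => _; rewrite ?mul0e ?ltry// -EFinM -EFinM ltry.
Qed.

Lemma polyfun_integrable (K : set (mvec3 R)) f : bounded3 K -> measurable K ->
  polyfun f -> (lebesgue3 R).-integrable K (EFin \o f).
Proof.
move=> bK mK pf; have [C hC] := polyfun_bounded bK pf.
apply: (@le_integrable _ _ _ _ _ mK _ (EFin \o cst C)).
- by apply/measurable_EFinP; exact: polyfun_measurable.
- by move=> r Kr /=; rewrite lee_fin (le_trans (hC r Kr))// ler_norm.
- apply/integrableP; split; first exact/measurable_EFinP/measurable_cst.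
  rewrite (eq_integral (cst `|C|%:E))// integral_cst//.
  by rewrite lte_mul_pinfty// bounded3_finite.
Qed.

Lemma substitution_integral (T : mvec3 R -> mvec3 R) c (F : mvec3 R -> \bar R) :
  substitution T c -> 0 < c -> (lebesgue3 R).-integrable setT F ->
  (lebesgue3 R).-integrable setT (F \o T) /\
  (\int[lebesgue3 R]_x F x = c%:E * \int[lebesgue3 R]_x F (T x))%E.
Proof.
move=> [_ mT hT] c0 intF; have mF := measurable_int _ intF.
have iFT : (lebesgue3 R).-integrable setT (F \o T).
  apply/integrableP; split; first exact: measurableT_comp.
  have /integrableP[_] := intF.
  rewrite (hT (fun x => `|F x|)%E)//; last exact: measurableT_comp.
  move=> h; rewrite -(@lte_pmul2l _ c%:E) ?lte_fin//.
  by rewrite gt0_muley ?lte_fin.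
split => //.
have pos := integrable_pos_fin_num measurableT iFT.
have neg := integrable_neg_fin_num measurableT iFT.
transitivity (c%:E * (\int[lebesgue3 R]_x (F \o T)^\+ x -
    \int[lebesgue3 R]_x (F \o T)^\- x))%E; last first.
  by congr (_ * _)%E; rewrite [RHS]integralE.
rewrite muleBr//; last exact: fin_num_adde_defr.
rewrite [LHS]integralE (funepos_comp F T) (funeneg_comp F T); congr (_ - _)%E.
  exact: (hT F^\+%E (measurable_funepos mF) (fun x => funepos_ge0 F x)).
exact: (hT F^\-%E (measurable_funeneg mF) (fun x => funeneg_ge0 F x)).
Qed.

(** The affine change of variables with frame ([u], [v], [w]) and Fubini's theorem
    reduce the claim to the fundamental theorem of calculus along [w]. *)
Lemma integral_sweep (a u v w : vec3 R) (B : set (mR * mR)%type) (h : R * R -> R)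
    (K : set (mvec3 R)) (g G : vec3 R -> R) :
  det3 u v w != 0 -> measurable B -> measurable K -> bounded3 K ->
  (forall s, B s -> 0 < h s) ->
  (forall s z, K (affine_map a u v w (s, z)) <-> B s /\ 0 < z < h s) ->
  polyfun G -> (forall r, is_derive r w g (G r)) ->
  volint K G = `|det3 u v w| * \int[lebesgue2 R]_(s in B)
    (g (a + s.1 *: u + s.2 *: v + h s *: w) - g (a + s.1 *: u + s.2 *: v)).
Proof.
move=> det0 mB mK bK h0 KE pG dG.
have iG := polyfun_integrable bK mK pG.
pose F : mvec3 R -> \bar R := (EFin \o G) \_ K.
have iF : (lebesgue3 R).-integrable setT F.
  by apply/integrable_restrict => //; rewrite setTI.
have D0 : 0 < `|det3 u v w| by rewrite normr_gt0.
have [iFT FTE] := substitution_integral (substitution_affine_map a det0) D0 iF.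
rewrite /volint /Rintegral integral_mkcond FTE.
rewrite fineM//; last exact: integral_fune_fin_num.
congr (_ * fine _).
have <- := @integral12_prod_meas1 _ _ _ _ R (@plane_measure R)
  (@lebesgue_measure R) _ iFT.
rewrite [RHS]integral_mkcond; apply: eq_integral => s _.
rewrite /fubini_F /= patchE; case: ifPn => [/set_mem Bs|/negP Bs]; last first.
  rewrite integral0_eq// => z _; rewrite /F /= patchE.
  by case: ifPn => // /set_mem /KE[/mem_set].
pose I : set mR := `]0, h s[%classic.
transitivity (\int[lebesgue_measure]_z
    ((fun z : mR => (G (affine_map a u v w (s, z)))%:E) \_ I) z)%E.
  apply: eq_integral => z _; rewrite /F /= !patchE.
  have -> // : (affine_map a u v w (s, z) \in K) = (z \in I).
  apply/idP/idP => /set_mem.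
    by move/KE => [_ hz]; apply/mem_set; rewrite /I /= in_itv.
  by rewrite /I /= in_itv /= => hz; apply/mem_set/KE.
rewrite -integral_mkcond.
pose p := a + s.1 *: u + s.2 *: v.
have ga z : affine_map a u v w (s, z) = p + z *: w by [].
have cont (f : vec3 R -> R) : polyfun f -> continuous (fun z : R => f (p + z *: w)).
  move=> pf z; apply: (@continuous_comp _ _ _ (fun z : R => p + z *: w) f).
    apply: cvgD; first exact: cvg_cst.
    by apply: cvgZr_tmp; exact: cvg_id.
  exact: polyfun_continuous.
rewrite -/p.
have dg z : is_derive z (1 : R) (fun z : R => g (p + z *: w)) (G (p + z *: w)).
  have [dr <-] := dG (p + z *: w).
  have E : (fun t : R => t^-1 *: (g (p + (t *: 1 + z) *: w) - g (p + z *: w))) =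
      (fun t => t^-1 *: (g (t *: w + (p + z *: w)) - g (p + z *: w))).
    apply/funext => t; congr (_ *: (g _ - _)).
    by rewrite scalerDl scaler1 addrCA.
  by split; rewrite /derivable /derive /= E.
have cg : continuous (fun z : R => g (p + z *: w)).
  move=> z; apply: differentiable_continuous; apply/derivable1_diffP.
  exact: (@ex_derive _ _ _ _ _ _ _ (dg z)).
have := @continuous_FTC2 R (fun z => G (p + z *: w)) (fun z => g (p + z *: w))
  0 (h s) (h0 _ Bs).
rewrite scale0r addr0 EFinB => <-.
- rewrite -(@integral_itv_bndoo _ 0 (h s) _ true false) //.
  apply/measurable_EFinP; apply: measurable_funTS.
  by apply: continuous_measurable_fun; exact: cont.
- exact/continuous_subspaceT/cont.
- split.
  + by move=> z _; exact: (@ex_derive _ _ _ _ _ _ _ (dg z)).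
  + exact/cvg_at_right_filter/cg.
  + exact/cvg_at_left_filter/cg.
- by move=> z _; rewrite derive1E; exact: derive_val.
Qed.

End Polynomials.

(** * Normal vectors and planes *)

Section Geometry.
Variable R : realType.
Local Notation mR := (measurableTypeR R).
Implicit Types (r x y u v w a n : vec3 R).

Lemma dotE x y : dot x y = x.1.1 * y.1.1 + x.1.2 * y.1.2 + x.2 * y.2.
Proof. by rewrite /dot !big_ord_recl big_ord0 /= addr0 addrA. Qed.

Lemma vec3P x y : x.1.1 = y.1.1 -> x.1.2 = y.1.2 -> x.2 = y.2 -> x = y.
Proof. by case: x y => [[? ?] ?] [[? ?] ?] /= -> -> ->. Qed.

Lemma dotDr a x y : dot a (x + y) = dot a x + dot a y.
Proof. by rewrite !dotE /=; ring. Qed.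

Lemma dotZr a c x : dot a (c *: x) = c * dot a x.
Proof. by rewrite !dotE /= /GRing.scale /=; ring. Qed.

Lemma dotZl a c x : dot (c *: a) x = c * dot a x.
Proof. by rewrite !dotE /= /GRing.scale /=; ring. Qed.

Lemma dotBr a x y : dot a (x - y) = dot a x - dot a y.
Proof. by rewrite !dotE /=; ring. Qed.

Lemma dotC x y : dot x y = dot y x.
Proof. by rewrite !dotE; ring. Qed.

Lemma dot_gt0 x : x != 0 -> 0 < dot x x.
Proof.
move=> x0; rewrite lt_neqAle dotE -!expr2 !addr_ge0 ?sqr_ge0// andbT eq_sym.
apply: contra_neq x0 => /eqP.
rewrite paddr_eq0 ?addr_ge0 ?sqr_ge0// paddr_eq0 ?sqr_ge0// !sqrf_eq0.
by move=> /andP[/andP[/eqP ? /eqP ?] /eqP ?]; exact: vec3P.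
Qed.

Definition cross u v : vec3 R :=
  (u.1.2 * v.2 - u.2 * v.1.2, u.2 * v.1.1 - u.1.1 * v.2,
   u.1.1 * v.1.2 - u.1.2 * v.1.1).

(** Both [n] and [a] are parallel to [cross u v], whose length is the Gram area;
    comparing lengths leaves only a sign open. *)
Lemma unit_normal_sign u v n a (D area : R) :
  area = Num.sqrt (dot u u * dot v v - dot u v ^+ 2) ->
  dot n n = 1 -> dot n u = 0 -> dot n v = 0 -> 0 < D -> a != 0 ->
  D *: a = cross u v \/ D *: a = - cross u v ->
  exists2 s : R, s = 1 \/ s = -1 & (s * area) *: n = - (D *: a).
Proof.
move=> areaE nn nu nv D0 a0 Da.
set c := cross u v in Da *.
have c0 : c != 0.
  have : D *: a != 0 by rewrite scaler_eq0 negb_or gt_eqF.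
  by case: Da => ->; rewrite ?oppr_eq0.
have gramE : dot u u * dot v v - dot u v ^+ 2 = dot c c.
  by rewrite !dotE /c /cross /=; ring.
rewrite gramE in areaE.
have area0 : 0 < area by rewrite areaE sqrtr_gt0 dot_gt0.
have area2 : area ^+ 2 = dot c c by rewrite areaE sqr_sqrtr// ltW// dot_gt0.
have nc : dot c c *: n = dot n c *: c.
  have [e1 e2 e3] : [/\ u.1.1 * dot n v - v.1.1 * dot n u = 0,
      u.1.2 * dot n v - v.1.2 * dot n u = 0 &
      u.2 * dot n v - v.2 * dot n u = 0] by rewrite nu nv; split; ring.
  (* n x (u x v) = 0, since n is orthogonal to u and v *)
  have h1 : n.1.2 * c.2 - n.2 * c.1.2 = 0 by rewrite -e1 !dotE /c /cross /=; ring.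
  have h2 : n.2 * c.1.1 - n.1.1 * c.2 = 0 by rewrite -e2 !dotE /c /cross /=; ring.
  have h3 : n.1.1 * c.1.2 - n.1.2 * c.1.1 = 0.
    by rewrite -e3 !dotE /c /cross /=; ring.
  clearbody c; apply: vec3P; rewrite /= /GRing.scale /= !dotE; apply/eqP;
    rewrite -subr_eq0.
  - apply/eqP; transitivity (c.1.2 * (n.1.1 * c.1.2 - n.1.2 * c.1.1) -
      c.2 * (n.2 * c.1.1 - n.1.1 * c.2)); [ring | by rewrite h2 h3; ring].
  - apply/eqP; transitivity (c.2 * (n.1.2 * c.2 - n.2 * c.1.2) -
      c.1.1 * (n.1.1 * c.1.2 - n.1.2 * c.1.1)); [ring | by rewrite h1 h3; ring].
  - apply/eqP; transitivity (c.1.1 * (n.2 * c.1.1 - n.1.1 * c.2) -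
      c.1.2 * (n.1.2 * c.2 - n.2 * c.1.2)); [ring | by rewrite h2 h1; ring].
have nc2 : dot n c ^+ 2 = area ^+ 2.
  have : dot n (dot c c *: n) = dot n (dot n c *: c) by rewrite nc.
  by rewrite !dotZr nn mulr1 area2 expr2 => ->.
have areaN : area *: n = (dot n c / area) *: c.
  apply: (scalerI (lt0r_neq0 area0)); rewrite !scalerA -expr2 area2 nc.
  by rewrite mulrCA divff ?mulr1// gt_eqF.
move/eqP: nc2; rewrite eqf_sqr => /orP[] /eqP ncE; rewrite ncE in areaN.
- have {}areaN : area *: n = c by rewrite areaN divff ?scale1r// gt_eqF.
  case: Da => ->; [exists (-1)|exists 1];
    rewrite -?scalerA ?areaN ?scaleN1r ?scale1r ?opprK//;
    by [left|right].
- have {}areaN : area *: n = - c.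
    by rewrite areaN mulNr divff ?scaleN1r// gt_eqF.
  case: Da => ->; [exists 1|exists (-1)];
    rewrite -?scalerA ?areaN ?scaleN1r ?scale1r ?opprK//;
    by [left|right].
Qed.

Definition affine_form a (b : R) r := dot a r + b.

Lemma affine_form_polyfun a b : polyfun (affine_form a b).
Proof.
apply: polyfunD; last exact: polyfun_cst.
apply: polyfun_sum => i _.
exact: (polyfunM (polyfun_cst (crd a i)) (polyfun_crd R i)).
Qed.

Lemma measurable_plane a b :
  measurable ([set r | affine_form a b r = 0] : set (mvec3 R)).
Proof.
have := polyfun_measurable (D := setT) (affine_form_polyfun a b).
by move=> /(_ measurableT [set 0] (measurable_set1 _)); rewrite setTI.
Qed.

Lemma plane_null_z a b : a.2 != 0 ->
  lebesgue3 R [set r | affine_form a b r = 0] = 0%E.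
Proof.
move=> a0; set P : set (mvec3 R) := [set r | _].
rewrite -[LHS]/(\int[lebesgue2 R]_p lebesgue_measure (xsection P p))%E.
rewrite integral0_eq// => p _.
rewrite (_ : xsection _ _ =
  [set - (a.1.1 * p.1 + a.1.2 * p.2 + b) / a.2]) ?lebesgue_measure_set1//.
apply/seteqP; split => z; rewrite xsectionE /P /affine_form /= dotE /=.
  by move=> h; apply: (mulfI a0); rewrite [RHS]mulrC divfK//; lra.
by move=> ->; field.
Qed.

Lemma plane_null_shear a : a != 0 ->
  exists t : vec3 R, t.2 = 1 /\ dot a t != 0.
Proof.
move=> a0; have [az|] := eqVneq a.2 0; last first.
  by exists (0, 0, 1); rewrite dotE /= !mulr0 mulr1 !add0r.
have [ay|] := eqVneq a.1.2 0; last first.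
  by exists (0, 1, 1); rewrite dotE /= mulr0 !mulr1 add0r az addr0.
exists (1, 0, 1); split => //; rewrite dotE /= az mulr0 !mulr1 !addr0.
by apply: contra_neq a0 => ax; exact: vec3P.
Qed.

(** A shear turns the plane into one that is not parallel to the third axis, which
    every line in that direction meets in a single point. *)
Lemma plane_null a b : a != 0 ->
  lebesgue3 R [set r | affine_form a b r = 0] = 0%E.
Proof.
move=> a0; have [t [t1 at0]] := plane_null_shear a0.
set P := [set r | _]; have mP : measurable (P : set (mvec3 R)).
  exact: measurable_plane.
have det1 : det3 (1, 0, 0) (0, 1, 0) t = 1 by rewrite /det3 t1 /=; ring.
have [_ _ hT] : substitution (affine_map 0 (1, 0, 0) (0, 1, 0) t) 1.
  have := @substitution_affine_map _ 0 (1, 0, 0) (0, 1, 0) t.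
  by rewrite det1 normr1; apply; exact: oner_neq0.
have := hT (EFin \o \1_P) _ _.
rewrite integral_indic// setIT => ->; last 2 first.
- exact/measurable_EFinP/measurable_indic.
- by move=> r /=; rewrite lee_fin.
pose a' : vec3 R := (a.1.1, a.1.2, dot a t).
pose P' : set (mvec3 R) := [set r | affine_form a' b r = 0].
have mP' : measurable P' by exact: measurable_plane.
rewrite mul1e (eq_integral (EFin \o \1_P')).
  by rewrite integral_indic// setIT; exact: plane_null_z.
move=> [[x y] z] _; rewrite affine_mapE /=; congr (_%:E).
rewrite !indicE; congr (nat_of_bool _)%:R.
have E : affine_form a b (affine_map 0 (1, 0, 0) (0, 1, 0) t (x, y, z)) =
    affine_form a' b (x, y, z).
  by rewrite affine_mapE /affine_form !dotE /= dotE t1; ring.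
by rewrite affine_mapE /= in E; apply/idP/idP; rewrite !inE /P /P' /= E.
Qed.

End Geometry.

(** * Integrals over a face *)

Section FaceIntegrals.
Variables (R : realType) (M : mesh R).
Local Notation mR := (measurableTypeR R).
Local Notation ref_face := (@ref_face R M : set (mR * mR)%type).

Lemma Rintegral_sum d (T : measurableType d) (mu : {measure set T -> \bar R})
    (D : set T) (I : Type) (s : seq I) (P : pred I) (c : I -> R)
    (f : I -> T -> R) : measurable D ->
  (forall i, P i -> mu.-integrable D (EFin \o f i)) ->
  mu.-integrable D (EFin \o (fun x => \sum_(i <- s | P i) c i * f i x)) /\
  \int[mu]_(x in D) (\sum_(i <- s | P i) c i * f i x) =
    \sum_(i <- s | P i) c i * \int[mu]_(x in D) f i x.
Proof.
move=> mD intf; elim: s => [|i s [ih1 ih2]].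
  rewrite big_nil; under eq_fun do rewrite big_nil.
  split; first exact: integrable0.
  by rewrite Rintegral_cst// mul0r.
rewrite big_cons; under eq_fun do rewrite big_cons.
case: ifP => // Pi; have {}intf := intf i Pi.
have i1 : mu.-integrable D (EFin \o (fun x => c i * f i x)).
  apply: eq_integrable (integrableZl mD (c i) intf) => //.
split; first by apply: eq_integrable (integrableD mD i1 ih1).
by rewrite RintegralD// ih2 RintegralZl.
Qed.

Lemma ref_face_measurable : measurable ref_face.
Proof.
have m1 : measurable_fun setT (fun s : mR * mR => s.1) by exact: measurable_fst.
have m2 : measurable_fun setT (fun s : mR * mR => s.2) by exact: measurable_snd.
have m0 c : measurable_fun setT (fun _ : mR * mR => c : mR).
  exact: measurable_cst.
pose lt (f g : mR * mR -> mR) := [set s | f s < g s].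
have mlt f g : measurable_fun setT f -> measurable_fun setT g ->
    measurable (lt f g).
  move=> mf mg; rewrite -[lt f g]setTI.
  exact: (measurable_fun_ltr mf mg measurableT (Y := [set true])).
rewrite /Defs.ref_face; case: kind.
- rewrite (_ : [set _ | _] = lt (fun=> 0) fst `&` lt fst (fun=> 1) `&`
      (lt (fun=> 0) snd `&` lt snd (fun=> 1))).
    by do ?apply: measurableI; apply: mlt.
  apply/seteqP; split => s /=; rewrite /lt /=.
    by move=> [/andP[? ?] /andP[? ?]].
  by move=> [[-> ->] [-> ->]].
- rewrite (_ : [set _ | _] = lt (fun=> 0) fst `&` lt (fun=> 0) snd `&`
      lt (fun s => s.1 + s.2) (fun=> 1)).
    by do ?apply: measurableI; apply: mlt => //; exact: measurable_funD.
  by apply/seteqP; split => s /=; rewrite /lt /=; [case|case=> -[]].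
Qed.

Lemma ref_face_unit s : ref_face s -> 0 < s.1 < 1 /\ 0 < s.2 < 1.
Proof.
by rewrite /Defs.ref_face; case: kind => //= -[? ? ?]; split; apply/andP; lra.
Qed.

Lemma ref_face_neq0 : exists s, ref_face s.
Proof.
exists (4^-1, 4^-1); rewrite /Defs.ref_face; case: kind => /=.
  by split; apply/andP; lra.
by split; lra.
Qed.

Lemma ref_face_finite : (lebesgue2 R ref_face < +oo)%E.
Proof.
pose I : set mR := `[0, 1]%classic.
have mI : measurable I by exact: measurable_itv.
apply: (@le_lt_trans _ _ (lebesgue2 R (I `*` I))).
  apply: le_measure; rewrite ?inE.
  - exact: ref_face_measurable.
  - exact: measurableX.
  - by move=> s /ref_face_unit [/andP[/ltW ? /ltW ?] /andP[/ltW ? /ltW ?]];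
      split; rewrite /I /= in_itv /=; apply/andP.
have -> : lebesgue2 R (I `*` I) = (lebesgue_measure I * lebesgue_measure I)%E.
  exact: product_measure1E.
by rewrite /I lebesgue_measure_itv /=; case: ifP => _; rewrite ?mul0e ?ltry//
  -EFinM ltry.
Qed.

Lemma face_map_measurable (e : faceT M) :
  measurable_fun setT (face_map e : mR * mR -> mvec3 R).
Proof.
apply: (eq_measurable_fun (fun s : mR * mR =>
  let: (a, u, v) := face_frame e in
  (u.1.1 * s.1 + v.1.1 * s.2 + a.1.1, u.1.2 * s.1 + v.1.2 * s.2 + a.1.2,
   u.2 * s.1 + v.2 * s.2 + a.2) : mvec3 R)).
  move=> [s t] _; rewrite /face_map; case: face_frame => [[a u] v] /=.
  by apply: vec3P; rewrite /= /GRing.scale /=; ring.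
case: face_frame => [[a u] v].
apply/measurable_fun_pair; first apply/measurable_fun_pair;
  exact: measurable_affine2.
Qed.

Lemma face_image_bounded (e : faceT M) : bounded3 (face_map e @` ref_face).
Proof.
case E : (face_frame e) => [[a u] v].
pose C i := `|crd a i| + `|crd u i| + `|crd v i|.
exists (C 0 + C 1 + C 2) => _ i [s /ref_face_unit [/andP[s0 s1] /andP[t0 t1]] <-].
apply: (@le_trans _ _ (C i)); last first.
  have C0 j : 0 <= C j by rewrite /C !addr_ge0.
  elim/I3_ind: i.
  - by rewrite -addrA lerDl addr_ge0.
  - by rewrite addrAC lerDr addr_ge0.
  - by rewrite lerDr addr_ge0.
rewrite /face_map E /= !crdD !crdZ /C.
apply: le_trans (ler_normD _ _) _; apply: lerD.
  apply: le_trans (ler_normD _ _) _; apply: lerD => //.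
  by rewrite normrM gtr0_norm// ler_piMl// ltW.
by rewrite normrM gtr0_norm// ler_piMl// ltW.
Qed.

Lemma face_integrable (e : faceT M) f : polyfun f ->
  (lebesgue2 R).-integrable ref_face (EFin \o (fun s => f (face_map e s))).
Proof.
move=> pf; have mF := ref_face_measurable.
have [C hC] := polyfun_bounded (face_image_bounded e) pf.
apply: (@le_integrable _ _ _ _ _ mF _ (EFin \o cst C)).
- apply/measurable_EFinP; apply: measurable_funTS.
  exact: measurableT_comp (polyfun_measurable pf) (face_map_measurable e).
- move=> s Fs; have := hC _ (ex_intro2 _ _ s Fs erefl).
  by rewrite /= lee_fin => /le_trans; apply; exact: ler_norm.
- apply/integrableP; split; first exact/measurable_EFinP/measurable_cst.
  rewrite (eq_integral (cst `|C|%:E))// integral_cst//.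
  by rewrite lte_mul_pinfty// ref_face_finite.
Qed.

End FaceIntegrals.

(** * The divergence theorem on a polyhedral cell *)

Section Polyhedra.
Variables (R : realType) (M : mesh R).
Local Notation mR := (measurableTypeR R).
Local Notation ref_face := (@ref_face R M : set (mR * mR)%type).
Implicit Types (K : cellT M) (e : faceT M).

(** What the divergence theorem needs to know about a cell; boxes and tetrahedra
    share this description. By [sweep_dual], a motion along [sweep m] increases
    the form of the facet [sweep_from m], decreases that of [sweep_to m] and
    leaves the others unchanged; [sweep_face] says that it matches the
    parametrizations of these two facets. The common Jacobian [volf] of the
    sweeps is the volume of a box, and six times that of a tetrahedron. *)
Record polyhedral K := Polyhedral {
  facet : finType;
  gradf : facet -> vec3 R;
  cstf : facet -> R;
  facet_face : facet -> faceT M;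
  sweep : 'I_3 -> vec3 R;
  sweep_from : 'I_3 -> facet;
  sweep_to : 'I_3 -> facet;
  volf : R;
  facet_form := fun i => affine_form (gradf i) (cstf i);
  cell_form : cell_pts K = [set r | forall i, 0 < facet_form i r];
  cell_bounded : bounded3 (cell_pts K);
  cell_neq0 : exists r, cell_pts K r;
  facet_face_inj : injective facet_face;
  facet_faceP : forall e, reflect (exists i, e = facet_face i) (face_of e K);
  form_face0 : forall i s, facet_form i (face_map (facet_face i) s) = 0;
  ref_faceP : forall i s, Defs.ref_face M s <->
    forall j, j != i -> 0 < facet_form j (face_map (facet_face i) s);
  sweep_neq : forall m, sweep_from m != sweep_to m;
  sweep_dual : forall i m, dot (sweep m) (gradf i) =
    (i == sweep_from m)%:R - (i == sweep_to m)%:R;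
  sweep_face : forall m s, face_map (facet_face (sweep_to m)) s =
    face_map (facet_face (sweep_from m)) s +
    facet_form (sweep_to m) (face_map (facet_face (sweep_from m)) s) *: sweep m;
  sweep_span : forall x, (forall m, dot (sweep m) x = 0) -> x = 0;
  volf_gt0 : 0 < volf;
  sweep_vol : forall m, let: (a, u, v) := face_frame (facet_face (sweep_from m)) in
    `|det3 u v (sweep m)| = volf;
  gradf_neq0 : forall i, gradf i != 0;
  gradf_cross : forall i, let: (a, u, v) := face_frame (facet_face i) in
    volf *: gradf i = cross u v \/ volf *: gradf i = - cross u v }.

Section Consequences.
Variables (K : cellT M) (P : polyhedral K).
Local Notation fc := (@facet_face K P).
Local Notation lam := (@facet_form K P).
Local Notation Kp := (cell_pts K : set (mvec3 R)).

Lemma form_polyfun i : polyfun (lam i).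
Proof. exact: affine_form_polyfun. Qed.

Lemma form_affine i r t w : lam i (r + t *: w) = lam i r + t * dot (gradf i) w.
Proof. by rewrite /facet_form /affine_form dotDr dotZr; ring. Qed.

Lemma cell_open : open (cell_pts K).
Proof.
rewrite (cell_form P) openE => r /= Kr.
suff h i : \forall x \near r, 0 < lam i x by exact: filter_forall h.
have := @polyfun_continuous _ _ (form_polyfun i) r.
by move=> /cvgr_gt /(_ _ (Kr i)).
Qed.

Lemma cell_measurable : measurable Kp.
Proof.
rewrite (cell_form P).
have -> : [set r | forall i, 0 < lam i r] =
    \bigcap_(i in [set: facet P]) (lam i @^-1` `]0, +oo[).
  apply/seteqP; split => r /= h.
    by move=> i _; rewrite /= in_itv /= h.
  by move=> i; have := h i I; rewrite /= in_itv /= andbT.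
apply: fin_bigcap_measurable; first exact: finite_finset.
move=> i _; rewrite -[X in measurable X]setTI.
have := polyfun_measurable (D := setT) (form_polyfun i).
by apply => //; exact: measurable_itv.
Qed.

(** On the closure all forms are nonnegative, so a boundary point lies on the
    zero plane of some form. *)
Lemma cell_closure_null :
  exists2 N : set (mvec3 R), measurable N /\ lebesgue3 R N = 0%E &
    closure (cell_pts K) `\` cell_pts K `<=` N.
Proof.
pose N i : set (mvec3 R) := [set r | lam i r = 0].
have mN i : measurable (N i) by exact: measurable_plane.
have N0 i : lebesgue3 R (N i) = 0%E by apply: plane_null; exact: gradf_neq0.
exists (\bigcup_(i in [set` index_enum (facet P)]) N i).
  rewrite bigcup_seq.
  have [mU nU] : measurable (\big[setU/set0]_(i <- index_enum (facet P)) N i) /\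
      (lebesgue3 R).-negligible (\big[setU/set0]_(i <- index_enum (facet P)) N i).
    apply: (big_ind (fun A : set (mvec3 R) =>
      measurable A /\ (lebesgue3 R).-negligible A)).
    - by split; [exact: measurable0|exact: negligible_set0].
    - by move=> A A' [? ?] [? ?]; split; [exact: measurableU|exact: negligibleU].
    - by move=> i _; split=> //; exists (N i); split.
  by split => //; exact: (negligibleP _ mU).1 nU.
move=> r [clr Kr].
have h i : 0 <= lam i r.
  rewrite leNgt; apply/negP => lr.
  have := clr [set x | lam i x < 0].
  case.
    have := @polyfun_continuous _ _ (form_polyfun i) r.
    by move=> /cvgr_lt /(_ _ lr).
  by rewrite (cell_form P) => x [/(_ i) /= x0]; rewrite ltNge ltW.
apply: contrapT => nN; apply: Kr; rewrite (cell_form P) /= => i.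
rewrite lt_neqAle h andbT eq_sym; apply/eqP => li.
by apply: nN; exists i; rewrite //= mem_index_enum.
Qed.

(** The cell is the region between the graphs of 0 and of the form of the facet
    [sweep_to m] over the facet [sweep_from m]. *)
Lemma cell_sweep m g (G : 'I_3 -> vec3 R -> R) : polyfun g ->
  (forall i, polyfun (G i)) ->
  (forall r w, is_derive r w g (\sum_(i < 3) crd w i * G i r)) ->
  volint (cell_pts K) (fun r => \sum_(i < 3) crd (sweep P m) i * G i r) =
  volf P * (\int[lebesgue2 R]_(s in ref_face) g (face_map (fc (sweep_to P m)) s)
   - \int[lebesgue2 R]_(s in ref_face) g (face_map (fc (sweep_from P m)) s)).
Proof.
move=> pg pG dG.
have mF := @ref_face_measurable R M.
rewrite -RintegralB//; [|exact: face_integrable|exact: face_integrable].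
have := sweep_vol P m.
case E : (face_frame (fc (sweep_from P m))) => [[a u] v] volE.
pose h s := lam (sweep_to P m) (face_map (fc (sweep_from P m)) s).
have fmE s : face_map (fc (sweep_from P m)) s = a + s.1 *: u + s.2 *: v.
  by rewrite /face_map E.
rewrite (@integral_sweep _ a u v (sweep P m) ref_face h Kp g).
- rewrite volE; congr (_ * _); apply: eq_Rintegral => s _.
  by rewrite sweep_face /h fmE.
- by rewrite -normr_gt0 volE volf_gt0.
- exact: mF.
- exact: cell_measurable.
- exact: cell_bounded.
- move=> s /(ref_faceP (sweep_from P m) s); apply.
  by rewrite eq_sym sweep_neq.
- move=> s z; rewrite (cell_form P) /=.
  have aE : affine_map a u v (sweep P m) (s, z) =
    face_map (fc (sweep_from P m)) s + z *: sweep P m by rewrite fmE.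
  rewrite aE.
  have lamE i : lam i (face_map (fc (sweep_from P m)) s + z *: sweep P m) =
      lam i (face_map (fc (sweep_from P m)) s) +
      z * ((i == sweep_from P m)%:R - (i == sweep_to P m)%:R).
    by rewrite form_affine dotC sweep_dual.
  have nft := negPf (sweep_neq P m).
  split => [hK|[/(ref_faceP (sweep_from P m) s) hF /andP[z0 zh]] i].
    have z0 : 0 < z.
      have := hK (sweep_from P m).
      by rewrite lamE form_face0 eqxx nft subr0 mulr1 add0r.
    have zh : z < h s.
      have := hK (sweep_to P m).
      by rewrite lamE eqxx eq_sym nft sub0r mulrN1 subr_gt0.
    split; last by rewrite z0.
    apply/(ref_faceP (sweep_from P m) s) => j jf.
    have [->|jt] := eqVneq j (sweep_to P m); first exact: lt_trans zh.
    by have := hK j; rewrite lamE (negPf jf) (negPf jt) subr0 mulr0 addr0.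
  rewrite lamE; have [->|jf] := eqVneq i (sweep_from P m).
    by rewrite nft form_face0 subr0 mulr1 add0r.
  have [->|jt] := eqVneq i (sweep_to P m).
    by rewrite sub0r mulrN1 subr_gt0.
  by rewrite subr0 mulr0 addr0 hF.
- apply: polyfun_sum => i _.
  exact: (polyfunM (polyfun_cst (crd (sweep P m) i)) (pG i)).
Qed.

(** By [cell_sweep] and the duality of sweeps and gradients, the vector of the
    differences of both sides is orthogonal to the three sweep directions,
    which span the space. *)
Lemma cell_gauss g (G : 'I_3 -> vec3 R -> R) j : polyfun g ->
  (forall i, polyfun (G i)) ->
  (forall r w, is_derive r w g (\sum_(i < 3) crd w i * G i r)) ->
  volint (cell_pts K) (G j) = - \sum_(i : facet P) volf P * crd (gradf i) j *
    \int[lebesgue2 R]_(s in ref_face) g (face_map (fc i) s).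
Proof.
move=> pg pG dG.
set In := fun i => \int[lebesgue2 R]_(s in ref_face) g (face_map (fc i) s).
pose V := mkpt (fun j => volint (cell_pts K) (G j)).
pose B := mkpt (fun j => \sum_(i : facet P) volf P * crd (gradf i) j * In i).
have crdV k : crd V k = volint (cell_pts K) (G k) by elim/I3_ind: k.
have crdB k : crd B k = \sum_(i : facet P) volf P * crd (gradf i) k * In i.
  by elim/I3_ind: k.
suff : V + B = 0.
  by move/(congr1 (fun r => crd r j)); rewrite crdD crdV crdB (_ : crd 0 j = 0);
    [move/eqP; rewrite addr_eq0 => /eqP|elim/I3_ind: (j)].
apply: (sweep_span (p := P)) => m; rewrite dotDr.
have iG i : (lebesgue3 R).-integrable Kp (EFin \o G i).
  exact: polyfun_integrable (cell_bounded P) cell_measurable (pG i).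
have -> : dot (sweep P m) V = volf P * (In (sweep_to P m) - In (sweep_from P m)).
  rewrite -cell_sweep// /volint (Rintegral_sum _ _ cell_measurable (fun i _ => iG i)).2.
  by apply: eq_bigr => i _; rewrite crdV.
have -> : dot (sweep P m) B = volf P * \sum_i dot (sweep P m) (gradf i) * In i.
  rewrite /dot; under eq_bigr do rewrite crdB mulr_sumr.
  rewrite exchange_big mulr_sumr; apply: eq_bigr => i _.
  rewrite mulr_suml mulr_sumr; apply: eq_bigr => k _; ring.
under eq_bigr do rewrite sweep_dual mulrBl.
rewrite sumrB.
have sumE i0 : \sum_(i : facet P) (i == i0)%:R * In i = In i0.
  rewrite (bigD1 i0)//= eqxx mul1r big1 ?addr0// => i /negPf ->.
  by rewrite mul0r.
by rewrite !sumE; ring.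
Qed.

End Consequences.
End Polyhedra.

Section Normals.
Variables (R : realType) (M : mesh R).

(** The sign [s e] is 1 if [n e] points out of the cell. A small step from an open
    facet against the outer normal makes the form of this facet positive and
    keeps the other forms positive. *)
Lemma cell_normals (K : cellT M) (P : polyhedral K) (n : faceT M -> vec3 R) :
  (forall e, face_of e K -> [/\ dot (n e) (n e) = 1,
    dot (n e) (face_frame e).1.2 = 0 & dot (n e) (face_frame e).2 = 0]) ->
  exists s : faceT M -> R,
    (forall e, face_of e K -> (s e = 1 \/ s e = -1) /\
      forall r, (face_map e @` ref_face M) r ->
        \forall eps \near 0^'+, cell_pts K (r - (s e * eps) *: n e)) /\
    (forall g (G : 'I_3 -> vec3 R -> R) j, polyfun g ->
      (forall i, polyfun (G i)) ->
      (forall r w, is_derive r w g (\sum_(i < 3) crd w i * G i r)) ->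
      volint (cell_pts K) (G j) =
        \sum_(e | face_of e K) s e * crd (n e) j * faceint e g).
Proof.
move=> hn.
have h0 : forall e : faceT M, exists s : R, face_of e K ->
    (s = 1 \/ s = -1) /\ exists2 i : facet P, e = facet_face i &
      (s * area_factor e) *: n e = - (volf P *: gradf i).
  move=> e; have [Ke|] := boolP (face_of e K); last by exists 0.
  have [nn nu nv] := hn e Ke; have /(@facet_faceP _ _ _ P _)[i ei] := Ke.
  have := @gradf_cross _ _ _ P i; rewrite -ei.
  case E : (face_frame e) => [[a u] v] ci.
  rewrite E /= in nu nv.
  have [|s s1 sE] := @unit_normal_sign _ u v (n e) (gradf i) (volf P)
    (area_factor e) _ nn nu nv (volf_gt0 P) (gradf_neq0 i) ci.
    by rewrite /area_factor E.
  by exists s => _; split=> //; exists i.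
have [s hs] := choice h0.
exists s; split.
  move=> e Ke; have [s1 [i ei sE]] := hs e Ke; split=> // r [t Ft <-{r}].
  have an : s e * dot (gradf i) (n e) < 0.
    have : dot (gradf i) ((s e * area_factor e) *: n e) < 0.
      rewrite sE -scaleN1r dotZr dotZr mulN1r oppr_lt0 mulr_gt0 ?volf_gt0//.
      exact/dot_gt0/gradf_neq0.
    rewrite dotZr mulrAC; have : 0 <= area_factor e by exact: sqrtr_ge0.
    rewrite le_eqVlt => /predU1P[<-|a0]; first by rewrite mulr0 ltxx.
    by rewrite pmulr_llt0.
  suff h j : \forall eps \near 0^'+,
      0 < @facet_form _ _ _ P j (face_map e t - (s e * eps) *: n e).
    have h2 : \forall eps \near 0^'+, forall j,
        0 < @facet_form _ _ _ P j (face_map e t - (s e * eps) *: n e).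
      by apply: filter_forall => j; exact: h.
    by near=> eps; rewrite (cell_form P) /=; near: eps.
  have formE eps : facet_form j (face_map e t - (s e * eps) *: n e) =
      facet_form j (face_map e t) - eps * (s e * dot (gradf j) (n e)).
    by rewrite -scaleNr form_affine; ring.
  under eq_near do rewrite formE.
  have [->|ji] := eqVneq j i.
    rewrite ei form_face0; near=> eps; rewrite sub0r -mulrN mulr_gt0//.
    by rewrite -ei oppr_gt0.
  have hj : 0 < facet_form j (face_map e t).
    by rewrite ei; have /(ref_faceP (p := P) i t) := Ft; apply.
  have : facet_form j (face_map e t) - eps * (s e * dot (gradf j) (n e)) @[eps --> 0^'+]
      --> facet_form j (face_map e t) - 0 * (s e * dot (gradf j) (n e)).
    apply: cvg_at_right_filter; apply: cvgB; first exact: cvg_cst.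
    by apply: cvgM; [exact: cvg_id|exact: cvg_cst].
  by rewrite mul0r subr0 => /cvgr_gt /(_ _ hj).
move=> g G j pg pG dG; rewrite (cell_gauss P j pg pG dG).
have -> : \sum_(e | face_of e K) s e * crd (n e) j * faceint e g =
   \sum_(e in [set facet_face i | i in [set: facet P]]%SET)
     s e * crd (n e) j * faceint e g.
  by apply: eq_bigl => e; apply/(@facet_faceP _ _ _ P _)/imsetP => [[i ->]|[i _ ->]];
    exists i.
rewrite big_imset /=; last by move=> i i' _ _; exact: facet_face_inj.
rewrite -sumrN; apply: eq_big => [i|i _]; first by rewrite finset.in_setT.
have [|_ [i' /facet_face_inj <- sE]] := hs (facet_face i).
  by apply/(@facet_faceP _ _ _ P _); exists i.
have := congr1 (fun r => crd r j) sE; rewrite crdZ crdN crdZ => E.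
by rewrite /faceint mulrA mulrAC [s _ * _ * _]mulrAC E; ring.
Unshelve. all: by end_near. Qed.

End Normals.

(** * Boxes *)

Lemma I3_cycle (P : 'I_3 -> Prop) d : P d -> P (d + 1) -> P (d + 2) ->
  forall d', P d'.
Proof.
move=> P0 P1 P2 d'.
have : [|| d' == d, d' == d + 1 | d' == d + 2].
  by case: d d' {P0 P1 P2} => [[|[|[|//]]] ?] [[|[|[|//]]] ?].
by case/or3P => /eqP ->.
Qed.

Lemma I3_add1 (d : 'I_3) : (d + 1 == d) = false.
Proof. by elim/I3_ind: d. Qed.

Lemma I3_add2 (d : 'I_3) : (d + 2 == d) = false.
Proof. by elim/I3_ind: d. Qed.

Lemma I3_addE : [/\ (0 + 1 = 1 :> 'I_3) , (0 + 2 = 2 :> 'I_3), (1 + 1 = 2 :> 'I_3) &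
  [/\ 1 + 2 = 0 :> 'I_3, 2 + 1 = 0 :> 'I_3 & 2 + 2 = 1 :> 'I_3]].
Proof. by split; [| | |split]; exact: val_inj. Qed.

Lemma crdP (R : realType) (r r' : vec3 R) : (forall i, crd r i = crd r' i) -> r = r'.
Proof. by move=> h; apply: vec3P; [exact: (h 0)|exact: (h 1)|exact: (h 2)]. Qed.

Section Box.
Variables (R : realType) (N : nat) (x : 'I_3 -> nat -> R).
Variable C : {set {ffun 'I_3 -> 'I_N}}.
Hypothesis hx : forall d i j, (i < j <= N)%N -> x d i < x d j.
Local Notation M := (cartesian_mesh x C).
Variable K : cellT M.

Let lo d := x d (K d).
Let hi d := x d (K d).+1.
Let len d := hi d - lo d.

Lemma box_len_gt0 d : 0 < len d.
Proof. by rewrite subr_gt0; apply: hx; rewrite ltnSn ltn_ord. Qed.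

Let len_neq0 d : len d != 0. Proof. by rewrite gt_eqF// box_len_gt0. Qed.

Definition box_grad (i : 'I_3 * bool) : vec3 R :=
  ((if i.2 then -1 else 1) / len i.1) *: Defs.basis R i.1.
Definition box_cst (i : 'I_3 * bool) : R :=
  (if i.2 then hi i.1 else - lo i.1) / len i.1.
Definition box_facet (i : 'I_3 * bool) : faceT M :=
  (i.1, [ffun d => inord (K d + ((d == i.1) && i.2)) : 'I_N.+1]).

Lemma dot_basis d r : dot (Defs.basis R d) r = crd r d.
Proof. by elim/I3_ind: d; rewrite dotE /= ?(mul1r, mul0r, addr0, add0r). Qed.

Lemma box_formE i r : affine_form (box_grad i) (box_cst i) r =
  (if i.2 then hi i.1 - crd r i.1 else crd r i.1 - lo i.1) / len i.1.
Proof.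
by rewrite /affine_form dotZl dot_basis /box_cst; case: i.2; ring.
Qed.

Lemma box_facet_val i d :
  ((box_facet i).2 d : nat) = (K d + ((d == i.1) && i.2))%N.
Proof.
rewrite ffunE inordK// ltnS; have := ltn_ord (K d).
by case: (_ && _); rewrite ?addn0 ?addn1//; exact: ltnW.
Qed.

Lemma crd_mkpt (f : 'I_3 -> R) i : crd (mkpt f) i = f i.
Proof. by elim/I3_ind: i. Qed.

Lemma box_frame i : face_frame (box_facet i) =
  (mkpt (fun d => if d == i.1 then (if i.2 then hi d else lo d) else lo d),
   len (i.1 + 1) *: Defs.basis R (i.1 + 1),
   len (i.1 + 2) *: Defs.basis R (i.1 + 2)).
Proof.
rewrite /=; congr (mkpt _, _, _).
- apply/funext => d; rewrite box_facet_val; case: eqP => [->|_]; last by rewrite addn0.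
  by case: i.2; rewrite /= ?addn0 ?addn1.
- by rewrite box_facet_val I3_add1 /= addn0.
- by rewrite box_facet_val I3_add2 /= addn0.
Qed.

Lemma box_face_crd i s :
  [/\ crd (face_map (box_facet i) s) i.1 = if i.2 then hi i.1 else lo i.1,
      crd (face_map (box_facet i) s) (i.1 + 1) =
        lo (i.1 + 1) + s.1 * len (i.1 + 1) &
      crd (face_map (box_facet i) s) (i.1 + 2) =
        lo (i.1 + 2) + s.2 * len (i.1 + 2)].
Proof.
rewrite /face_map box_frame /= !crdD !crdZ !crd_mkpt !eqxx I3_add1 I3_add2.
have e12 : (i.1 + 1 == i.1 + 2) = false by elim/I3_ind: i.1.
have e21 : (i.1 + 2 == i.1 + 1) = false by elim/I3_ind: i.1.
rewrite e12 e21 [i.1 == i.1 + 1]eq_sym I3_add1 [i.1 == i.1 + 2]eq_sym I3_add2.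
by split; rewrite ?(mulr1, mulr0, addr0).
Qed.

Local Notation bform i := (affine_form (box_grad i) (box_cst i)).

Lemma box_form_face d b s :
  [/\ forall b', bform (d, b') (face_map (box_facet (d, b)) s) = (b' != b)%:R,
      forall b', bform (d + 1, b') (face_map (box_facet (d, b)) s) =
        if b' then 1 - s.1 else s.1 &
      forall b', bform (d + 2, b') (face_map (box_facet (d, b)) s) =
        if b' then 1 - s.2 else s.2].
Proof.
have [/= h0 h1 h2] := box_face_crd (d, b) s.
split=> b'; rewrite box_formE /= ?h0 ?h1 ?h2.
- case: (b) (b') => [] []; rewrite /= ?subrr ?mul0r // -/(len d) divff //.
- case: b'; rewrite /len; [|rewrite addrAC subrr add0r].
    by rewrite opprD addrA -/(len _) mulrBl divff ?mulfK.
  by rewrite mulfK// -/(len _).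
- case: b'; rewrite /len; [|rewrite addrAC subrr add0r].
    by rewrite opprD addrA -/(len _) mulrBl divff ?mulfK.
  by rewrite mulfK// -/(len _).
Qed.

(** Opposite faces have the same parametrization up to a translation, so the
    sweeps are the edges and have constant height. *)
Lemma box_polyhedral : polyhedral K.
Proof.
have [e01 e02 e11 [e12 e21 e22]] := I3_addE.
pose vol := len 0 * len 1 * len 2.
have vol0 : 0 < vol by rewrite !mulr_gt0 ?box_len_gt0.
apply: (@Polyhedral R M K ('I_3 * bool)%type box_grad box_cst box_facet
  (fun d => len d *: Defs.basis R d) (fun d => (d, false)) (fun d => (d, true))
  vol).
- apply/seteqP; split => r /= h.
    move=> i; rewrite box_formE divr_gt0 ?box_len_gt0//.
    by have /andP[? ?] := h i.1; case: i.2; rewrite subr_gt0.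
  move=> d; apply/andP; split.
    have := h (d, false); rewrite box_formE /= pmulr_lgt0 ?subr_gt0//.
    by rewrite invr_gt0 box_len_gt0.
  have := h (d, true); rewrite box_formE /= pmulr_lgt0 ?subr_gt0//.
  by rewrite invr_gt0 box_len_gt0.
- pose B d := `|lo d| + `|hi d|.
  exists (B 0 + B 1 + B 2) => r d /(_ d) /= /andP[h1 h2].
  apply: (@le_trans _ _ (B d)).
    rewrite ler_norml; have := ler_norm (hi d); have := ler_norm (- lo d).
    rewrite normrN /B; have := normr_ge0 (lo d); have := normr_ge0 (hi d).
    move: h1 h2; rewrite -/(lo d) -/(hi d) => *; apply/andP; lra.
  have B0 j : 0 <= B j by rewrite /B addr_ge0.
  by have := (B0 0, B0 1, B0 2); elim/I3_ind: {h1 h2} d => -[[? ?] ?]; lra.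
- exists (mkpt (fun d => (lo d + hi d) / 2)); rewrite /= => d; rewrite crd_mkpt.
  have := box_len_gt0 d; rewrite /len -/(lo d) -/(hi d) => *; apply/andP; lra.
- move=> [d b] [d' b'] [<-] /ffunP /(_ d).
  rewrite !ffunE /= eqxx /= => /(congr1 val) /=.
  have Kb (c : bool) : (K d + c < N.+1)%N.
    by rewrite ltnS; case: c; rewrite ?addn1 ?addn0 ?ltn_ord// ltnW.
  by rewrite !inordK// => /addnI; case: b b' => [] [].
- move=> e; apply: (iffP forallP) => [h|[[d b] ->] d']; last first.
    rewrite box_facet_val; case: eqP => [->|]; rewrite /= ?addn0//.
    by case: b; rewrite ?addn0 ?addn1 eqxx ?orbT.
  exists (e.1, (e.2 e.1 == (K e.1).+1 :> nat)).
  case: e h => d k /= h; rewrite /box_facet /=; congr (_, _).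
  apply/ffunP => d'; apply: val_inj; rewrite ffunE /=.
  have := h d'; case: eqP => [->|_] /=; last first.
    by rewrite addn0 => /eqP ->; rewrite inordK// ltnW// ltnS ltn_ord.
  have Kd := ltn_ord (K d); have [kd|kd] := eqVneq (k d : nat) (K d).+1.
    by move=> _; rewrite /= addn1 inordK ?kd.
  by rewrite orbF => /eqP ->; rewrite addn0 inordK// ltnW.
- by move=> [d b] s; have [-> _ _] := box_form_face d b s; rewrite eqxx.
- move=> [d b] s; have [h0 h1 h2] := box_form_face d b s.
  split => [/= [/andP[s0 s1] /andP[t0 t1]] [d' b']|h].
    move: d' b'; apply: (@I3_cycle _ d) => b' nb.
    - rewrite h0; have -> : b' != b by apply: contra_neq nb => ->.
      exact: ltr01.
    - by rewrite h1; case: b' {nb}; rewrite ?subr_gt0.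
    - by rewrite h2; case: b' {nb}; rewrite ?subr_gt0.
  have n1 b' : (d + 1, b') != (d, b) by rewrite xpair_eqE I3_add1.
  have n2 b' : (d + 2, b') != (d, b) by rewrite xpair_eqE I3_add2.
  split; apply/andP; split.
  + by have := h _ (n1 false); rewrite h1.
  + by have := h _ (n1 true); rewrite h1 subr_gt0.
  + by have := h _ (n2 false); rewrite h2.
  + by have := h _ (n2 true); rewrite h2 subr_gt0.
- by move=> d; rewrite xpair_eqE eqxx.
- move=> [d b] m; rewrite dotZl dotZr dot_basis crd_basis /=.
  rewrite !xpair_eqE; have [->|nmd] := eqVneq m d.
    by rewrite mulr1 mulrC divfK//; case: (b); rewrite /= ?sub0r ?subr0.
  by rewrite !mulr0 subrr.
- move=> d s; have [-> _ _] := box_form_face d false s.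
  rewrite scale1r.
  have [/= h0 h1 h2] := box_face_crd (d, true) s.
  have [/= l0 l1 l2] := box_face_crd (d, false) s.
  apply: crdP; apply: (@I3_cycle _ d); rewrite crdD crdZ crd_basis.
  + by rewrite h0 l0 eqxx mulr1 /len addrC subrK.
  + by rewrite h1 l1 I3_add1 mulr0 addr0.
  + by rewrite h2 l2 I3_add2 mulr0 addr0.
- move=> r h; apply: vec3P; rewrite -?crd0 -?crd1 -?crd2.
  + by have /eqP := h 0; rewrite dotZl dot_basis mulf_eq0 (negPf (len_neq0 _)) => /eqP.
  + by have /eqP := h 1; rewrite dotZl dot_basis mulf_eq0 (negPf (len_neq0 _)) => /eqP.
  + by have /eqP := h 2; rewrite dotZl dot_basis mulf_eq0 (negPf (len_neq0 _)) => /eqP.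
- exact: vol0.
- move=> d; rewrite box_frame /=.
  have -> // : det3 (len (d + 1) *: Defs.basis R (d + 1))
      (len (d + 2) *: Defs.basis R (d + 2)) (len d *: Defs.basis R d) = vol.
    rewrite /det3 /vol; elim/I3_ind: d; rewrite /= /GRing.scale /=;
      rewrite ?e01 ?e02 ?e11 ?e12 ?e21 ?e22; ring.
  by rewrite gtr0_norm.
- move=> [d b]; rewrite scaler_eq0 negb_or mulf_neq0 ?invr_eq0//=.
    apply/eqP => /(congr1 (fun r => crd r d)).
    rewrite crd_basis eqxx; have -> : crd 0 d = 0 :> R by elim/I3_ind: (d).
    by move/eqP; rewrite oner_eq0.
  by case: (b); rewrite ?oppr_eq0 oner_eq0.
- move=> [d b]; rewrite box_frame /=.
  set c := cross _ _; suff cE : vol *: ((len d)^-1 *: Defs.basis R d) = c.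
    rewrite /box_grad /=; case: (b); [right|left]; rewrite -cE.
      by rewrite mulN1r scaleNr scalerN.
    by rewrite mul1r.
  rewrite /c /cross /vol; have := len_neq0.
  elim/I3_ind: d {c} => l0; rewrite ?e01 ?e02 ?e11 ?e12 ?e21 ?e22;
    apply: vec3P; rewrite /= /GRing.scale /=; by field; rewrite ?l0.
Qed.

End Box.

(** * Tetrahedra *)

Lemma I4_ind (P : 'I_4 -> Prop) : P 0 -> P 1 -> P 2 -> P 3 -> forall i, P i.
Proof.
move=> P0 P1 P2 P3 [[|[|[|[|//]]]] lti].
- by rewrite (_ : Ordinal _ = 0)//; exact: val_inj.
- by rewrite (_ : Ordinal _ = 1)//; exact: val_inj.
- by rewrite (_ : Ordinal _ = 2)//; exact: val_inj.
- by rewrite (_ : Ordinal _ = 3)//; exact: val_inj.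
Qed.

Section Tetrahedron.
Variable R : realType.
Variables P0 P1 P2 P3 : vec3 R.

Let e1 := P1 - P0.
Let e2 := P2 - P0.
Let e3 := P3 - P0.

(** If the determinant vanishes, the rows of cofactors are linear relations
    between the edges, so all the cofactors vanish. In particular [e2] and [e3]
    satisfy relations with their own coordinates as coefficients, so [e2 = 0],
    which is a relation itself. *)
Lemma independent_det3 : (forall c1 c2 c3 : R,
    c1 *: e1 + c2 *: e2 + c3 *: e3 = 0 -> [/\ c1 = 0, c2 = 0 & c3 = 0]) ->
  det3 e1 e2 e3 != 0.
Proof.
move=> indep; apply/eqP => det0.
have crd_eq (r r' : vec3 R) : r = r' -> [/\ r.1.1 = r'.1.1, r.1.2 = r'.1.2 & r.2 = r'.2].
  by move=> ->.
have [c1 _ _] : [/\ (cross e2 e3).1.1 = 0, (cross e3 e1).1.1 = 0 &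
    (cross e1 e2).1.1 = 0].
  apply: indep; apply: vec3P; rewrite /= /GRing.scale /=;
    first [ring | rewrite -[RHS]det0 /det3 /=; ring].
have [c2 _ _] : [/\ (cross e2 e3).1.2 = 0, (cross e3 e1).1.2 = 0 &
    (cross e1 e2).1.2 = 0].
  apply: indep; apply: vec3P; rewrite /= /GRing.scale /=;
    first [ring | rewrite -[RHS]det0 /det3 /=; ring].
have [c3 _ _] : [/\ (cross e2 e3).2 = 0, (cross e3 e1).2 = 0 &
    (cross e1 e2).2 = 0].
  apply: indep; apply: vec3P; rewrite /= /GRing.scale /=;
    first [ring | rewrite -[RHS]det0 /det3 /=; ring].
rewrite /cross /= in c1 c2 c3.
have [_ _ h1] : [/\ 0 = 0 :> R, - e3.1.1 = 0 & e2.1.1 = 0].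
  by apply: indep; apply: vec3P; rewrite /= /GRing.scale /=; lra.
have [_ _ h2] : [/\ 0 = 0 :> R, - e3.1.2 = 0 & e2.1.2 = 0].
  by apply: indep; apply: vec3P; rewrite /= /GRing.scale /=; lra.
have [_ _ h3] : [/\ 0 = 0 :> R, - e3.2 = 0 & e2.2 = 0].
  by apply: indep; apply: vec3P; rewrite /= /GRing.scale /=; lra.
have [_ /eqP] : [/\ 0 = 0 :> R, 1 = 0 :> R & 0 = 0 :> R].
  apply: indep; rewrite !scale0r scale1r add0r addr0.
  by apply: vec3P.
by rewrite oner_eq0.
Qed.

Hypothesis det_neq0 : det3 e1 e2 e3 != 0.
Let det := det3 e1 e2 e3.

Let cof (i : 'I_4) : vec3 R :=
  [:: - (cross e2 e3 + cross e3 e1 + cross e1 e2);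
    cross e2 e3; cross e3 e1; cross e1 e2]`_i.
Definition bary_grad (i : 'I_4) : vec3 R := det^-1 *: cof i.
Definition bary_cst (i : 'I_4) : R := (i == 0)%:R - dot (bary_grad i) P0.
Definition bary i := affine_form (bary_grad i) (bary_cst i).

Lemma bary_grad_dual i : [/\ dot (bary_grad i) e1 = (i == 1)%:R - (i == 0)%:R,
  dot (bary_grad i) e2 = (i == 2)%:R - (i == 0)%:R &
  dot (bary_grad i) e3 = (i == 3)%:R - (i == 0)%:R].
Proof.
have dual x c : dot (cof i) x = c * det -> dot (bary_grad i) x = c.
  by rewrite /bary_grad dotZl => ->; rewrite mulrC mulfK.
by split; apply: dual; rewrite dotE /det /det3 /cof; elim/I4_ind: i => /=; ring.
Qed.

Lemma baryE i x y z : bary i (P0 + x *: e1 + y *: e2 + z *: e3) =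
  [:: 1 - x - y - z; x; y; z]`_i.
Proof.
rewrite /bary /affine_form /bary_cst !dotDr !dotZr.
have [-> -> ->] := bary_grad_dual i.
by elim/I4_ind: i => /=; ring.
Qed.

Lemma bary_decomp r :
  r = P0 + bary 1 r *: e1 + bary 2 r *: e2 + bary 3 r *: e3.
Proof.
have bE (i : 'I_4) : i != 0 -> bary i r = det^-1 * dot (cof i) (r - P0).
  move=> /negPf i0; rewrite /bary /affine_form /bary_cst i0 sub0r -dotBr.
  by rewrite dotZl.
rewrite !bE//; apply: (addrI (- P0)); rewrite !addrA addNr add0r [LHS]addrC.
apply: (scalerI det_neq0); rewrite !scalerDr !scalerA !mulrA !divff// !mul1r.
rewrite -/det; apply: vec3P; rewrite /= /GRing.scale /= /det /det3 /cof !dotE /=; ring.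
Qed.

Lemma bary_sum r : bary 0 r = 1 - bary 1 r - bary 2 r - bary 3 r.
Proof. by rewrite {1}[r]bary_decomp baryE. Qed.

Definition tet_face (i : 'I_4) : vec3 R * vec3 R * vec3 R :=
  nth 0 [:: (P1, P2 - P1, P3 - P1); (P0, P2 - P0, P3 - P0);
            (P0, P1 - P0, P3 - P0); (P0, P1 - P0, P2 - P0)] i.

Definition tet_map i (s : R * R) :=
  (tet_face i).1.1 + s.1 *: (tet_face i).1.2 + s.2 *: (tet_face i).2.

Lemma bary_face i j s : bary j (tet_map i s) =
  (nth [::] [:: [:: 0; 1 - s.1 - s.2; s.1; s.2]; [:: 1 - s.1 - s.2; 0; s.1; s.2];
    [:: 1 - s.1 - s.2; s.1; 0; s.2]; [:: 1 - s.1 - s.2; s.1; s.2; 0]] i)`_j.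
Proof.
have -> : tet_map i s = P0 +
  [:: 1 - s.1 - s.2; 0; s.1; s.1]`_i *: e1 +
  [:: s.1; s.1; 0; s.2]`_i *: e2 + [:: s.2; s.2; s.2; 0]`_i *: e3.
  by elim/I4_ind: i; apply: vec3P; rewrite /= /GRing.scale /=; ring.
by rewrite baryE; elim/I4_ind: i; elim/I4_ind: j => /=; ring.
Qed.

(** The facets opposite to consecutive vertices differ in one vertex, which has the
    same position in both when the vertices are listed in increasing order, as
    in the parametrizations of the faces. Thus a sweep along the edge joining
    these two vertices matches the parametrizations, with heights 1 - s - t, s
    and t for the three sweeps. *)
Definition tet_sweep (m : 'I_3) : vec3 R :=
  [:: P1 - P0; P2 - P1; P3 - P2]`_m.
Definition tet_from (m : 'I_3) : 'I_4 := lift 0 m.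
Definition tet_to (m : 'I_3) : 'I_4 := widen_ord (leqnSn 3) m.

Lemma tet_sweep_dual i m : dot (tet_sweep m) (bary_grad i) =
  (i == tet_from m)%:R - (i == tet_to m)%:R.
Proof.
have [h1 h2 h3] := bary_grad_dual i.
have -> : tet_sweep m = [:: e1; e2 - e1; e3 - e2]`_m.
  by elim/I3_ind: m; rewrite /tet_sweep //=; apply: vec3P => /=; ring.
have [f0 f1 f2] : [/\ tet_from 0 = 1, tet_from 1 = 2 & tet_from 2 = 3].
  by split; exact: val_inj.
have [t0 t1 t2] : [/\ tet_to 0 = 0, tet_to 1 = 1 & tet_to 2 = 2].
  by split; exact: val_inj.
rewrite dotC; elim/I3_ind: m.
- by rewrite f0 t0 h1.
- by rewrite f1 t1 dotBr h1 h2; ring.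
- by rewrite f2 t2 dotBr h2 h3; ring.
Qed.

Lemma tet_sweep_face m s : tet_map (tet_to m) s = tet_map (tet_from m) s +
  bary (tet_to m) (tet_map (tet_from m) s) *: tet_sweep m.
Proof.
rewrite bary_face; elim/I3_ind: m; apply: vec3P; rewrite /= /GRing.scale /=; ring.
Qed.

Lemma tet_span x : (forall m, dot (tet_sweep m) x = 0) -> x = 0.
Proof.
move=> h; have := h 0; have := h 1; have := h 2; rewrite !dotE /tet_sweep /=.
move=> h2 h1 h0.
have d1 : dot e1 x = 0 by rewrite dotE /=; lra.
have d2 : dot e2 x = 0 by rewrite dotE /=; lra.
have d3 : dot e3 x = 0 by rewrite dotE /=; lra.
have E : det *: x = dot e1 x *: cross e2 e3 + dot e2 x *: cross e3 e1 +
    dot e3 x *: cross e1 e2.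
  by apply: vec3P; rewrite /= /GRing.scale /= !dotE /det /det3 /=; ring.
by apply: (scalerI det_neq0); rewrite E d1 d2 d3 !scale0r scaler0 !addr0.
Qed.

Lemma tet_sweep_vol m : let: (a, u, v) := tet_face (tet_from m) in
  `|det3 u v (tet_sweep m)| = `|det|.
Proof.
have absE (x y : R) : x = y \/ x = - y -> `|x| = `|y|.
  by case=> ->; rewrite ?normrN.
elim/I3_ind: m; rewrite /tet_face /tet_sweep /=; apply: absE;
  rewrite /det /det3 /=.
- by left; ring.
- by right; ring.
- by left; ring.
Qed.

Lemma bary_grad_neq0 i : bary_grad i != 0.
Proof.
have h m : bary_grad i != 0 \/ (i == tet_from m)%:R - (i == tet_to m)%:R = 0 :> R.
  have [a0|] := eqVneq (bary_grad i) 0; last by left.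
  by right; rewrite -tet_sweep_dual a0 dotE /= !mulr0 !addr0.
elim/I4_ind: i h => h.
- by case: (h 0) => // /eqP; rewrite subr_eq0 eq_sym oner_eq0.
- by case: (h 0) => // /eqP; rewrite subr_eq0 oner_eq0.
- by case: (h 1) => // /eqP; rewrite subr_eq0 oner_eq0.
- by case: (h 2) => // /eqP; rewrite subr_eq0 oner_eq0.
Qed.

Lemma bary_grad_cross i : let: (a, u, v) := tet_face i in
  `|det| *: bary_grad i = cross u v \/ `|det| *: bary_grad i = - cross u v.
Proof.
case E : (tet_face i) => [[a u] v].
suff [h|h] : det *: bary_grad i = cross u v \/ det *: bary_grad i = - cross u v.
- case: (ger0P det) => _; first by left.
  by right; rewrite scaleNr h.
- case: (ger0P det) => _; first by right.
  by left; rewrite scaleNr h opprK.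
rewrite /bary_grad scalerA divff// scale1r /cof.
elim/I4_ind: i E => [[_ <- <-]|[_ <- <-]|[_ <- <-]|[_ <- <-]].
- by right; apply: vec3P => /=; ring.
- by left; apply: vec3P => /=; ring.
- by right; apply: vec3P => /=; ring.
- by left; apply: vec3P => /=; ring.
Qed.

End Tetrahedron.

Section Simplex.
Variables (R : realType) (N : nat) (p : 'I_N -> vec3 R).
Variable C : {set {set 'I_N}}.
Local Notation M := (triangular_mesh p C).
Variable K : {set 'I_N}.
Variables k0 k1 k2 k3 : 'I_N.
Hypothesis enumK : enum K = [:: k0; k1; k2; k3].
Hypothesis indK : affinely_independent p K.

Let k (i : 'I_4) := nth k0 [:: k0; k1; k2; k3] i.

Lemma simplex_vertices_uniq : uniq [:: k0; k1; k2; k3].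
Proof. by rewrite -enumK enum_uniq. Qed.

Lemma simplex_vertex_inj : injective k.
Proof.
have /(uniqP k0) h := simplex_vertices_uniq.
move=> i j kij; apply: val_inj; apply: h kij; rewrite inE; exact: ltn_ord.
Qed.

Lemma simplex_sum (V : nmodType) (F : 'I_N -> V) :
  \sum_(j in K) F j = F k0 + F k1 + F k2 + F k3.
Proof. by rewrite -big_enum enumK !big_cons big_nil /= addr0 !addrA. Qed.

Lemma simplex_memP x : reflect (exists i, x = k i) (x \in K).
Proof.
rewrite -mem_enum enumK; apply: (iffP idP) => [|[i ->]]; last first.
  by apply: mem_nth; exact: ltn_ord.
move=> xk; have := xk; rewrite -index_mem => hi.
by exists (Ordinal hi); rewrite /k /= nth_index.
Qed.

(** Converts between four barycentric coordinates and the coefficient functions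
    in which simplices and affine independence are expressed. *)
Definition coef (c : seq R) (j : 'I_N) : R := c`_(index j [:: k0; k1; k2; k3]).

Lemma coefE c : [/\ coef c k0 = c`_0, coef c k1 = c`_1, coef c k2 = c`_2 &
  coef c k3 = c`_3].
Proof.
have h (i : 'I_4) : coef c (k i) = c`_i.
  by rewrite /coef /k index_uniq ?simplex_vertices_uniq//; exact: ltn_ord.
by split; [exact: (h 0)|exact: (h 1)|exact: (h 2)|exact: (h 3)].
Qed.

Local Notation e1 := (p k1 - p k0).
Local Notation e2 := (p k2 - p k0).
Local Notation e3 := (p k3 - p k0).

Lemma simplex_det : det3 e1 e2 e3 != 0.
Proof.
apply: independent_det3 => c1 c2 c3 h.
pose l := coef [:: - (c1 + c2 + c3); c1; c2; c3].
have [l0 l1 l2 l3] := coefE [:: - (c1 + c2 + c3); c1; c2; c3].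
have := indK (l := l); rewrite !simplex_sum /l l0 l1 l2 l3 /= => hl.
have hs : - (c1 + c2 + c3) + c1 + c2 + c3 = 0 by ring.
have hp : - (c1 + c2 + c3) *: p k0 + c1 *: p k1 + c2 *: p k2 + c3 *: p k3 = 0.
  rewrite -h; apply: vec3P; rewrite /= /GRing.scale /=; ring.
have {}hl := hl hs hp.
split.
- by rewrite -[LHS]/([:: - (c1 + c2 + c3); c1; c2; c3]`_1) -l1; apply: hl;
    apply/simplex_memP; exists 1.
- by rewrite -[LHS]/([:: - (c1 + c2 + c3); c1; c2; c3]`_2) -l2; apply: hl;
    apply/simplex_memP; exists 2.
- by rewrite -[LHS]/([:: - (c1 + c2 + c3); c1; c2; c3]`_3) -l3; apply: hl;
    apply/simplex_memP; exists 3.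
Qed.

Local Notation lam := (bary (p k0) (p k1) (p k2) (p k3)).

Lemma open_simplexE :
  open_simplex p K = [set r | forall i, 0 < lam i r].
Proof.
apply/seteqP; split => r /= => [[l [l0 l1 ->]] i|h].
  rewrite !simplex_sum in l1 *.
  have -> : l k0 *: p k0 + l k1 *: p k1 + l k2 *: p k2 + l k3 *: p k3 =
      p k0 + l k1 *: e1 + l k2 *: e2 + l k3 *: e3.
    have -> : l k0 = 1 - l k1 - l k2 - l k3 by lra.
    by apply: vec3P; rewrite /= /GRing.scale /=; ring.
  rewrite baryE ?simplex_det//.
  have -> : 1 - l k1 - l k2 - l k3 = l k0 by lra.
  have : 0 < l (k i) by apply: l0; apply/simplex_memP; exists i.
  by elim/I4_ind: i.
exists (coef [:: lam 0 r; lam 1 r; lam 2 r; lam 3 r]).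
have [l0 l1 l2 l3] := coefE [:: lam 0 r; lam 1 r; lam 2 r; lam 3 r].
rewrite !simplex_sum l0 l1 l2 l3 /=; split.
- move=> j /simplex_memP [i ->]; move: (h i).
  by elim/I4_ind: i; rewrite ?l0 ?l1 ?l2 ?l3.
- by rewrite bary_sum ?simplex_det//; ring.
- rewrite bary_sum ?simplex_det// {1}[r](bary_decomp simplex_det).
  by apply: vec3P; rewrite /= /GRing.scale /=; ring.
Qed.

Definition simplex_facet (i : 'I_4) : {set 'I_N} := (K :\ k i)%SET.

Lemma simplex_facet_enum i : enum (simplex_facet i) =
  [seq x <- [:: k0; k1; k2; k3] | x != k i].
Proof.
rewrite -enumK /enum_mem -filter_predI; apply: eq_filter => x /=.
by rewrite !inE.
Qed.

Lemma simplex_frame i : @face_frame R M (simplex_facet i) =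
  tet_face (p k0) (p k1) (p k2) (p k3) i.
Proof.
rewrite /= simplex_facet_enum.
have := simplex_vertices_uniq; rewrite /= !inE !negb_or.
move=> /and4P[/and3P[n1 n2 n3] /andP[n4 n5] n6 _].
by elim/I4_ind: i; rewrite /k /= ?eqxx ?n1 ?n2 ?n3 ?n4 ?n5 ?n6 /= ?(eq_sym k1 k0)
  ?(eq_sym k2 k0) ?(eq_sym k3 k0) ?(eq_sym k2 k1) ?(eq_sym k3 k1) ?(eq_sym k3 k2)
  ?n1 ?n2 ?n3 ?n4 ?n5 ?n6 /=.
Qed.

Lemma simplex_faceE i s : @face_map R M (simplex_facet i) s =
  tet_map (p k0) (p k1) (p k2) (p k3) i s.
Proof. by rewrite /face_map simplex_frame. Qed.

Lemma simplex_polyhedral : @polyhedral R M K.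
Proof.
have d0 := simplex_det.
apply: (@Polyhedral R M K 'I_4 (bary_grad (p k0) (p k1) (p k2) (p k3))
  (bary_cst (p k0) (p k1) (p k2) (p k3)) simplex_facet
  (tet_sweep (p k0) (p k1) (p k2) (p k3)) tet_from tet_to `|det3 e1 e2 e3|).
- exact: open_simplexE.
- pose B i := `|crd (p k0) i| + `|crd (p k1) i| + `|crd (p k2) i| + `|crd (p k3) i|.
  exists (B 0 + B 1 + B 2) => r d [l [l0 l1 ->]].
  apply: (@le_trans _ _ (B d)).
    rewrite !simplex_sum in l1 *; rewrite !crdD !crdZ.
    have lk i : 0 < l (k i) by apply: l0; apply/simplex_memP; exists i.
    have := (lk 0, lk 1, lk 2, lk 3); rewrite /k /= => -[[[l00 l10] l20] l30].
    have term (c y : R) : 0 < c -> c <= 1 -> `|c * y| <= `|y|.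
      by move=> c0 c1; rewrite normrM gtr0_norm// ler_piMl.
    apply: le_trans (ler_normD _ _) _; apply: lerD; last by apply: term => //; lra.
    apply: le_trans (ler_normD _ _) _; apply: lerD; last by apply: term => //; lra.
    apply: le_trans (ler_normD _ _) _; apply: lerD; by apply: term => //; lra.
  have B0 j : 0 <= B j by rewrite /B !addr_ge0.
  by have := (B0 0, B0 1, B0 2); elim/I3_ind: {l0 l1} d => -[[? ?] ?]; lra.
- exists (\sum_(j in K) 4^-1 *: p j); exists (fun=> 4^-1); split => //.
  by rewrite simplex_sum; lra.
- move=> i j /setP /(_ (k i)); rewrite !inE eqxx /=.
  have -> : k i \in K by apply/simplex_memP; exists i.
  by rewrite andbT => /esym /negbFE /eqP /simplex_vertex_inj.
- have cardK : #|K| = 4 by rewrite cardE enumK.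
  move=> e; apply: (iffP andP) => [[/eqP ce eK]|[i ->]].
    have : #|(K :\: e)%SET| == 1%N.
      by rewrite cardsD (finset.setIidPr eK) ce cardK.
    move=> /cards1P [x xE].
    have /simplex_memP [i xi] : x \in K.
      have : x \in (K :\: e)%SET by rewrite xE finset.set11.
      by rewrite finset.in_setD => /andP[].
    exists i; rewrite /simplex_facet -xi -xE finset.setDDr finset.setDv.
    by rewrite finset.set0U; apply/esym/finset.setIidPr.
  have kK : k i \in K by apply/simplex_memP; exists i.
  split; last exact: finset.subsetDl.
  by rewrite /simplex_facet; have := cardsD1 (k i) K; rewrite kK cardK add1n => -[<-].
- move=> i s; rewrite simplex_faceE; apply: etrans (bary_face d0 i i s) _.
  by elim/I4_ind: i.
- move=> i s; rewrite simplex_faceE.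
  have bf j := bary_face d0 i j s.
  split => [/= [s0 t0 st] j|h /=].
    have -> : affine_form (bary_grad (p k0) (p k1) (p k2) (p k3) j)
      (bary_cst (p k0) (p k1) (p k2) (p k3) j)
      (tet_map (p k0) (p k1) (p k2) (p k3) i s) = _ := bf j.
    by elim/I4_ind: i {bf}; elim/I4_ind: j => //= _; lra.
  have {}h j : j != i -> 0 < (nth [::] [:: [:: 0; 1 - s.1 - s.2; s.1; s.2];
    [:: 1 - s.1 - s.2; 0; s.1; s.2]; [:: 1 - s.1 - s.2; s.1; 0; s.2];
    [:: 1 - s.1 - s.2; s.1; s.2; 0]] i)`_j by move=> ji; rewrite -bf; exact: h.
  elim/I4_ind: i h {bf} => h.
  + by have := h 1 isT; have := h 2 isT; have := h 3 isT => /= *; split; lra.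
  + by have := h 0 isT; have := h 2 isT; have := h 3 isT => /= *; split; lra.
  + by have := h 0 isT; have := h 1 isT; have := h 3 isT => /= *; split; lra.
  + by have := h 0 isT; have := h 1 isT; have := h 2 isT => /= *; split; lra.
- by elim/I3_ind.
- by move=> i m; exact: tet_sweep_dual.
- by move=> m s; rewrite !simplex_faceE; exact: tet_sweep_face.
- exact: tet_span.
- by rewrite normr_gt0.
- by move=> m; rewrite simplex_frame; exact: tet_sweep_vol.
- exact: bary_grad_neq0.
- by move=> i; rewrite simplex_frame; exact: bary_grad_cross.
Qed.

End Simplex.

(** * Integration over the domain *)

Lemma mesh_polyhedral (R : realType) (X : set (vec3 R)) (M : mesh R) :
  mesh_of X M -> forall K, K \in cells M -> inhabited (polyhedral K).
Proof.
case=> _ [[N [x [C [hx ->]]]] | [N [p [C [[hC _] ->]]]]] K KC.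
  by constructor; exact: box_polyhedral.
have [cardK indK] := hC K KC; constructor.
have : size (enum K) = 4 by rewrite -cardE.
case E : (enum K) => [|k0 [|k1 [|k2 [|k3 [|]]]]] // _.
exact: simplex_polyhedral E indK.
Qed.

(** An open set is the union of the countably many boxes with rational corners
    that it contains. *)
Lemma open_measurable_vec3 (R : realType) (X : set (vec3 R)) :
  open X -> measurable (X : set (mvec3 R)).
Proof.
move=> oX.
pose box (q : (rat * rat) * (rat * rat) * (rat * rat)) : set (mvec3 R) :=
  let I (a : rat * rat) : set (measurableTypeR R) :=
    `]ratr a.1, ratr a.2[%classic in
  I q.1.1 `*` I q.1.2 `*` I q.2.
pose F q := if `[< box q `<=` X >] then box q else set0.
have -> : X = \bigcup_q F q.
  apply/seteqP; split => r.
    move=> Xr; have /nbhs_ballP[e /= e0 he] : nbhs r X by apply: open_nbhs_nbhs.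
    have key (c : R) : exists a : rat * rat,
        ratr a.1 < c < ratr a.2 /\ forall y, ratr a.1 < y < ratr a.2 -> ball c e y.
      have [] := @rat_in_itvoo R (c - e) c; first by lra.
      move=> a; rewrite in_itv /= => /andP[a1 a2].
      have [] := @rat_in_itvoo R c (c + e); first by lra.
      move=> b; rewrite in_itv /= => /andP[b1 b2].
      exists (a, b); split => /=; first by rewrite a2.
      move=> y /andP[y1 y2]; rewrite /ball /= ltr_norml; apply/andP; lra.
    have [a0 [h0 b0]] := key r.1.1.
    have [a1 [h1 b1]] := key r.1.2.
    have [a2 [h2 b2]] := key r.2.
    exists (a0, a1, a2) => //; rewrite /F; case: asboolP => [_|[]].
      by split; first split; rewrite /= in_itv.
    move=> y [[/= y0 y1] y2]; apply: he.
    move: y0 y1 y2; rewrite /= !in_itv /= => /b0 ? /b1 ? /b2 ?.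
    by split; first split.
  case=> q _; rewrite /F; case: asboolP => // h; exact: h.
apply: countable_bigcupT_measurable; first exact: countableP.
move=> q; rewrite /F; case: asboolP => // _.
by apply: measurableX; first apply: measurableX; exact: measurable_itv.
Qed.

Section Mesh.
Variables (R : realType) (X : set (vec3 R)) (M : mesh R).
Hypotheses (openX : open X) (meshM : mesh_of X M).
Local Notation mu3 := (lebesgue3 R).
Implicit Types (f g v w : vec3 R -> R) (K : cellT M).

Lemma mesh_cell_open K : K \in cells M -> open (cell_pts K).
Proof. by case/(mesh_polyhedral meshM) => P; exact: cell_open P. Qed.

Lemma mesh_cell_measurable K : K \in cells M ->
  measurable (cell_pts K : set (mvec3 R)).
Proof. by case/(mesh_polyhedral meshM) => P; exact: cell_measurable P. Qed.

Lemma mesh_cell_bounded K : K \in cells M -> bounded3 (cell_pts K).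
Proof. by case/(mesh_polyhedral meshM) => P; exact: cell_bounded P. Qed.

Lemma mesh_cell_neq0 K : K \in cells M -> exists r, cell_pts K r.
Proof. by case/(mesh_polyhedral meshM) => P; exact: cell_neq0 P. Qed.

Lemma mesh_cell_sub K : K \in cells M -> cell_pts K `<=` X.
Proof. by case: meshM => -[h _ _] _; exact: h. Qed.

Lemma mesh_cell_disjoint K L r : K \in cells M -> L \in cells M ->
  cell_pts K r -> cell_pts L r -> K = L.
Proof.
case: meshM => -[_ h _] _ KC LC Kr Lr; apply/eqP/negPn/negP => /(h K L KC LC) E.
by have : (cell_pts K `&` cell_pts L) r by []; rewrite E.
Qed.

Lemma domain_measurable : measurable (X : set (mvec3 R)).
Proof. exact: open_measurable_vec3. Qed.

Definition cells_union : set (vec3 R) :=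
  \bigcup_(K in [set K | K \in cells M]) cell_pts K.

Lemma cells_union_measurable : measurable (cells_union : set (mvec3 R)).
Proof.
apply: fin_bigcup_measurable; first exact: finite_finset.
by move=> K; exact: mesh_cell_measurable.
Qed.

Lemma cells_union_sub : cells_union `<=` X.
Proof. by move=> r [K KC]; exact: mesh_cell_sub. Qed.

(** A point of [X] outside all cells is a boundary point of some cell. *)
Lemma skeleton_null : mu3 (X `\` cells_union) = 0%E.
Proof.
have mX := domain_measurable; have mU := cells_union_measurable.
apply/(negligibleP _ (measurableD mX mU)).
have h0 K : exists N : set (mvec3 R), K \in cells M ->
    [/\ measurable N, mu3 N = 0%E & closure (cell_pts K) `\` cell_pts K `<=` N].
  have [KC|] := boolP (K \in cells M); last by exists set0.
  have [P] := mesh_polyhedral meshM KC.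
  by have [N [mN N0] sN] := cell_closure_null P; exists N.
have [N hN] := choice h0.
apply: (@negligibleS _ _ _ _ (\big[setU/set0]_(K <- enum (cells M)) N K)).
  move=> r [Xr Ur]; rewrite -bigcup_seq.
  have [_ _ /(_ r Xr) [K KC clK]] := meshM.1.
  exists K; first by rewrite /= mem_enum.
  have [_ _] := hN K KC; apply; split => // Kr; apply: Ur.
  by exists K.
rewrite big_seq; apply: (big_ind (fun A : set (mvec3 R) => mu3.-negligible A)).
- exact: negligible_set0.
- by move=> A A' ? ?; exact: negligibleU.
- move=> K; rewrite mem_enum => KC; have [mN N0 _] := hN K KC.
  by exists (N K); split.
Qed.

Definition integrable_on f := mu3.-integrable X (EFin \o f).

Lemma integrable_on_measurable f : integrable_on f -> measurable_on X f.
Proof. by move=> /measurable_int /measurable_EFinP. Qed.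

Lemma integrable_on_cells f : measurable_on X f ->
  (integrable_on f <-> mu3.-integrable cells_union (EFin \o f)).
Proof.
move=> mf; have mX := domain_measurable; have mU := cells_union_measurable.
have XU : X `\` (X `\` cells_union) = cells_union.
  by rewrite setDD; apply/setIidPr; exact: cells_union_sub.
rewrite -XU; apply: negligible_integrable => //.
- exact: measurableD.
- exact/measurable_EFinP.
- exact: skeleton_null.
Qed.

Lemma volint_cells_union f : integrable_on f -> volint X f = volint cells_union f.
Proof.
move=> If; have mX := domain_measurable; have mU := cells_union_measurable.
have XU : X `\` (X `\` cells_union) = cells_union.
  by rewrite setDD; apply/setIidPr; exact: cells_union_sub.
rewrite /volint /Rintegral -XU; congr fine.
by apply: negligible_integral => //; [exact: measurableD|exact: skeleton_null].
Qed.

Lemma eq_volint f g : integrable_on f -> integrable_on g -> dg_eq M f g ->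
  volint X f = volint X g.
Proof.
move=> If Ig fg; rewrite !volint_cells_union//.
by apply: eq_Rintegral => r /set_mem [K KC Kr]; exact: fg Kr.
Qed.

Lemma volintD f g : integrable_on f -> integrable_on g ->
  volint X (fun r => f r + g r) = volint X f + volint X g.
Proof. by move=> If Ig; apply: RintegralD => //; exact: domain_measurable. Qed.

Lemma volintB f g : integrable_on f -> integrable_on g ->
  volint X (fun r => f r - g r) = volint X f - volint X g.
Proof. by move=> If Ig; apply: RintegralB => //; exact: domain_measurable. Qed.

Lemma volintZ c f : integrable_on f -> volint X (fun r => c * f r) = c * volint X f.
Proof. by move=> If; apply: RintegralZl => //; exact: domain_measurable. Qed.

Lemma integrable_onD f g : integrable_on f -> integrable_on g ->
  integrable_on (fun r => f r + g r).
Proof.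
move=> If Ig; apply: eq_integrable (integrableD _ If Ig) => //;
  exact: domain_measurable.
Qed.

Lemma integrable_onZ c f : integrable_on f -> integrable_on (fun r => c * f r).
Proof.
by move=> If; apply: eq_integrable (integrableZl _ c If) => //; exact: domain_measurable.
Qed.

Lemma integrable_onB f g : integrable_on f -> integrable_on g ->
  integrable_on (fun r => f r - g r).
Proof.
move=> If Ig; have := integrable_onD If (integrable_onZ (-1) Ig).
by under [X in integrable_on X]eq_fun do rewrite mulN1r.
Qed.

Lemma volint_sum (I : Type) (s : seq I) (P : pred I) (c : I -> R)
    (F : I -> vec3 R -> R) : (forall i, P i -> integrable_on (F i)) ->
  integrable_on (fun r => \sum_(i <- s | P i) c i * F i r) /\
  volint X (fun r => \sum_(i <- s | P i) c i * F i r) =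
  \sum_(i <- s | P i) c i * volint X (F i).
Proof. by move=> hF; apply: Rintegral_sum => //; exact: domain_measurable. Qed.

Lemma volint_sum_cells f : integrable_on f ->
  volint X f = \sum_(K in cells M) volint (cell_pts K) f.
Proof.
move=> If; rewrite volint_cells_union//.
have mX := domain_measurable; have mU := cells_union_measurable.
have IK K : K \in cells M -> mu3.-integrable setT (EFin \o (f \_ (cell_pts K))).
  move=> KC; rewrite -restrict_EFin; apply/integrable_restrict => //.
    exact: mesh_cell_measurable.
  rewrite setTI; apply: integrableS If => //; last exact: mesh_cell_sub.
  exact: mesh_cell_measurable.
rewrite /volint Rintegral_mkcond.
have [_ sumE] := Rintegral_sum (index_enum _) (fun=> 1) measurableT IK.
transitivity (\sum_(K in cells M) 1 * \int[mu3]_x (f \_ (cell_pts K)) x).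
  rewrite -sumE; apply: eq_Rintegral => r _.
  rewrite patchE; case: ifPn => [/set_mem [K KC Kr]|rU].
    rewrite (bigD1 K)//= mul1r patchE mem_set// big1 ?addr0// => L /andP[LC LK].
    rewrite mul1r patchE; case: ifPn => // /set_mem Lr.
    by rewrite (mesh_cell_disjoint LC KC Lr Kr) eqxx in LK.
  rewrite big1// => K KC; rewrite mul1r patchE; case: ifPn => // /set_mem Kr.
  by case/negP: rU; apply/mem_set; exists K.
by apply: eq_bigr => K _; rewrite mul1r -Rintegral_mkcond.
Qed.

(** No bound on the degree, unlike in the discrete spaces: products of discrete
    functions must be covered. *)
Definition cellpoly f :=
  forall K, K \in cells M -> exists2 p, polyfun p & forall r, cell_pts K r -> f r = p r.

Lemma cellpolyD f g : cellpoly f -> cellpoly g -> cellpoly (fun r => f r + g r).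
Proof.
move=> hf hg K KC; have [p pp fp] := hf K KC; have [q pq gq] := hg K KC.
by exists (fun r => p r + q r); [exact: polyfunD|move=> r Kr; rewrite fp// gq].
Qed.

Lemma cellpolyM f g : cellpoly f -> cellpoly g -> cellpoly (fun r => f r * g r).
Proof.
move=> hf hg K KC; have [p pp fp] := hf K KC; have [q pq gq] := hg K KC.
by exists (fun r => p r * q r); [exact: polyfunM|move=> r Kr; rewrite fp// gq].
Qed.

Lemma cellpoly_cst c : cellpoly (fun=> c).
Proof. by move=> K KC; exists (fun=> c); [exact: polyfun_cst|]. Qed.

Lemma cellpoly_bounded f : cellpoly f ->
  exists C, forall r, cells_union r -> `|f r| <= C.
Proof.
move=> hf; have h0 K : exists C, K \in cells M -> forall r, cell_pts K r -> `|f r| <= C.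
  have [KC|] := boolP (K \in cells M); last by exists 0.
  have [p pp fp] := hf K KC.
  have [C hC] := polyfun_bounded (mesh_cell_bounded KC) pp.
  by exists C => _ r Kr; rewrite fp// hC.
have [C hC] := choice h0.
exists (\sum_(K in cells M) `|C K|) => r [K /= KC Kr].
rewrite (bigD1 K)//=; apply: le_trans (hC K KC r Kr) _.
by apply: le_trans (ler_norm _) _; rewrite lerDl sumr_ge0.
Qed.

Lemma cells_union_finite : (mu3 cells_union < +oo)%E.
Proof.
apply: bounded3_finite; last exact: cells_union_measurable.
pose cr i := fun r : vec3 R => crd r i.
have h0 i : exists C, forall r, cells_union r -> `|crd r i| <= C.
  by apply: (@cellpoly_bounded (cr i)) => K KC; exists (cr i) => //; exact: polyfun_crd.
have [C hC] := choice h0.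
exists (\sum_i `|C i|) => r i Ur; rewrite (bigD1 i)//=.
apply: le_trans (hC i r Ur) _.
by apply: le_trans (ler_norm _) _; rewrite lerDl sumr_ge0.
Qed.

Lemma cellpoly_integrable f : measurable_on X f -> cellpoly f -> integrable_on f.
Proof.
move=> mf /cellpoly_bounded [C hC]; apply/(integrable_on_cells mf).
have mU := cells_union_measurable.
apply: (@le_integrable _ _ _ _ _ mU _ (EFin \o cst C)).
- apply/measurable_EFinP; apply: measurable_funS mf => //.
  + exact: domain_measurable.
  + exact: cells_union_sub.
- by move=> r Ur /=; rewrite lee_fin (le_trans (hC r Ur))// ler_norm.
- apply/integrableP; split; first exact/measurable_EFinP/measurable_cst.
  rewrite (eq_integral (cst `|C|%:E))// integral_cst//.
  by rewrite lte_mul_pinfty// cells_union_finite.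
Qed.

End Mesh.

(** * Discontinuous polynomial spaces *)

Lemma open_not_negligible (R : realType) (A : set (vec3 R)) r :
  open A -> A r -> ~ (lebesgue3 R).-negligible (A : set (mvec3 R)).
Proof.
move=> oA Ar [N [mN N0 AN]].
have /nbhs_ballP[e /= e0 he] : nbhs r A by apply: open_nbhs_nbhs.
pose I (c : R) : set (measurableTypeR R) := `]c - e, c + e[%classic.
have mI c : measurable (I c) by exact: measurable_itv.
have IE c : lebesgue_measure (I c) = (e + e)%:E.
  rewrite /I lebesgue_measure_itv /= lte_fin ifT; last by lra.
  by rewrite -EFinB; congr EFin; ring.
have BN : I r.1.1 `*` I r.1.2 `*` I r.2 `<=` N.
  move=> y [[/= y0 y1] y2]; apply: AN; apply: he.
  have b c z : I c z -> ball c e z.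
    by rewrite /I /= in_itv /= /ball /= ltr_norml => /andP[? ?]; apply/andP; lra.
  by split; first split; apply: b.
have : (lebesgue3 R (I r.1.1 `*` I r.1.2 `*` I r.2) <= lebesgue3 R N)%E.
  apply: le_measure; rewrite ?inE//.
  by apply: measurableX => //; exact: measurableX.
have -> : lebesgue3 R (I r.1.1 `*` I r.1.2 `*` I r.2) =
    ((e + e)%:E * (e + e)%:E * (e + e)%:E)%E.
  rewrite -{1}(IE r.1.1) -{1}(IE r.1.2) -(IE r.2).
  apply: etrans; first by apply: product_measure1E => //; exact: measurableX.
  by congr (_ * _)%E; exact: product_measure1E.
by rewrite N0 -!EFinM lee_fin leNgt !mulr_gt0// addr_gt0.
Qed.

Section Pieces.
Variables (R : realType) (X : set (vec3 R)) (M : mesh R).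
Hypotheses (openX : open X) (meshM : mesh_of X M).
Local Notation mu3 := (lebesgue3 R).
Local Notation mR := (measurableTypeR R).
Local Notation integrable_on := (integrable_on X).
Local Notation U := (cells_union M).
Implicit Types (f g v w : vec3 R -> R) (K : cellT M).

(** By continuity, a positive value in an open cell persists on an open subset,
    which is not a null set. *)
Lemma cellpoly_eq0 f : measurable_on X f -> cellpoly M f ->
  (forall r, U r -> 0 <= f r) -> volint X f = 0 -> dg_eq M f (fun=> 0).
Proof.
move=> mf pf f0 If0 K KC r Kr; apply/eqP/negPn/negP => fr0.
have If := cellpoly_integrable openX meshM mf pf.
have mU := cells_union_measurable meshM.
have mfU : measurable_fun (U : set (mvec3 R)) (EFin \o f).
  apply/measurable_EFinP; apply: measurable_funS mf => //.
    exact: domain_measurable.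
  exact: cells_union_sub.
have IU : (\int[mu3]_(x in U) `|(EFin \o f) x| = 0)%E.
  have IfU := (integrable_on_cells openX meshM mf).1 If.
  transitivity (\int[mu3]_(x in U) (EFin \o f) x)%E.
    by apply: eq_integral => x /set_mem Ux /=; rewrite ger0_norm// f0.
  rewrite (volint_cells_union openX meshM If) /volint /Rintegral in If0.
  rewrite -[LHS]fineK; last first.
    exact: (@integrable_fin_num _ _ _ mu3 U mU (EFin \o f) IfU).
  by rewrite If0.
have [p pp fp] := pf K KC.
have oA : open (cell_pts K `&` [set x | 0 < p x]).
  apply: openI; first exact: (mesh_cell_open meshM KC).
  have := @open_comp _ _ p [set y : R | 0 < y].
  apply; last exact: open_gt.
  by move=> x _; exact: polyfun_continuous.
apply: (open_not_negligible oA (r := r)).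
  split => //=; rewrite -fp// lt_neqAle eq_sym fr0 f0//.
  by exists K.
have := (ae_eq_integral_abs mu3 mU mfU).1 IU.
move=> [N [mN N0 hN]]; exists N; split => // x [Kx px]; apply: hN => /= h.
have Ux : U x by exists K.
by have [] := h Ux; move/eqP; rewrite fp// gt_eqF.
Qed.

Lemma poly_spaceD k p q a b : poly_space M k p -> poly_space M k q ->
  poly_space M k (fun r => a * p r + b * q r).
Proof.
move=> [c pE] [d qE]; exists (fun al => a * c al + b * d al) => r.
rewrite pE qE !mulr_sumr -big_split; apply: eq_bigr => al _ /=; ring.
Qed.

Lemma poly_space0 k : poly_space M k (fun=> 0).
Proof. by exists (fun=> 0) => r; rewrite big1// => al _; rewrite mul0r. Qed.

Lemma poly_space_cst (c : R) : poly_space M 0 (fun=> c).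
Proof.
exists (fun=> c) => r; rewrite (bigD1 [ffun=> ord0])/=; last first.
  by rewrite /monomial_in; case: kind => //; rewrite big1// => i _; rewrite ffunE.
rewrite big1 => [|i _]; last by rewrite ffunE expr0.
rewrite mulr1 big1 ?addr0// => al /andP[_ /eqP[]].
by apply/ffunP => i; rewrite ffunE; case: (al i) => -[|//] ?; exact: val_inj.
Qed.

Lemma poly_space0_cst p : poly_space M 0 p -> exists c, forall r, p r = c.
Proof.
move=> [c pE]; exists (\sum_(a | @monomial_in _ M 0 a) c a) => r.
rewrite pE; apply: eq_bigr => al _; rewrite big1 ?mulr1// => i _.
by rewrite (ord1 (al i)) expr0.
Qed.

Lemma dg_measurable k v : dg_space X M k v -> measurable_on X v.
Proof. by case=> -[]. Qed.

Lemma dg_cellpoly k v : dg_space X M k v -> cellpoly M v.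
Proof.
move=> [_ h] K KC; have [p pp vp] := h K KC.
by exists p => //; exact: poly_space_polyfun pp.
Qed.

Lemma dg_intro k v : measurable_on X v ->
  (forall K, K \in cells M ->
    exists2 p, poly_space M k p & forall r, cell_pts K r -> v r = p r) ->
  dg_space X M k v.
Proof.
move=> mv hv; split => //; split => //.
have pv : cellpoly M v.
  move=> K KC; have [p pp vp] := hv K KC.
  by exists p => //; exact: poly_space_polyfun pp.
apply: (@cellpoly_integrable _ X M) => //.
  by under [X in measurable_on _ X]eq_fun do rewrite expr2; exact: measurable_funM.
by under [X in cellpoly _ X]eq_fun do rewrite expr2; exact: cellpolyM.
Qed.

Lemma dgD k v w a b : dg_space X M k v -> dg_space X M k w ->
  dg_space X M k (fun r => a * v r + b * w r).
Proof.
move=> hv hw; apply: dg_intro.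
  have mv := dg_measurable hv; have mw := dg_measurable hw.
  by apply: measurable_funD; apply: measurable_funM.
move=> K KC; have [p pp vp] := hv.2 K KC; have [q pq wq] := hw.2 K KC.
exists (fun r => a * p r + b * q r); first exact: poly_spaceD.
by move=> r Kr; rewrite vp// wq.
Qed.

Lemma dg_zero k : dg_space X M k (fun=> 0).
Proof.
apply: dg_intro; first exact: measurable_cst.
by move=> K _; exists (fun=> 0) => //; exact: poly_space0.
Qed.

Lemma dg_sum k (I : Type) (s : seq I) (c : I -> R) (F : I -> vec3 R -> R) :
  (forall i, dg_space X M k (F i)) ->
  dg_space X M k (fun r => \sum_(i <- s) c i * F i r).
Proof.
move=> hF; elim: s => [|i s ih].
  by under eq_fun do rewrite big_nil; exact: dg_zero.
under eq_fun do rewrite big_cons -[X in _ + X]mul1r.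
exact: dgD.
Qed.

Lemma dg_indic K : K \in cells M -> dg_space X M 0 (\1_(cell_pts K)).
Proof.
move=> KC; apply: dg_intro.
  by apply: measurable_indic; exact: (mesh_cell_measurable meshM KC).
move=> L LC; exists (fun=> (L == K)%:R); first exact: poly_space_cst.
move=> r Lr; rewrite indicE; congr (nat_of_bool _)%:R.
apply/idP/eqP => [/set_mem Kr|<-]; last exact: mem_set.
exact: (mesh_cell_disjoint meshM LC KC Lr Kr).
Qed.

Lemma dg_mul_integrable k l v w : dg_space X M k v -> dg_space X M l w ->
  integrable_on (fun r => v r * w r).
Proof.
move=> hv hw; apply: (@cellpoly_integrable _ X M) => //.
  by apply: measurable_funM; [exact: dg_measurable hv|exact: dg_measurable hw].
by apply: cellpolyM; [exact: dg_cellpoly hv|exact: dg_cellpoly hw].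
Qed.

Lemma L2_mul_integrable k f v : L2 X f -> dg_space X M k v ->
  integrable_on (fun r => f r * v r).
Proof.
move=> [mf If] hv; have Iv := dg_mul_integrable hv hv.
have mX := domain_measurable openX; have mv := dg_measurable hv.
apply: (@le_integrable _ _ _ _ _ mX _ (EFin \o (fun r => f r ^+ 2 + v r * v r))).
- by apply/measurable_EFinP; exact: measurable_funM.
- move=> r _ /=; rewrite lee_fin normrM [leRHS]ger0_norm; last first.
    by rewrite addr_ge0 ?sqr_ge0// -expr2 sqr_ge0.
  rewrite -expr2 -[f r ^+ 2]real_normK ?num_real// -[v r ^+ 2]real_normK ?num_real//.
  have := sqr_ge0 (`|f r| - `|v r|); have := sqr_ge0 (`|f r| + `|v r|); nra.
- exact: (integrable_onD openX If Iv).
Qed.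

End Pieces.

(** * Cross sections *)

Section Coefficients.
Variables (R : realType) (X : set (vec3 R)) (M : mesh R).
Hypotheses (openX : open X) (meshM : mesh_of X M).
Local Notation mu3 := (lebesgue3 R).
Variables sigt siga : vec3 R -> R.
Hypotheses (sigt_dg : dg_space X M 0 sigt) (siga_meas : measurable_on X siga).
Hypothesis sig_bounds : {ae mu3, forall r, X r -> 0 < siga r <= sigt r}.

(** The bounds hold almost everywhere and a cell is not a null set, so the
    constant value on a cell must satisfy them. *)
Lemma sigt_pos K : K \in cells M ->
  exists2 c, 0 < c & forall r, cell_pts K r -> sigt r = c.
Proof.
move=> KC; have [p pp sp] := sigt_dg.2 K KC.
have [c pc] := poly_space0_cst pp.
exists c; last by move=> r Kr; rewrite sp// pc.
rewrite ltNge; apply/negP => c0.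
have [r Kr] := mesh_cell_neq0 meshM KC.
apply: (open_not_negligible (mesh_cell_open meshM KC) Kr).
have [N [mN N0 hN]] := sig_bounds; exists N; split => // x Kx; apply: hN => /= h.
have := h (mesh_cell_sub meshM KC Kx); rewrite sp// pc => /andP[s0 s1].
by have := lt_le_trans s0 (le_trans s1 c0); rewrite ltxx.
Qed.

(** The absorption cross section is dominated by the total one, which is
    polynomial on the cells. *)
Lemma siga_mul_integrable g : measurable_on X g -> cellpoly M g ->
  integrable_on X (fun r => siga r * g r).
Proof.
move=> mg pg.
have mX := domain_measurable openX; have mst := dg_measurable sigt_dg.
have Ig : integrable_on X (fun r => sigt r * g r).
  apply: (@cellpoly_integrable _ X M) => //; first exact: measurable_funM.
  by apply: cellpolyM => //; exact: dg_cellpoly sigt_dg.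
have [N [mN N0 hN]] := sig_bounds.
have mXN := measurableD mX mN.
have mag : measurable_fun (X : set (mvec3 R)) (EFin \o (fun r => siga r * g r)).
  by apply/measurable_EFinP; exact: measurable_funM.
apply/(negligible_integrable mN mX mag N0).
apply: (@le_integrable _ _ _ _ _ mXN _ (EFin \o (fun r => sigt r * g r))).
- by apply: measurable_funS mag.
- move=> r [Xr Nr] /=; rewrite lee_fin !normrM ler_wpM2r//.
  have /andP[s0 s1] : 0 < siga r <= sigt r.
    by apply: contrapT => h; apply: Nr; apply: hN => /= h'; exact/h/h'.
  by rewrite !ger0_norm// ?ltW// (lt_le_trans s0).
- by apply: integrableS Ig => //.
Qed.

End Coefficients.

(** * Cellwise gradients *)

Section Gradients.
Variables (R : realType) (X : set (vec3 R)) (M : mesh R).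
Hypotheses (openX : open X) (meshM : mesh_of X M).
Implicit Types (v : vec3 R -> R) (K : cellT M).

Record piece v K (p : vec3 R -> R) (G : 'I_3 -> vec3 R -> R) : Prop := Piece {
  piece_poly : polyfun p;
  piece_grad_poly : forall i, polyfun (G i);
  piece_derive : forall r w, is_derive r w p (\sum_(i < 3) crd w i * G i r);
  piece_val : forall r, cell_pts K r -> v r = p r;
  piece_grad : forall r, cell_pts K r ->
    forall a, crd (cellwise_grad M v r) a = G a r }.

Lemma dg_piece k v K : dg_space X M k v -> K \in cells M ->
  exists p G, piece v K p G.
Proof.
move=> hv KC; have [p pp vp] := dg_cellpoly hv KC.
have [G pG dG] := polyfun_derive pp.
exists p, G; split => // r Kr a.
have Ur : cells_union M r by exists K.
rewrite /cellwise_grad crdZ indicE -/(cells_union M) mem_set// mul1r /grad crd_mkpt.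
have -> : 'D_(Defs.basis R a) v r = 'D_(Defs.basis R a) p r.
  apply: near_eq_derive; have oK := mesh_cell_open meshM KC.
  have : nbhs r (cell_pts K) by apply: open_nbhs_nbhs.
  by apply: filterS => x; exact: vp.
have dp := dG r (Defs.basis R a); rewrite derive_val.
rewrite (bigD1 a)//= crd_basis eqxx mul1r big1 ?addr0// => i /negPf ia.
by rewrite crd_basis ia mul0r.
Qed.

(** The derivative is a finite sum of polynomials cut off to the cells, also at
    the points of the skeleton, where both are zero. *)
Lemma cellwise_grad_measurable k v a : dg_space X M k v ->
  measurable_on X (fun r => crd (cellwise_grad M v r) a).
Proof.
move=> hv.
have h0 K : exists G, K \in cells M -> polyfun G /\
    forall r, cell_pts K r -> crd (cellwise_grad M v r) a = G r.
  have [KC|] := boolP (K \in cells M); last by exists (fun=> 0).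
  have [p [G P]] := dg_piece hv KC.
  exists (G a) => _; split; first exact: (piece_grad_poly P).
  by move=> r Kr; rewrite (piece_grad P).
have [G hG] := choice h0.
have -> : (fun r => crd (cellwise_grad M v r) a) =
    (fun r => \sum_(K <- enum (cells M)) \1_(cell_pts K) r * G K r).
  apply/funext => r; rewrite big_enum /=.
  have [[K KC Kr]|Ur] := pselect (cells_union M r).
    rewrite (bigD1 K)//= indicE mem_set// mul1r (hG K KC).2// big1 ?addr0//.
    move=> L /andP[LC LK]; rewrite indicE memNset ?mul0r// => Lr.
    by rewrite (mesh_cell_disjoint meshM LC KC Lr Kr) eqxx in LK.
  rewrite /cellwise_grad crdZ indicE -/(cells_union M) memNset// mul0r big1// => K KC.
  by rewrite indicE memNset ?mul0r// => Kr; apply: Ur; exists K.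
apply: measurable_funTS; rewrite (_ : (fun r => _) =
  (fun r => \sum_(K <- enum (cells M)) (if K \in cells M then
    \1_(cell_pts K) r * G K r else 0))); last first.
  by apply/funext => r; rewrite !big_enum; apply: eq_bigr => K ->.
apply: measurable_sum => K.
have [KC|KC] := boolP (K \in cells M); last exact: measurable_cst.
apply: measurable_funM.
  by apply: measurable_indic; exact: (mesh_cell_measurable meshM KC).
exact: polyfun_measurable (hG K KC).1.
Qed.

Lemma cellwise_grad_cellpoly k v a : dg_space X M k v ->
  cellpoly M (fun r => crd (cellwise_grad M v r) a).
Proof.
move=> hv K KC; have [p [G P]] := dg_piece hv KC.
exists (G a); first exact: (piece_grad_poly P).
by move=> r Kr; rewrite (piece_grad P).
Qed.

End Gradients.

(** * The two sides of a face *)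

Section SideDefinitions.
Variables (R : realType) (M : mesh R) (n : faceT M -> vec3 R).
Variables Km Kp : faceT M -> cellT M.

(** [Km e] is the cell from which the trace v^- on [e] is taken, [Kp e] the one for
    v^+. *)
Definition minus_side := forall e, e \in @faces R M -> Km e \in cells M /\
  forall r, (face_map e @` ref_face M) r ->
    \forall eps \near 0^'+, cell_pts (Km e) (r - eps *: n e).

Definition plus_side := forall e, e \in @faces R M -> ~~ exterior e ->
  Kp e \in cells M /\
  forall r, (face_map e @` ref_face M) r ->
    \forall eps \near 0^'+, cell_pts (Kp e) (r + eps *: n e).

(** One polynomial for each cell, since the two traces on a face may differ. *)
Definition mesh_gauss :=
  forall (g : cellT M -> vec3 R -> R) (G : cellT M -> 'I_3 -> vec3 R -> R) j,
    (forall K, K \in cells M -> [/\ polyfun (g K),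
      forall i, polyfun (G K i) &
      forall r w, is_derive r w (g K) (\sum_(i < 3) crd w i * G K i r)]) ->
  \sum_(K in cells M) volint (cell_pts K) (G K j) =
  \sum_(e in @faces R M) crd (n e) j * (faceint e (g (Km e)) -
    if exterior e then 0 else faceint e (g (Kp e))).

End SideDefinitions.

Section Sides.
Variables (R : realType) (X : set (vec3 R)) (M : mesh R).
Hypotheses (openX : open X) (meshM : mesh_of X M).
Hypothesis X_neq0 : X !=set0.
Variable n : faceT M -> vec3 R.
Hypothesis normals : unit_normals X n.
Implicit Types (v : vec3 R -> R) (K : cellT M) (e : faceT M).
Local Notation face_pts e := (face_map e @` ref_face M).

Lemma cell_face_in_faces e K : K \in cells M -> face_of e K -> e \in @faces R M.
Proof. by move=> KC eK; apply/exists_inP; exists K. Qed.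

(** Two cells on the same side of a face would overlap near the face, so a face
    has at most one cell on each side. The cell of an exterior face lies behind
    it because the normal points out of [X]. Exchanging the sums over cells and
    faces in the cellwise divergence theorem then leaves one term for each
    side. *)
Lemma mesh_sides : exists Km Kp : faceT M -> cellT M,
  [/\ minus_side n Km, plus_side n Kp & mesh_gauss n Km Kp].
Proof.
have h0 K : exists s : faceT M -> R, K \in cells M ->
    (forall e, face_of e K -> (s e = 1 \/ s e = -1) /\
      forall r, face_pts e r ->
        \forall eps \near 0^'+, cell_pts K (r - (s e * eps) *: n e)) /\
    (forall g (G : 'I_3 -> vec3 R -> R) j, polyfun g ->
      (forall i, polyfun (G i)) ->
      (forall r w, is_derive r w g (\sum_(i < 3) crd w i * G i r)) ->
      volint (cell_pts K) (G j) =
        \sum_(e | face_of e K) s e * crd (n e) j * faceint e g).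
  have [KC|] := boolP (K \in cells M); last by exists (fun=> 0).
  have [P] := mesh_polyhedral meshM KC.
  have [|s hs] := cell_normals (n := n) P; last by exists s.
  by move=> e eK; have [? ? ? _] := normals (cell_face_in_faces KC eK).
have {h0}[s hs] := choice h0.
have same e K L : K \in cells M -> L \in cells M -> face_of e K -> face_of e L ->
    s K e = s L e -> K = L.
  move=> KC LC eK eL sKL; have [t Ft] := ref_face_neq0 M.
  have rF : face_pts e (face_map e t) by exists t.
  have nK := ((hs K KC).1 e eK).2 _ rF.
  have nL := ((hs L LC).1 e eL).2 _ rF; rewrite -sKL in nL.
  have [eps [Ke Le]] := filter_ex (filterI nK nL).
  exact: (mesh_cell_disjoint meshM KC LC Ke Le).
have h1 e : exists KK : cellT M * cellT M, e \in @faces R M ->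
    [/\ KK.1 \in cells M, face_of e KK.1, s KK.1 e = 1 &
    if exterior e then forall L, L \in cells M -> face_of e L -> L = KK.1 else
    [/\ KK.2 \in cells M, face_of e KK.2, s KK.2 e = -1 &
      forall L, L \in cells M -> face_of e L -> L = KK.1 \/ L = KK.2]].
  have [eF|] := boolP (e \in @faces R M); last first.
    have [r Xr] := X_neq0; have [_ _ /(_ r Xr) [K _ _]] := meshM.1.
    by exists (K, K).
  have /exists_inP[K KC eK] := eF.
  have [ex|ex] := boolP (exterior e).
    exists (K, K) => _; split => //=; last first.
      move=> L LC eL; have /card1P[K' hK'] := ex.
      have := hK' K; have := hK' L; rewrite !inE KC LC eK eL /=.
      by move=> /esym/eqP -> /esym/eqP.
    have [[//|sK] _] := (hs K KC).1 e eK.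
    have [t Ft] := ref_face_neq0 M.
    have rF : face_pts e (face_map e t) by exists t.
    have nK := ((hs K KC).1 e eK).2 _ rF; rewrite sK in nK.
    have [_ _ _ /(_ ex _ rF) nX] := normals eF.
    have [eps [Ke [_ nXe]]] := filter_ex (filterI nK nX).
    by exfalso; apply: nXe; rewrite mulN1r scaleNr opprK in Ke;
      exact: (mesh_cell_sub meshM KC Ke).
  have [L [LC eL LK]] : exists L, [/\ L \in cells M, face_of e L & L != K].
    apply: contrapT => noL; case/negP: ex; apply/card1P; exists K => L.
    rewrite !inE; apply/andP/eqP => [[LC eL]|->//].
    by apply/eqP/negPn/negP => LK; apply: noL; exists L.
  have tri s1 s2 s3 : (s1 = 1 \/ s1 = -1 :> R) -> (s2 = 1 \/ s2 = -1) ->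
      (s3 = 1 \/ s3 = -1) -> s1 <> s2 -> s3 = s1 \/ s3 = s2.
    by move=> [->|->] [->|->] [->|->]; tauto.
  have sKL : s K e <> s L e.
    by move=> /(same _ _ _ KC LC eK eL) E; rewrite E eqxx in LK.
  have [sK _] := (hs K KC).1 e eK; have [sL _] := (hs L LC).1 e eL.
  have third L' : L' \in cells M -> face_of e L' -> L' = K \/ L' = L.
    move=> LC' eL'; have [sL' _] := (hs L' LC').1 e eL'.
    by have [E|E] := tri _ _ _ sK sL sL' sKL; [left|right]; apply: same E.
  case: sK => sK; [exists (K, L)|exists (L, K)] => _; split => //=;
    try (split => //); case: sL => sL //; try by rewrite sK sL in sKL.
  by move=> L' LC' eL'; have [->|->] := third L' LC' eL'; tauto.
have {h1}[KK hKK] := choice h1.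
exists (fun e => (KK e).1), (fun e => (KK e).2); split.
- move=> e eF; have [KC eK sK _] := hKK e eF; split => // r rF.
  have := ((hs _ KC).1 e eK).2 r rF; rewrite sK.
  by apply: filterS => eps; rewrite mul1r.
- move=> e eF /negPf ex; have [_ _ _] := hKK e eF; rewrite ex => -[KC eK sK _].
  split => // r rF; have := ((hs _ KC).1 e eK).2 r rF; rewrite sK.
  by apply: filterS => eps; rewrite mulN1r scaleNr opprK.
move=> g G j hG.
transitivity (\sum_(K in cells M) \sum_(e | face_of e K)
    s K e * crd (n e) j * faceint e (g K)).
  apply: eq_bigr => K KC; have [pg pG dG] := hG K KC.
  by rewrite ((hs K KC).2 (g K) (G K)).
rewrite (exchange_big_dep (mem (@faces R M)))/=; last first.
  by move=> K e; exact: cell_face_in_faces.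
apply: eq_bigr => e eF; have [KC eK sK hex] := hKK e eF.
rewrite (bigD1 (KK e).1)/= ?KC// sK mul1r mulrBr; congr (_ + _).
case: ifP hex => ex.
  move=> uniqK; rewrite mulr0 oppr0 big1// => L /andP[/andP[LC eL] /eqP[]].
  exact: uniqK.
move=> [LC eL sL third].
have LK : (KK e).2 != (KK e).1.
  by apply/eqP => E; move: sL; rewrite E sK => h; have : (1 : R) = -1 by []; lra.
rewrite (bigD1 (KK e).2)/= ?LC ?eL ?LK// sL mulN1r mulNr big1 ?addr0//.
move=> L' /andP[/andP[/andP[LC' eL'] /eqP n1] /eqP n2].
by have [] := third L' LC' eL'.
Qed.

End Sides.

(** * Polynomials on a face *)

Section FacePolynomials.
Variables (R : realType) (M : mesh R).
Implicit Types (f g : vec3 R -> R) (e : faceT M).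
Local Notation face_pts e := (face_map e @` ref_face M).

Definition facepoly e f :=
  exists2 p, polyfun p & forall r, face_pts e r -> f r = p r.

Lemma facepoly_cst e c : facepoly e (fun=> c).
Proof. by exists (fun=> c) => //; exact: polyfun_cst. Qed.

Lemma facepolyD e f g : facepoly e f -> facepoly e g ->
  facepoly e (fun r => f r + g r).
Proof.
move=> [p pp fp] [q pq gq]; exists (fun r => p r + q r); first exact: polyfunD.
by move=> r Fr; rewrite fp// gq.
Qed.

Lemma facepolyM e f g : facepoly e f -> facepoly e g ->
  facepoly e (fun r => f r * g r).
Proof.
move=> [p pp fp] [q pq gq]; exists (fun r => p r * q r); first exact: polyfunM.
by move=> r Fr; rewrite fp// gq.
Qed.

Lemma facepolyB e f g : facepoly e f -> facepoly e g ->
  facepoly e (fun r => f r - g r).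
Proof.
move=> [p pp fp] [q pq gq]; exists (fun r => p r - q r); first exact: polyfunB.
by move=> r Fr; rewrite fp// gq.
Qed.

Lemma eq_faceint e f g : (forall r, face_pts e r -> f r = g r) ->
  faceint e f = faceint e g.
Proof.
move=> fg; rewrite /faceint; congr (_ * _).
by apply: eq_Rintegral => s /set_mem Fs; apply: fg; exists s.
Qed.

Lemma facepoly_integrable e f : facepoly e f ->
  (lebesgue2 R).-integrable (ref_face M) (EFin \o (fun s => f (face_map e s))).
Proof.
move=> [p pp fp].
apply: eq_integrable (face_integrable e pp); first exact: ref_face_measurable.
by move=> s /set_mem Fs /=; rewrite fp//; exists s.
Qed.

Lemma faceintZ e c f : facepoly e f -> faceint e (fun r => c * f r) = c * faceint e f.
Proof.
move=> pf; rewrite /faceint RintegralZl; first by rewrite mulrCA.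
  exact: ref_face_measurable.
exact: facepoly_integrable.
Qed.

Lemma faceintD e f g : facepoly e f -> facepoly e g ->
  faceint e (fun r => f r + g r) = faceint e f + faceint e g.
Proof.
move=> pf pg; rewrite /faceint RintegralD; first by rewrite mulrDr.
- exact: ref_face_measurable.
- exact: facepoly_integrable.
- exact: facepoly_integrable.
Qed.

Lemma faceintB e f g : facepoly e f -> facepoly e g ->
  faceint e (fun r => f r - g r) = faceint e f - faceint e g.
Proof.
move=> pf pg; rewrite /faceint RintegralB; first by rewrite mulrBr.
- exact: ref_face_measurable.
- exact: facepoly_integrable.
- exact: facepoly_integrable.
Qed.

Lemma faceint0 e : faceint e (fun=> 0) = 0.
Proof.
by rewrite /faceint Rintegral_cst ?mul0r ?mulr0//; exact: ref_face_measurable.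
Qed.

Lemma faceint_sum e (I : Type) (s : seq I) (c : I -> R) (F : I -> vec3 R -> R) :
  (forall i, facepoly e (F i)) ->
  facepoly e (fun r => \sum_(i <- s) c i * F i r) /\
  faceint e (fun r => \sum_(i <- s) c i * F i r) =
  \sum_(i <- s) c i * faceint e (F i).
Proof.
move=> hF; elim: s => [|i s [ih1 ih2]].
  rewrite big_nil; under eq_fun do rewrite big_nil.
  by split; [exact: facepoly_cst|exact: faceint0].
rewrite big_cons; under eq_fun do rewrite big_cons.
have pc : facepoly e (fun r => c i * F i r).
  by apply: facepolyM => //; exact: facepoly_cst.
by split; [exact: facepolyD|rewrite faceintD// ih2 faceintZ].
Qed.

Lemma faceint_sqr_ge0 e f : 0 <= faceint e (fun r => f r ^+ 2).
Proof.
apply: mulr_ge0; first exact: sqrtr_ge0.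
by apply: Rintegral_ge0 => s _; exact: sqr_ge0.
Qed.

(** The trace [f] vanishes almost everywhere on the face. Orthogonality is the form
    in which the absence of jumps enters the flux terms. *)
Lemma faceint_sqr_eq0 e f g : facepoly e f -> facepoly e g ->
  faceint e (fun r => f r ^+ 2) = 0 -> faceint e (fun r => f r * g r) = 0.
Proof.
move=> pf pg /eqP; rewrite /faceint mulf_eq0 => /orP[/eqP->|/eqP I0].
  by rewrite mul0r.
have mF := @ref_face_measurable R M.
have i2 : (lebesgue2 R).-integrable (ref_face M)
    (EFin \o (fun s => f (face_map e s) ^+ 2)).
  have := facepoly_integrable (facepolyM pf pf).
  by apply: eq_integrable => // s _ /=; rewrite expr2.
have ifg := facepoly_integrable (facepolyM pf pg).
have ae0 : ae_eq (lebesgue2 R) (ref_face M)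
    (EFin \o (fun s => f (face_map e s) ^+ 2)) (cst 0%E).
  apply/(ae_eq_integral_abs _ mF (measurable_int _ i2)).
  pose h s : \bar R := (EFin \o (fun s => f (face_map e s) ^+ 2)) s.
  transitivity (\int[lebesgue2 R]_(s in ref_face M) h s)%E.
    by apply: eq_integral => s _; rewrite gee0_abs// /h /= lee_fin sqr_ge0.
  rewrite -[LHS]fineK; last exact: (@integrable_fin_num _ _ _ (lebesgue2 R) _ mF _ i2).
  by move: I0; rewrite /Rintegral => ->.
have -> : \int[lebesgue2 R]_(s in ref_face M) (f (face_map e s) * g (face_map e s))
    = 0; last by rewrite mulr0.
rewrite /Rintegral (ae_eq_integral (cst 0%E))//.
- by rewrite integral0.
- exact: measurable_int ifg.
- have [N [mN N0 hN]] := ae0; exists N; split => // s hs; apply: hN => /= h.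
  apply: hs => /= Fs; have := h Fs; rewrite /cst => -[/eqP].
  by rewrite sqrf_eq0 => /eqP ->; rewrite mul0r.
Qed.

End FacePolynomials.

(** * Traces, jumps and integration by parts *)

Section Traces.
Variables (R : realType) (X : set (vec3 R)) (M : mesh R).
Hypotheses (openX : open X) (meshM : mesh_of X M).
Variable n : faceT M -> vec3 R.
Variables Km Kp : faceT M -> cellT M.
Local Notation face_pts e := (face_map e @` ref_face M).
Hypothesis KmP : minus_side n Km.
Hypothesis KpP : plus_side n Kp.
Hypothesis gaussP : mesh_gauss n Km Kp.

(** The common form of the traces from both sides: they only see the cell that a
    small step enters. *)
Lemma lim_trace (K : set (vec3 R)) (v q : vec3 R -> R) r (m : vec3 R) :
  (forall x, K x -> v x = q x) -> continuous q ->
  (\forall eps \near 0^'+, K (r + eps *: m)) ->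
  lim (v (r + eps *: m) @[eps --> 0^'+]) = q r.
Proof.
move=> vq cq nK; apply: cvg_lim => //.
have h : q (r + eps *: m) @[eps --> 0^'+] --> q (r + 0 *: m).
  apply: cvg_at_right_filter.
  apply: (@continuous_comp _ _ _ (fun eps : R => r + eps *: m) q); last exact: cq.
  apply: cvgD; first exact: cvg_cst.
  by apply: cvgZr_tmp; exact: cvg_id.
rewrite scale0r addr0 in h; apply: cvg_trans h.
apply: near_eq_cvg; near=> eps.
by apply/esym/vq; near: eps.
Unshelve. all: by end_near. Qed.

Lemma trace_minusE v q e r : e \in @faces R M -> face_pts e r -> continuous q ->
  (forall x, cell_pts (Km e) x -> v x = q x) -> trace_minus n v e r = q r.
Proof.
move=> eF rF cq vq; rewrite /trace_minus.
have -> : (fun eps : R => v (r - eps *: n e)) = (fun eps => v (r + eps *: - n e)).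
  by apply/funext => eps; rewrite scalerN.
apply: lim_trace vq cq _; have := (KmP eF).2 r rF.
by apply: filterS => eps; rewrite scalerN.
Qed.

Lemma trace_plusE v q e r : e \in @faces R M -> face_pts e r -> continuous q ->
  ~~ exterior e -> (forall x, cell_pts (Kp e) x -> v x = q x) ->
  trace_plus n v e r = q r.
Proof.
move=> eF rF cq ex vq; rewrite /trace_plus (negPf ex).
by have := (KpP eF ex).2 r rF; exact: lim_trace.
Qed.

Lemma trace_plus_ext v e r : exterior e -> trace_plus n v e r = 0.
Proof. by rewrite /trace_plus => ->. Qed.

Lemma trace_minus_facepoly v e : cellpoly M v -> e \in @faces R M ->
  facepoly e (trace_minus n v e).
Proof.
move=> hv eF; have [p pp vp] := hv _ (KmP eF).1.
exists p => // r rF; apply: trace_minusE => //; exact: polyfun_continuous.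
Qed.

Lemma trace_plus_facepoly v e : cellpoly M v -> e \in @faces R M ->
  facepoly e (trace_plus n v e).
Proof.
move=> hv eF; have [ex|ex] := boolP (exterior e).
  exists (fun=> 0); first exact: polyfun_cst.
  by move=> r _; exact: trace_plus_ext.
have [p pp vp] := hv _ (KpP eF ex).1.
exists p => // r rF; apply: trace_plusE => //; exact: polyfun_continuous.
Qed.

Lemma trace_minus_comb v w a b e r : cellpoly M v -> cellpoly M w ->
  e \in @faces R M -> face_pts e r ->
  trace_minus n (fun r => a * v r + b * w r) e r =
  a * trace_minus n v e r + b * trace_minus n w e r.
Proof.
move=> hv hw eF rF; have KC := (KmP eF).1.
have [p pp vp] := hv _ KC; have [q pq wq] := hw _ KC.
have cp := polyfun_continuous pp; have cq := polyfun_continuous pq.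
rewrite (trace_minusE eF rF cp vp) (trace_minusE eF rF cq wq).
rewrite (trace_minusE (q := fun r => a * p r + b * q r) eF rF)//.
  by apply: polyfun_continuous; apply: polyfunD; apply: polyfunM => //;
    exact: polyfun_cst.
by move=> x Kx; rewrite vp// wq.
Qed.

Lemma trace_plus_comb v w a b e r : cellpoly M v -> cellpoly M w ->
  e \in @faces R M -> face_pts e r ->
  trace_plus n (fun r => a * v r + b * w r) e r =
  a * trace_plus n v e r + b * trace_plus n w e r.
Proof.
move=> hv hw eF rF; have [ex|ex] := boolP (exterior e).
  by rewrite !trace_plus_ext// !mulr0 addr0.
have KC := (KpP eF ex).1.
have [p pp vp] := hv _ KC; have [q pq wq] := hw _ KC.
have cp := polyfun_continuous pp; have cq := polyfun_continuous pq.
rewrite (trace_plusE eF rF cp ex vp) (trace_plusE eF rF cq ex wq).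
rewrite (trace_plusE (q := fun r => a * p r + b * q r) eF rF)//.
  by apply: polyfun_continuous; apply: polyfunD; apply: polyfunM => //;
    exact: polyfun_cst.
by move=> x Kx; rewrite vp// wq.
Qed.

Lemma trace_eq v w e r : cellpoly M w -> dg_eq M v w ->
  e \in @faces R M -> face_pts e r ->
  trace_minus n v e r = trace_minus n w e r /\
  trace_plus n v e r = trace_plus n w e r.
Proof.
move=> hw vw eF rF; split.
  have KC := (KmP eF).1; have [q pq wq] := hw _ KC.
  have cq := polyfun_continuous pq.
  rewrite (trace_minusE eF rF cq wq) (trace_minusE eF rF cq)//.
  by move=> x Kx; rewrite (vw _ KC)// wq.
have [ex|ex] := boolP (exterior e); first by rewrite !trace_plus_ext.
have KC := (KpP eF ex).1; have [q pq wq] := hw _ KC.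
have cq := polyfun_continuous pq.
rewrite (trace_plusE eF rF cq ex wq) (trace_plusE eF rF cq ex)//.
by move=> x Kx; rewrite (vw _ KC)// wq.
Qed.

Lemma jump_facepoly v e : cellpoly M v -> e \in @faces R M ->
  facepoly e (jump n v e).
Proof.
move=> hv eF; apply: facepolyB; first exact: trace_minus_facepoly.
exact: trace_plus_facepoly.
Qed.

Lemma jump_sum e r (I : Type) (s : seq I) (c : I -> R) (F : I -> vec3 R -> R) :
  (forall i, cellpoly M (F i)) -> e \in @faces R M -> face_pts e r ->
  cellpoly M (fun r => \sum_(i <- s) c i * F i r) /\
  jump n (fun r => \sum_(i <- s) c i * F i r) e r =
  \sum_(i <- s) c i * jump n (F i) e r.
Proof.
move=> hF eF rF; rewrite /jump; elim: s => [|i s [ih1 ih2]].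
  rewrite big_nil; under eq_fun do rewrite big_nil.
  have h0 := @cellpoly_cst R M 0; split => //.
  have := trace_minus_comb 0 0 h0 h0 eF rF.
  have := trace_plus_comb 0 0 h0 h0 eF rF.
  have -> : (fun _ : vec3 R => 0 * 0 + 0 * 0) = (fun=> 0 : R).
    by apply/funext => x; rewrite !mul0r addr0.
  by move=> -> ->; rewrite !mul0r !addr0 subrr.
rewrite big_cons -ih2.
have E : (fun r => \sum_(i0 <- i :: s) c i0 * F i0 r) =
    (fun r => c i * F i r + 1 * \sum_(i <- s) c i * F i r).
  by apply/funext => x; rewrite big_cons mul1r.
rewrite E; split.
  apply: cellpolyD; first by apply: cellpolyM => //; exact: cellpoly_cst.
  by apply: cellpolyM => //; exact: cellpoly_cst.
by rewrite trace_minus_comb// trace_plus_comb//; ring.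
Qed.

(** The divergence theorem for the product of the two polynomials on each cell. On
    an exterior face the term of the outer side vanishes because the exterior
    trace is zero by convention. *)
Lemma green v w k a : dg_space X M k v -> dg_space X M k w ->
  volint X (fun r => crd (cellwise_grad M v r) a * w r +
    v r * crd (cellwise_grad M w r) a) =
  \sum_(e in @faces R M) crd (n e) a *
    (faceint e (fun r => trace_minus n v e r * trace_minus n w e r) -
     faceint e (fun r => trace_plus n v e r * trace_plus n w e r)).
Proof.
move=> hv hw.
have h0 K : exists pG : (vec3 R -> R) * ('I_3 -> vec3 R -> R), K \in cells M ->
    piece v K pG.1 pG.2.
  have [KC|] := boolP (K \in cells M); last by exists (v, fun=> v).
  by have [p [G h]] := dg_piece meshM hv KC; exists (p, G).
have h1 K : exists pG : (vec3 R -> R) * ('I_3 -> vec3 R -> R), K \in cells M ->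
    piece w K pG.1 pG.2.
  have [KC|] := boolP (K \in cells M); last by exists (v, fun=> v).
  by have [p [G h]] := dg_piece meshM hw KC; exists (p, G).
have [P hP] := choice h0; have [Q hQ] := choice h1.
pose g K r := (P K).1 r * (Q K).1 r.
pose G K i r := (P K).1 r * (Q K).2 i r + (Q K).1 r * (P K).2 i r.
have mv := dg_measurable hv; have mw := dg_measurable hw.
rewrite (volint_sum_cells openX meshM); last first.
  apply: (cellpoly_integrable openX meshM).
    have mgv := cellwise_grad_measurable meshM a hv.
    have mgw := cellwise_grad_measurable meshM a hw.
    by apply: measurable_funD; exact: measurable_funM.
  have pgv := cellwise_grad_cellpoly meshM a hv.
  have pgw := cellwise_grad_cellpoly meshM a hw.
  have pv := dg_cellpoly hv; have pw := dg_cellpoly hw.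
  by apply: cellpolyD; exact: cellpolyM.
have gg := @gaussP g G a.
transitivity (\sum_(K in cells M) volint (cell_pts K) (G K a)).
  apply: eq_bigr => K KC; apply: eq_Rintegral => r /set_mem Kr.
  rewrite (piece_grad (hP K KC))// (piece_grad (hQ K KC))//.
  by rewrite (piece_val (hP K KC))// (piece_val (hQ K KC))// /G; ring.
rewrite gg; last first.
  move=> K KC; have [pp pG dG _ _] := hP K KC; have [qp qG dH _ _] := hQ K KC.
  split; first exact: polyfunM.
    by move=> i; apply: polyfunD; exact: polyfunM.
  move=> r x; rewrite (_ : \sum_(_ < _) _ =
      (P K).1 r *: (\sum_(i < 3) crd x i * (Q K).2 i r) +
      (Q K).1 r *: (\sum_(i < 3) crd x i * (P K).2 i r)); last first.
    rewrite !scaler_sumr -big_split; apply: eq_bigr => i _ /=.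
    by rewrite /G /GRing.scale /=; ring.
  by have ? := dG r x; have ? := dH r x; apply: is_deriveM.
apply: eq_bigr => e eF; congr (_ * (_ - _)).
  have KC := (KmP eF).1; apply: eq_faceint => r rF.
  rewrite (trace_minusE eF rF _ (piece_val (hP _ KC))); last first.
    exact/polyfun_continuous/(piece_poly (hP _ KC)).
  rewrite (trace_minusE eF rF _ (piece_val (hQ _ KC)))//.
  exact/polyfun_continuous/(piece_poly (hQ _ KC)).
have [ex|ex] := boolP (exterior e).
  rewrite -(faceint0 e); apply: eq_faceint => r rF.
  by rewrite trace_plus_ext// mul0r.
have KC := (KpP eF ex).1; apply: eq_faceint => r rF.
rewrite (trace_plusE eF rF _ ex (piece_val (hP _ KC))); last first.
  exact/polyfun_continuous/(piece_poly (hP _ KC)).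
rewrite (trace_plusE eF rF _ ex (piece_val (hQ _ KC)))//.
exact/polyfun_continuous/(piece_poly (hQ _ KC)).
Qed.

End Traces.

(** * Moments of the angular quadrature *)

Section Quadratures.
Variables (R : realType) (Q : quadrature R).
Implicit Types (m y : vec3 R).
Local Notation w := (@wgt R Q).
Local Notation Om := (@dir R Q).

Lemma crd_sum (I : Type) (s : seq I) (F : I -> vec3 R) a :
  crd (\sum_(i <- s) F i) a = \sum_(i <- s) crd (F i) a.
Proof.
elim: s => [|i s ih]; last by rewrite !big_cons crdD ih.
by rewrite !big_nil; elim/I3_ind: a.
Qed.

Lemma pi4_neq0 : 4 * pi != 0 :> R.
Proof. by rewrite mulf_neq0 ?pnatr_eq0// gt_eqF// pi_gt0. Qed.

Lemma quadrature_crd a : \sum_i w i * crd (Om i) a = 0.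
Proof.
have := congr1 (fun r => crd r a) (moment1 Q); rewrite /= crd_sum.
have -> : crd 0 a = 0 :> R by elim/I3_ind: a.
by move=> h; rewrite -[RHS]h; apply: eq_bigr => i _; rewrite crdZ.
Qed.

Lemma quadrature_dot y : \sum_i w i * dot (Om i) y = 0.
Proof.
under eq_bigr do rewrite /dot mulr_sumr.
rewrite exchange_big big1// => a _.
under eq_bigr do rewrite mulrA.
by rewrite -mulr_suml quadrature_crd mul0r.
Qed.

Lemma quadrature_crd2 a b :
  \sum_i w i * (crd (Om i) a * crd (Om i) b) = 4 * pi / 3 * (a == b)%:R.
Proof.
have /matrixP/(_ a b) := moment2 Q; rewrite summxE mxE mulr_natr => <-.
by apply: eq_bigr => i _; rewrite !mxE.
Qed.

Lemma quadrature_dot_crd y b :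
  \sum_i w i * (dot (Om i) y * crd (Om i) b) = 4 * pi / 3 * crd y b.
Proof.
under eq_bigr do rewrite /dot mulr_suml mulr_sumr.
rewrite exchange_big /=.
transitivity (\sum_(a < 3) crd y a * (4 * pi / 3 * (a == b)%:R)).
  apply: eq_bigr => a _; rewrite -quadrature_crd2 mulr_sumr.
  by apply: eq_bigr => i _; ring.
rewrite (bigD1 b)//= eqxx big1 ?addr0 => [|a /negPf ->]; first by rewrite mulr1 mulrC.
by rewrite !mulr0.
Qed.

Lemma ang_avgE (f : angular Q R) r : \sum_i w i * f i r = 4 * pi * ang_avg f r.
Proof. by rewrite /ang_avg mulrA divff ?mul1r// pi4_neq0. Qed.

Lemma ang_avg_cst (f : angular Q R) r c : (forall i, f i r = c) -> ang_avg f r = c.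
Proof.
move=> fc; rewrite /ang_avg; under eq_bigr do rewrite fc.
by rewrite -mulr_suml moment0 mulrA mulVf ?mul1r// pi4_neq0.
Qed.

(** If no direction pointed against [m], the vanishing first moment would make all
    directions orthogonal to [m], contradicting the second moment. *)
Lemma quadrature_inflow_gt0 m : dot m m = 1 ->
  0 < \sum_i w i * Num.max 0 (- dot (Om i) m).
Proof.
move=> mm; have pos i : 0 <= w i * Num.max 0 (- dot (Om i) m).
  by rewrite mulr_ge0 ?le_max ?lexx// ltW// wgt_gt0.
rewrite lt_neqAle sumr_ge0// andbT; apply/eqP => /esym/eqP.
rewrite psumr_eq0// => /allP h.
have d0 i : 0 <= dot (Om i) m.
  have := h i (mem_index_enum _); rewrite /= mulf_eq0 gt_eqF ?wgt_gt0//=.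
  by move/eqP/max_idPl; rewrite oppr_le0.
have : \sum_i w i * dot (Om i) m == 0 by rewrite quadrature_dot.
rewrite psumr_eq0 => [/allP z|i _]; last by rewrite mulr_ge0// ltW// wgt_gt0.
have z0 i : dot (Om i) m = 0.
  have := z i (mem_index_enum _).
  by rewrite /= mulf_eq0 gt_eqF ?wgt_gt0//= => /eqP.
have : \sum_(b < 3) crd m b * (\sum_i w i * (dot (Om i) m * crd (Om i) b)) = 0.
  by rewrite big1// => b _; rewrite big1 ?mulr0// => i _; rewrite z0 mul0r mulr0.
under eq_bigr do rewrite quadrature_dot_crd mulrCA.
rewrite -mulr_sumr -/(dot m m) mm mulr1 => /eqP.
by rewrite mulf_eq0 (negPf pi4_neq0) invr_eq0 pnatr_eq0.
Qed.

Lemma dot_sum (F : 'I_(qsize Q) -> vec3 R) y :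
  dot (\sum_i F i) y = \sum_i dot (F i) y.
Proof.
rewrite /dot exchange_big; apply: eq_bigr => a _.
by rewrite crd_sum mulr_suml.
Qed.

End Quadratures.

(** The first part is linear in the direction, so that its angular average is
    governed by the moments of the quadrature; the second part penalizes jumps
    with a nonnegative weight. *)
Lemma upwindE (R : realType) (M : mesh R) (n : faceT M -> vec3 R) Om f e r :
  dot Om (n e) * upwind n Om f e r = dot Om (n e) * trace_minus n f e r +
    Num.max 0 (- dot Om (n e)) * jump n f e r.
Proof.
rewrite /upwind /jump; set d := dot Om (n e).
have [d0|d0|->] := ltgtP d 0.
- by rewrite (max_idPr _) ?oppr_ge0 ?ltW//; ring.
- by rewrite (max_idPl _) ?oppr_le0 ?ltW//; ring.
- by rewrite oppr0 maxxx !mul0r addr0.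
Qed.

(** * Definiteness of the mass form and the projection onto constants *)

Section Tests.
Variables (R : realType) (X : set (vec3 R)) (M : mesh R).
Hypotheses (openX : open X) (meshM : mesh_of X M).
Variable sigt : vec3 R -> R.
Hypothesis sigt_dg : dg_space X M 0 sigt.
Hypothesis sigtP : forall K, K \in cells M ->
  exists2 c, 0 < c & forall r, cell_pts K r -> sigt r = c.
Implicit Types (f g v : vec3 R -> R).
Local Notation integrable_on := (integrable_on X).

Lemma dg_mul3_integrable k l j f g v : dg_space X M k f -> dg_space X M l g ->
  dg_space X M j v -> integrable_on (fun r => f r * g r * v r).
Proof.
move=> hf hg hv; apply: (cellpoly_integrable openX meshM).
  apply: measurable_funM (dg_measurable hv).
  exact: measurable_funM (dg_measurable hf) (dg_measurable hg).
apply: cellpolyM (dg_cellpoly hv).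
exact: cellpolyM (dg_cellpoly hf) (dg_cellpoly hg).
Qed.

Lemma volint_dg_eq0 f : measurable_on X f -> dg_eq M f (fun=> 0) -> volint X f = 0.
Proof.
move=> mf f0; have pf : cellpoly M f.
  by move=> K KC; exists (fun=> 0); [exact: polyfun_cst|exact: f0].
rewrite (eq_volint openX meshM (cellpoly_integrable openX meshM mf pf) _ f0).
  by rewrite /volint Rintegral_cst ?mul0r//; exact: domain_measurable.
apply: (cellpoly_integrable openX meshM); first exact: measurable_cst.
exact: cellpoly_cst.
Qed.

(** With [f] as its own test function, the form is a sum of nonnegative terms. *)
Lemma mass_zero (Q : quadrature R) k (f : angular Q R) : ang_space X M k f ->
  (forall v : angular Q R, ang_space X M k v ->
    \sum_i wgt i * volint X (fun r => sigt r * f i r * v i r) = 0) ->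
  forall i, dg_eq M (f i) (fun=> 0).
Proof.
move=> hf h.
have Uge0 i r : cells_union M r -> 0 <= sigt r * f i r * f i r.
  move=> [K KC Kr]; have [c c0 sc] := sigtP KC.
  by rewrite sc// -mulrA -expr2 mulr_ge0 ?sqr_ge0// ltW.
have If i : integrable_on (fun r => sigt r * f i r * f i r).
  exact: dg_mul3_integrable sigt_dg (hf i) (hf i).
have Ige0 i : 0 <= volint X (fun r => sigt r * f i r * f i r).
  rewrite (volint_cells_union openX meshM)//; apply: Rintegral_ge0 => r.
  exact: Uge0.
have /eqP := h f hf; rewrite psumr_eq0 => [/allP z i|i _]; last first.
  by rewrite mulr_ge0// ltW// wgt_gt0.
have := z i (mem_index_enum _); rewrite /= mulf_eq0 gt_eqF ?wgt_gt0//= => /eqP I0.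
move=> K KC r Kr; have [c c0 sc] := sigtP KC.
have mf := integrable_on_measurable (If i).
have pf : cellpoly M (fun r => sigt r * f i r * f i r).
  apply: cellpolyM (dg_cellpoly (hf i)).
  exact: cellpolyM (dg_cellpoly sigt_dg) (dg_cellpoly (hf i)).
have := cellpoly_eq0 openX meshM mf pf (Uge0 i) I0 KC Kr.
by move/eqP; rewrite sc// !mulf_eq0 gt_eqF//= orbb => /eqP.
Qed.

(** The difference of the two projections is an admissible test function for
    both. *)
Lemma proj0_unique f g g' :
  (forall v, dg_space X M 0 v -> integrable_on (fun r => f r * v r)) ->
  is_L2_proj0 X M f g -> is_L2_proj0 X M f g' -> dg_eq M g g'.
Proof.
move=> hf [dg hg] [dg' hg'].
pose w r := 1 * g r + (-1) * g' r.
have hw : dg_space X M 0 w by exact: dgD.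
have Ifw := hf w hw.
have Igw := dg_mul_integrable openX meshM dg hw.
have Igw' := dg_mul_integrable openX meshM dg' hw.
have E h : dg_space X M 0 h -> volint X (fun r => (f r - h r) * w r) =
    volint X (fun r => f r * w r) - volint X (fun r => h r * w r).
  move=> dh; rewrite -volintB//; last exact: (dg_mul_integrable openX meshM dh hw).
  by apply: eq_Rintegral => r _; rewrite mulrBl.
have := hg w hw; have := hg' w hw; rewrite !E// => e1 e2.
have I0 : volint X (fun r => w r * w r) = 0.
  have -> : volint X (fun r => w r * w r) =
      volint X (fun r => g r * w r - g' r * w r).
    by apply: eq_Rintegral => r _; rewrite {1}/w; ring.
  by rewrite volintB//; lra.
move=> K KC r Kr.
have mw := dg_measurable hw; have pw := dg_cellpoly hw.
have w0 x : cells_union M x -> 0 <= w x * w x by rewrite -expr2 sqr_ge0.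
have := cellpoly_eq0 openX meshM (measurable_funM mw mw) (cellpolyM pw pw) w0
  I0 KC Kr.
by move/eqP; rewrite mulf_eq0 orbb /w mul1r mulN1r subr_eq0 => /eqP.
Qed.

Lemma L2_proj0_eq f g :
  (forall v, dg_space X M 0 v -> integrable_on (fun r => f r * v r)) ->
  is_L2_proj0 X M f g -> dg_eq M g (L2_proj0 X M f).
Proof.
move=> hf hg; apply: (proj0_unique hf hg).
exact: (@xgetPex _ (fun=> 0) [set g | is_L2_proj0 X M f g] (ex_intro _ g hg)).
Qed.

End Tests.

(** * Upwind fluxes *)

Section Fluxes.
Variables (R : realType) (M : mesh R).
Variable n : faceT M -> vec3 R.
Variables Km Kp : faceT M -> cellT M.
Local Notation face_pts e := (face_map e @` ref_face M).
Hypothesis KmP : minus_side n Km.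
Hypothesis KpP : plus_side n Kp.

Lemma flux_split Om f g v : cellpoly M g -> dg_eq M f g -> cellpoly M v ->
  face_flux n Om f v = \sum_(e in @faces R M)
    (dot Om (n e) * faceint e (fun r => trace_minus n g e r * jump n v e r) +
     Num.max 0 (- dot Om (n e)) *
       faceint e (fun r => jump n g e r * jump n v e r)).
Proof.
move=> pg fg pv; apply: eq_bigr => e eF.
have pm := trace_minus_facepoly KmP pg eF.
have pj := jump_facepoly KmP KpP pg eF.
have pjv := jump_facepoly KmP KpP pv eF.
have pm1 := facepolyM pm pjv; have pm2 := facepolyM pj pjv.
rewrite -faceintZ// -faceintZ// -faceintD; last 2 first.
- by apply: facepolyM => //; exact: facepoly_cst.
- by apply: facepolyM => //; exact: facepoly_cst.
apply: eq_faceint => r rF; rewrite upwindE.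
have [E1 E2] := trace_eq KmP KpP pg fg eF rF.
have EJ : jump n f e r = jump n g e r by rewrite /jump E1 E2.
by rewrite E1 EJ; ring.
Qed.

Lemma flux_zero Om f v : dg_eq M f (fun=> 0) -> cellpoly M v ->
  face_flux n Om f v = 0.
Proof.
move=> f0 pv; have p0 := @cellpoly_cst R M 0.
rewrite (flux_split Om p0 f0 pv) big1// => e eF.
have c0 : continuous (fun _ : vec3 R => 0 : R) by move=> x; exact: cvg_cst.
have tm r : face_pts e r -> trace_minus n (fun=> 0) e r = 0.
  by move=> rF; exact: (trace_minusE KmP eF rF c0).
have tp r : face_pts e r -> trace_plus n (fun=> 0) e r = 0.
  move=> rF; have [ex|ex] := boolP (exterior e); first exact: trace_plus_ext.
  exact: (trace_plusE KpP eF rF c0 ex).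
rewrite (@eq_faceint _ _ e _ (fun=> 0)) => [|r rF]; last by rewrite tm// mul0r.
rewrite [X in _ + _ * X](@eq_faceint _ _ e _ (fun=> 0)) => [|r rF]; last first.
  by rewrite /jump tm// tp// subrr mul0r.
by rewrite faceint0 !mulr0 addr0.
Qed.

(** On an interior face, both traces are values of the same continuous function;
    on an exterior face, this function is zero on the side of the normal. *)
Lemma cg_jump (X : set (vec3 R)) v e r : unit_normals X n -> cg_space X M v ->
  e \in @faces R M -> face_pts e r -> jump n v e r = 0.
Proof.
move=> normals [_ [g [cg vg g0]]] eF rF.
have [KC _] := KmP eF.
rewrite /jump (trace_minusE KmP eF rF cg); last by move=> x; exact: vg.
have [ex|ex] := boolP (exterior e); last first.
  rewrite (trace_plusE KpP eF rF cg ex) ?subrr// => x.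
  by apply: vg; have [] := KpP eF ex.
rewrite trace_plus_ext// subr0.
have [_ _ _ /(_ ex r rF) nX] := normals e eF.
have h : g (r + eps *: n e) @[eps --> 0^'+] --> g (r + 0 *: n e).
  apply: cvg_at_right_filter.
  apply: (@continuous_comp _ _ _ (fun eps : R => r + eps *: n e) g); last exact: cg.
  apply: cvgD; first exact: cvg_cst.
  by apply: cvgZr_tmp; exact: cvg_id.
rewrite scale0r addr0 in h; rewrite -(cvg_lim (@Rhausdorff R) h).
apply: cvg_lim => //; apply: cvg_near_cst.
by apply: filterS nX => eps [_ nXe]; exact: g0.
Qed.

Lemma flux_cg_eq0 (X : set (vec3 R)) Om f v : unit_normals X n ->
  cg_space X M v -> face_flux n Om f v = 0.
Proof.
move=> normals hv; rewrite /face_flux big1// => e eF.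
rewrite (@eq_faceint _ _ e _ (fun=> 0)) ?faceint0// => r rF.
by rewrite (cg_jump normals hv)// mulr0.
Qed.

(** Averaging the upwind fluxes over the directions removes the part linear in the
    direction and leaves a positive penalty on the squared jumps of [g]. *)
Lemma jump_orthogonal (Q : quadrature R) (f : angular Q R) g :
  (forall e, e \in @faces R M -> dot (n e) (n e) = 1) ->
  cellpoly M g -> (forall i, dg_eq M (f i) g) ->
  \sum_i wgt i * face_flux n (dir i) (f i) g = 0 ->
  forall e p, e \in @faces R M -> facepoly e p ->
    faceint e (fun r => jump n g e r * p r) = 0.
Proof.
move=> nn pg fg F0 e p eF pp.
pose c (e : faceT M) := \sum_i wgt i * Num.max 0 (- dot (@dir R Q i) (n e)).
have sumE : \sum_(e in @faces R M) c e * faceint e (fun r => jump n g e r ^+ 2) = 0.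
  rewrite -[RHS]F0.
  under [RHS]eq_bigr do rewrite (flux_split _ pg (fg _) pg) mulr_sumr.
  rewrite exchange_big; apply: eq_bigr => e' eF'.
  rewrite /c; under [X in faceint e' X]eq_fun do rewrite expr2.
  move: (faceint e' _) (faceint e' _) => A B.
  under [RHS]eq_bigr do rewrite mulrDr !mulrA.
  by rewrite big_split /= -!mulr_suml quadrature_dot mul0r add0r.
have c0 e' : e' \in @faces R M -> 0 < c e'.
  by move=> eF'; apply: quadrature_inflow_gt0; exact: nn.
move/eqP: sumE; rewrite psumr_eq0 => [/allP z|e' eF']; last first.
  by rewrite mulr_ge0 ?faceint_sqr_ge0// ltW// c0.
have := z e (mem_index_enum _); rewrite eF /= mulf_eq0 gt_eqF ?c0//= => /eqP.
exact: faceint_sqr_eq0 (jump_facepoly KmP KpP pg eF) pp.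
Qed.

End Fluxes.

(** * Operations on discrete functions *)

Section Spaces.
Variables (R : realType) (X : set (vec3 R)) (M : mesh R).
Hypotheses (openX : open X) (meshM : mesh_of X M).
Implicit Types (v w : vec3 R -> R).

Lemma dgB k v w : dg_space X M k v -> dg_space X M k w ->
  dg_space X M k (fun r => v r - w r).
Proof.
move=> hv hw; have := dgD openX meshM 1 (-1) hv hw.
by under [X in dg_space _ _ _ X]eq_fun do rewrite mul1r mulN1r.
Qed.

Lemma dgZ k c v : dg_space X M k v -> dg_space X M k (fun r => c * v r).
Proof.
move=> hv; have := dgD openX meshM c 0 hv hv.
by under [X in dg_space _ _ _ X]eq_fun do rewrite mul0r addr0.
Qed.

Lemma ang_avg_sumE (Q : quadrature R) (f : angular Q R) :
  ang_avg f = fun r => \sum_i ((4 * pi)^-1 * wgt i) * f i r.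
Proof.
apply/funext => r; rewrite /ang_avg mulr_sumr.
by apply: eq_bigr => i _; rewrite mulrA.
Qed.

Lemma dg_avg (Q : quadrature R) k (f : angular Q R) : ang_space X M k f ->
  dg_space X M k (ang_avg f).
Proof. by move=> hf; rewrite ang_avg_sumE; exact: dg_sum. Qed.

Lemma dg_deg0_mul v w : dg_space X M 0 v -> dg_space X M 0 w ->
  dg_space X M 0 (fun r => v r * w r).
Proof.
move=> hv hw; apply: (dg_intro openX meshM).
  exact: measurable_funM (dg_measurable hv) (dg_measurable hw).
move=> K KC; have [p pp vp] := hv.2 K KC; have [q pq wq] := hw.2 K KC.
have [c pc] := poly_space0_cst pp; have [d qd] := poly_space0_cst pq.
exists (fun=> c * d); first exact: poly_space_cst.
by move=> r Kr; rewrite vp// wq// pc qd.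
Qed.

(** Allows a test function to absorb the weight sigma_t. *)
Lemma dg_deg0_div s w : dg_space X M 0 w ->
  (forall K, K \in cells M ->
    exists2 c, 0 < c & forall r, cell_pts K r -> s r = c) ->
  exists2 w', dg_space X M 0 w' & dg_eq M (fun r => s r * w' r) w.
Proof.
move=> hw hs.
have h0 K : exists c, K \in cells M -> forall r, cell_pts K r -> s r * c = w r.
  have [KC|] := boolP (K \in cells M); last by exists 0.
  have [q pq wq] := hw.2 K KC; have [d qd] := poly_space0_cst pq.
  have [c c0 sc] := hs K KC; exists (d / c) => _ r Kr.
  by rewrite sc// wq// qd mulrC divfK// gt_eqF.
have [c hc] := choice h0.
pose F K : vec3 R -> R := if K \in cells M then \1_(cell_pts K) else fun=> 0.
exists (fun r => \sum_(K <- enum (cells M)) c K * F K r).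
  apply: (dg_sum openX meshM) => K; rewrite /F; case: ifPn => KC.
    exact: (dg_indic openX meshM KC).
  exact: (dg_zero openX meshM).
move=> K KC r Kr; rewrite big_enum (bigD1 K)//= /F KC indicE mem_set// mulr1.
rewrite big1 ?addr0; first exact: hc.
move=> L /andP[LC LK]; rewrite LC indicE memNset ?mulr0// => Lr.
by rewrite (mesh_cell_disjoint meshM LC KC Lr Kr) eqxx in LK.
Qed.

(** The functions [f] and [- f + f] represent the same element, which a linear
    operator maps to [- Rec f + Rec f]. *)
Lemma reconstruction_zero (Q : quadrature R) (Rec : angular Q R -> angular Q R)
    (f : angular Q R) : linear_reconstruction X M Rec -> ang_space X M 0 f ->
  (forall i, dg_eq M (f i) (fun=> 0)) -> forall i, dg_eq M (Rec f i) (fun=> 0).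
Proof.
move=> [_ Rec_eq Rec_lin] hf f0 i K KC r Kr.
pose g : angular Q R := fun j r => -1 * f j r + f j r.
have hg : ang_space X M 0 g.
  move=> j; have := dgD openX meshM (-1) 1 (hf j) (hf j).
  by under [X in dg_space _ _ _ X]eq_fun do rewrite mul1r.
have fg j : dg_eq M (f j) (g j).
  by move=> L LC x Lx; rewrite /g (f0 j L LC x Lx) mulr0 addr0.
rewrite (Rec_eq _ _ hf hg fg i K KC r Kr).
rewrite (Rec_lin (-1) f f hf hf i K KC r Kr); ring.
Qed.

Lemma cellwise_grad_sum k (I : Type) (s : seq I) (c : I -> R)
    (F : I -> vec3 R -> R) K r a : (forall i, dg_space X M k (F i)) ->
  K \in cells M -> cell_pts K r ->
  crd (cellwise_grad M (fun r => \sum_(i <- s) c i * F i r) r) a =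
  \sum_(i <- s) c i * crd (cellwise_grad M (F i) r) a.
Proof.
move=> hF KC Kr.
have gradE v k' : dg_space X M k' v -> exists2 d,
    crd (cellwise_grad M v r) a = d & is_derive r (Defs.basis R a) v d.
  move=> hv; have [p [G P]] := dg_piece meshM hv KC.
  exists (G a r); first by rewrite (piece_grad P).
  apply: (@near_eq_is_derive _ _ _ p).
    have : nbhs r (cell_pts K).
      by apply: open_nbhs_nbhs; split => //; exact: (mesh_cell_open meshM KC).
    by apply: filterS => x Kx; rewrite (piece_val P).
  have := piece_derive P r (Defs.basis R a).
  rewrite (bigD1 a)//= crd_basis eqxx mul1r big1 ?addr0// => i /negPf ia.
  by rewrite crd_basis ia mul0r.
have [d -> dd] := gradE _ _ (dg_sum openX meshM s c hF).
suff dd' : is_derive r (Defs.basis R a) (fun r => \sum_(i <- s) c i * F i r)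
    (\sum_(i <- s) c i * crd (cellwise_grad M (F i) r) a).
  by rewrite -(@derive_val _ _ _ _ _ _ _ dd) -(@derive_val _ _ _ _ _ _ _ dd').
elim: s {d dd} => [|i s ih].
  rewrite big_nil; under eq_fun do rewrite big_nil.
  exact: is_derive_cst.
rewrite big_cons; under eq_fun do rewrite big_cons.
have [di -> hdi] := gradE _ _ (hF i).
by apply: is_deriveD; apply: is_deriveZ.
Qed.

Lemma dot_grad_integrable k l v w y : dg_space X M k v -> dg_space X M l w ->
  integrable_on X (fun r => v r * dot y (cellwise_grad M w r)).
Proof.
move=> hv hw; apply: (cellpoly_integrable openX meshM).
  apply: measurable_funM (dg_measurable hv) _.
  apply: measurable_sum => a; apply: measurable_funM => //.
  exact: (cellwise_grad_measurable meshM a hw).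
apply: cellpolyM (dg_cellpoly hv) _ => K KC.
have [p [G P]] := dg_piece meshM hw KC.
exists (fun r => \sum_a crd y a * G a r).
  apply: polyfun_sum => a _.
  exact: (polyfunM (polyfun_cst (crd y a)) (piece_grad_poly P a)).
by move=> r Kr; apply: eq_bigr => a _; rewrite (piece_grad P).
Qed.

End Spaces.

(** * The diffusion limit *)

Theorem theorem3p1 (R : realType) (X : set (vec3 R))
  (openX : open X) (connectedX : connected X) (X_neq0 : X !=set0)
  (lipX : lipschitz_boundary X)
  (M : mesh R) (meshM : mesh_of X M)
  (n : faceT M -> vec3 R) (normals : unit_normals X n)
  (Qu Qc : quadrature R)
  (Rec : angular Qu R -> angular Qu R)
  (linRec : linear_reconstruction X M Rec)
  (q : angular Qu R) (q_L2 : forall i, L2 X (q i))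
  (sigt siga : vec3 R -> R)
  (sigt_dg : dg_space X M 0 sigt) (siga_meas : measurable_on X siga)
  (sig_bounds : {ae lebesgue3 R, forall r, X r -> 0 < siga r <= sigt r})
  (fu : 'I_3 -> angular Qu R) (fc : 'I_3 -> angular Qc R) (f0 : angular Qu R)
  (fu_dg : forall j, ang_space X M 0 (fu j))
  (fc_dg : forall j, ang_space X M 1 (fc j))
  (f0_dg : ang_space X M 0 f0) :
  let Phiu j := ang_avg (fu j) in
  let Phic j := ang_avg (fc j) in
  (* order -1 *)
  (forall vu : angular Qu R, ang_space X M 0 vu ->
     \sum_i wgt i * volint X (fun r => sigt r * fu 0 i r * vu i r) = 0) ->
  (forall vc : angular Qc R, ang_space X M 1 vc ->
     \sum_i wgt i * volint X (fun r =>
       sigt r * (fc 0 i r - Phic 0 r) * vc i r) =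
     \sum_i wgt i * volint X (fun r => sigt r * Phiu 0 r * vc i r)) ->
  (forall vu : angular Qu R, ang_space X M 0 vu ->
     \sum_i wgt i * volint X (fun r => sigt r * f0 i r * vu i r) =
     \sum_i wgt i * volint X (fun r =>
       sigt r * (Phiu 0 r + Phic 0 r) * vu i r)) ->
  (* order 0 *)
  (forall vu : angular Qu R, ang_space X M 0 vu ->
     \sum_i wgt i *
       (volint X (fun r => sigt r * fu 1 i r * vu i r) +
        face_flux n (dir i) (Rec (fu 0) i) (vu i)) = 0) ->
  (forall vc : angular Qc R, ang_space X M 1 vc ->
     \sum_i wgt i *
       (volint X (fun r =>
          - fc 0 i r * dot (dir i) (cellwise_grad M (vc i) r) +
          sigt r * (fc 1 i r - Phic 1 r) * vc i r) +
        face_flux n (dir i) (fc 0 i) (vc i)) =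
     \sum_i wgt i * volint X (fun r => sigt r * Phiu 1 r * vc i r)) ->
  (* order 1 *)
  (forall vu : angular Qu R, ang_space X M 0 vu ->
     \sum_i wgt i *
       (volint X (fun r => sigt r * fu 2 i r * vu i r) +
        face_flux n (dir i) (Rec (fu 1) i) (vu i)) =
     \sum_i wgt i * volint X (fun r => q i r * vu i r)) ->
  (forall vc : angular Qc R, ang_space X M 1 vc ->
     \sum_i wgt i *
       (volint X (fun r =>
          - fc 1 i r * dot (dir i) (cellwise_grad M (vc i) r) +
          sigt r * (fc 2 i r - Phic 2 r) * vc i r +
          siga r * Phic 0 r * vc i r) +
        face_flux n (dir i) (fc 1 i) (vc i)) =
     \sum_i wgt i * volint X (fun r =>
       (sigt r * Phiu 2 r - siga r * Phiu 0 r) * vc i r)) ->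
  let J (r : vec3 R) : vec3 R := \sum_i wgt i *: (fc 1 i r *: dir i) in
  let qbar := ang_avg q in
  [/\ forall i, dg_eq M (f0 i) (L2_proj0 X M (Phic 0)),
      forall v : vec3 R -> R, cg_space X M v ->
        volint X (fun r =>
          - dot (J r) (cellwise_grad M v r) +
          4 * pi * siga r * Phic 0 r * v r) =
        4 * pi * volint X (fun r => L2_proj0 X M qbar r * v r)
    & forall phi : vec3 R -> vec3 R,
        (forall a, dg_space X M 1 (fun r => crd (phi r) a)) ->
        volint X (fun r =>
          dot ((4 * pi / 3) *: cellwise_grad M (Phic 0) r + sigt r *: J r)
              (phi r)) = 0].
Proof.
move=> Phiu Phic Hm1u Hm1c Hm1f H0u H0c H1u H1c J qbar.
have [Km [Kp [KmP KpP gaussP]]] := mesh_sides meshM X_neq0 normals.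
have sP := sigt_pos meshM sigt_dg sig_bounds.
have nn e : e \in @faces R M -> dot (n e) (n e) = 1 by case/normals.
have Phiu_dg j : dg_space X M 0 (Phiu j) by exact: dg_avg.
have Phic_dg j : dg_space X M 1 (Phic j) by exact: dg_avg.
have avg0 (Q : quadrature R) (f : angular Q R) :
    (forall i, dg_eq M (f i) (fun=> 0)) -> dg_eq M (ang_avg f) (fun=> 0).
  by move=> h0 K KC r Kr; apply: ang_avg_cst => i; exact: h0 Kr.
have fluct (Q : quadrature R) (f : angular Q R) r :
    \sum_i wgt i * (f i r - ang_avg f r) = 0.
  under eq_bigr do rewrite mulrBr.
  by rewrite sumrB ang_avgE -mulr_suml moment0 subrr.
have sum_wgt (Q : quadrature R) (c : R) : \sum_i @wgt R Q i * c = 4 * pi * c.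
  by rewrite -mulr_suml moment0.
have source0 j k v : dg_eq M (Phiu j) (fun=> 0) -> dg_space X M k v ->
    volint X (fun r => sigt r * Phiu j r * v r) = 0.
  move=> P0 hv; have I0 := dg_mul3_integrable openX meshM sigt_dg (Phiu_dg j) hv.
  apply: (volint_dg_eq0 openX meshM (integrable_on_measurable I0)) => K KC r Kr.
  by rewrite (P0 K KC r Kr) mulr0 mul0r.
have fu0 : forall i, dg_eq M (fu 0 i) (fun=> 0).
  exact: (mass_zero openX meshM sigt_dg sP (fu_dg 0) Hm1u).
have Phiu0 : dg_eq M (Phiu 0) (fun=> 0) by exact: avg0.
(* the source is zero by now, so the deviation from the average is a test
   function for itself *)
have fc0 i : dg_eq M (fc 0 i) (Phic 0).
  have h : ang_space X M 1 (fun i r => fc 0 i r - Phic 0 r).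
    by move=> i0; apply: (dgB openX meshM); [exact: fc_dg|exact: Phic_dg].
  have z := mass_zero openX meshM sigt_dg sP h.
  suff z0 : forall i, dg_eq M (fun r => fc 0 i r - Phic 0 r) (fun=> 0).
    by move=> K KC r Kr; apply/eqP; rewrite -subr_eq0 (z0 i K KC r Kr).
  apply: z => v hv; rewrite Hm1c// big1// => i' _.
  by rewrite (source0 0 1) ?mulr0//; exact: hv.
have rec0 j : (forall i, dg_eq M (fu j i) (fun=> 0)) ->
    forall i, dg_eq M (Rec (fu j) i) (fun=> 0).
  exact: (reconstruction_zero openX meshM linRec (fu_dg j)).
have rec_flux0 j (vu : angular Qu R) : (forall i, dg_eq M (fu j i) (fun=> 0)) ->
    ang_space X M 0 vu ->
    forall i, face_flux n (dir i) (Rec (fu j) i) (vu i) = 0.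
  move=> fj0 hv i; apply: (flux_zero KmP KpP) (rec0 j fj0 i) _.
  exact: dg_cellpoly (hv i).
have fu1 : forall i, dg_eq M (fu 1 i) (fun=> 0).
  apply: (mass_zero openX meshM sigt_dg sP (fu_dg 1)) => v hv.
  rewrite -[RHS](H0u v hv); apply: eq_bigr => i _.
  by rewrite rec_flux0// addr0.
have Phiu1 : dg_eq M (Phiu 1) (fun=> 0) by exact: avg0.
split.
- (* testing with w / sigt removes the weight sigt *)
  move=> i; apply: (L2_proj0_eq openX meshM).
    by move=> v hv; exact (dg_mul_integrable openX meshM (Phic_dg 0) hv).
  split; first exact: f0_dg.
  move=> w hw; have [w' hw' sw] := dg_deg0_div openX meshM hw sP.
  pose vu : angular Qu R := fun j r => (j == i)%:R * w' r.
  have hvu : ang_space X M 0 vu by move=> j; exact: dgZ.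
  have pick (g : 'I_(qsize Qu) -> vec3 R -> R) :
      (forall j, integrable_on X (fun r => g j r * w' r)) ->
      \sum_j wgt j * volint X (fun r => g j r * vu j r) =
      wgt i * volint X (fun r => g i r * w' r).
    move=> Ig; rewrite (bigD1 i)//= big1 ?addr0 => [|j /negPf ji].
      by congr (_ * _); apply: eq_Rintegral => r _; rewrite /vu eqxx mul1r.
    rewrite (_ : (fun r => _) = (fun r => 0 * (g j r * w' r))); last first.
      by apply/funext => r; rewrite /vu ji !mul0r mulr0.
    by rewrite (volintZ openX _ (Ig j)) mul0r mulr0.
  have I3 : integrable_on X (fun r => sigt r * (Phiu 0 r + Phic 0 r) * w' r).
    have := integrable_onD openX (dg_mul3_integrable openX meshM sigt_dg (Phiu_dg 0) hw')
      (dg_mul3_integrable openX meshM sigt_dg (Phic_dg 0) hw').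
    by apply: eq_integrable => [|r _ /=]; [exact: domain_measurable|congr EFin; ring].
  have := Hm1f vu hvu; rewrite !pick; last 2 first.
  + by move=> j; exact: I3.
  + move=> j; exact (dg_mul3_integrable openX meshM sigt_dg (f0_dg j) hw').
  move/(mulfI (lt0r_neq0 (wgt_gt0 i))) => E.
  have I1 := dg_mul_integrable openX meshM (Phic_dg 0) hw.
  have I2 := dg_mul_integrable openX meshM (f0_dg i) hw.
  transitivity (volint X (fun r => Phic 0 r * w r) -
      volint X (fun r => f0 i r * w r)).
    by rewrite -volintB//; apply: eq_Rintegral => r _; rewrite mulrBl.
  have e1 : volint X (fun r => f0 i r * w r) =
      volint X (fun r => sigt r * f0 i r * w' r).
    apply: (eq_volint openX meshM) => //.
      exact (dg_mul3_integrable openX meshM sigt_dg (f0_dg i) hw').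
    by move=> K KC r Kr; rewrite -(sw K KC r Kr); ring.
  have e2 : volint X (fun r => Phic 0 r * w r) =
      volint X (fun r => sigt r * (Phiu 0 r + Phic 0 r) * w' r).
    apply: (eq_volint openX meshM) => //.
    by move=> K KC r Kr; rewrite -(sw K KC r Kr) (Phiu0 K KC r Kr); ring.
  by rewrite e1 e2 E subrr.
- (* v itself, as an isotropic test function, has no face terms *)
  move=> v hv; have v1 := hv.1.
  pose F i r := - fc 1 i r * dot (dir i) (cellwise_grad M v r) +
      sigt r * (fc 2 i r - Phic 2 r) * v r + siga r * Phic 0 r * v r.
  have E : \sum_i wgt i * volint X (F i) = \sum_(i < qsize Qc) wgt i *
      volint X (fun r => (sigt r * Phiu 2 r - siga r * Phiu 0 r) * v r).
    rewrite -(H1c (fun=> v) (fun=> v1)); apply: eq_bigr => i _.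
    by rewrite (flux_cg_eq0 KmP KpP _ _ normals hv) addr0.
  have Is : integrable_on X (fun r => siga r * Phic 0 r * v r).
    have := siga_mul_integrable openX meshM sigt_dg siga_meas sig_bounds
      (measurable_funM (dg_measurable (Phic_dg 0)) (dg_measurable v1))
      (cellpolyM (dg_cellpoly (Phic_dg 0)) (dg_cellpoly v1)).
    by apply: eq_integrable => [|r _ /=]; [exact: domain_measurable|congr EFin; ring].
  have Ia i : integrable_on X (F i).
    apply: (integrable_onD openX) Is; apply: (integrable_onD openX).
      have mf : dg_space X M 1 (fun r => - fc 1 i r).
        have := dgZ openX meshM (-1) (fc_dg 1 i).
        by under [X in dg_space _ _ _ X]eq_fun do rewrite mulN1r.
      exact (dot_grad_integrable openX meshM (dir i) mf v1).
    have df := dgB openX meshM (fc_dg 2 i) (Phic_dg 2).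
    exact (dg_mul3_integrable openX meshM sigt_dg df v1).
  have [_ sumE] := volint_sum (P := xpredT) openX (index_enum _) (@wgt R Qc)
    (fun i _ => Ia i).
  rewrite -sumE in E.
  have -> : volint X (fun r => - dot (J r) (cellwise_grad M v r) +
      4 * pi * siga r * Phic 0 r * v r) =
      4 * pi * volint X (fun r => (sigt r * Phiu 2 r - siga r * Phiu 0 r) * v r).
    rewrite -(sum_wgt Qc) -E; apply: eq_Rintegral => r _.
    under eq_bigr do rewrite 2!mulrDr.
    rewrite 2!big_split /= -mulr_suml moment0.
    have -> : \sum_i wgt i * (sigt r * (fc 2 i r - Phic 2 r) * v r) = 0.
      rewrite (eq_bigr (fun i => (sigt r * v r) * (wgt i * (fc 2 i r - Phic 2 r)))).
        by rewrite -mulr_sumr fluct mulr0.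
      by move=> i _; ring.
    rewrite addr0 !mulrA /J dot_sum -sumrN; congr (_ + _).
    by apply: eq_bigr => i _; rewrite !dotZl; ring.
  congr (_ * _).
  have I2 := dg_mul3_integrable openX meshM sigt_dg (Phiu_dg 2) v1.
  have qbar_Int k w : dg_space X M k w -> integrable_on X (fun r => qbar r * w r) /\
      volint X (fun r => qbar r * w r) =
      (4 * pi)^-1 * \sum_i wgt i * volint X (fun r => q i r * w r).
    move=> hw.
    have Iqw i : integrable_on X (fun r => q i r * w r).
      exact (L2_mul_integrable openX meshM (q_L2 i) hw).
    have [i1 i2] := volint_sum (P := xpredT) openX (index_enum _)
      (fun i => (4 * pi)^-1 * @wgt R Qu i) (fun i _ => Iqw i).
    have qE : (fun r => qbar r * w r) =
       (fun r => \sum_i (4 * pi)^-1 * wgt i * (q i r * w r)).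
      apply/funext => r; rewrite /qbar ang_avg_sumE mulr_suml.
      by apply: eq_bigr => i _; rewrite !mulrA.
    rewrite qE i2 mulr_sumr; split; first exact i1.
    by apply: eq_bigr => i _; rewrite mulrA.
  (* the uncollided balance of order 1, tested isotropically *)
  have projq : is_L2_proj0 X M qbar (fun r => sigt r * Phiu 2 r).
    split; first exact: (dg_deg0_mul openX meshM sigt_dg (Phiu_dg 2)).
    move=> w hw; have [Iqw qw] := qbar_Int 0%N w hw.
    have Iw := dg_mul3_integrable openX meshM sigt_dg (Phiu_dg 2) hw.
    transitivity (volint X (fun r => qbar r * w r) -
        volint X (fun r => sigt r * Phiu 2 r * w r)).
      by rewrite -volintB//; apply: eq_Rintegral => r _; rewrite mulrBl.
    rewrite qw -(H1u (fun=> w) (fun=> hw)).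
    under eq_bigr do rewrite (rec_flux0 1 (fun=> w) fu1 (fun=> hw)) addr0.
    have If i : integrable_on X (fun r => sigt r * fu 2 i r * w r).
      exact (dg_mul3_integrable openX meshM sigt_dg (fu_dg 2 i) hw).
    have [_ <-] := volint_sum (P := xpredT) openX (index_enum _) (@wgt R Qu)
      (fun i _ => If i).
    have -> : volint X (fun r => \sum_i wgt i * (sigt r * fu 2 i r * w r)) =
        4 * pi * volint X (fun r => sigt r * Phiu 2 r * w r).
      rewrite -volintZ//; apply: eq_Rintegral => r _.
      rewrite (eq_bigr (fun i => (sigt r * w r) * (wgt i * fu 2 i r))).
        by rewrite -mulr_sumr ang_avgE /Phiu; ring.
      by move=> i _; ring.
    by rewrite mulrA mulVf ?mul1r ?subrr// pi4_neq0.
  have qInt w : dg_space X M 0 w -> integrable_on X (fun r => qbar r * w r).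
    by move=> hw; have [] := qbar_Int 0%N w hw.
  have Pq := L2_proj0_eq openX meshM qInt projq.
  have Pdg : dg_space X M 0 (L2_proj0 X M qbar).
    by have [] := @xgetPex _ (fun=> 0) [set g | is_L2_proj0 X M qbar g]
      (ex_intro _ _ projq).
  transitivity (volint X (fun r => sigt r * Phiu 2 r * v r)); last first.
    apply: (eq_volint openX meshM) => //.
      exact (dg_mul_integrable openX meshM Pdg v1).
    by move=> K KC r Kr; rewrite (Pq K KC r Kr).
  apply: (eq_volint openX meshM) => //; last first.
    by move=> K KC r Kr; rewrite (Phiu0 K KC r Kr) mulr0 subr0.
  have Is0 := siga_mul_integrable openX meshM sigt_dg siga_meas sig_bounds
      (measurable_funM (dg_measurable (Phiu_dg 0)) (dg_measurable v1))
      (cellpolyM (dg_cellpoly (Phiu_dg 0)) (dg_cellpoly v1)).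
  have := integrable_onB openX I2 Is0.
  by apply: eq_integrable => [|r _ /=]; [exact: domain_measurable|congr EFin; ring].
move=> phi hphi.
pose ph a r := crd (phi r) a.
have pph a : cellpoly M (ph a) by exact: dg_cellpoly (hphi a).
pose d a b r := crd (cellwise_grad M (ph b) r) a.
(* with the sum over directions under the integral, moments apply pointwise *)
have order0 (vc : angular Qc R) : ang_space X M 1 vc ->
    exists2 F : 'I_(qsize Qc) -> vec3 R -> R, (forall i r, F i r =
      - fc 0 i r * dot (dir i) (cellwise_grad M (vc i) r) +
      sigt r * (fc 1 i r - Phic 1 r) * vc i r) &
    integrable_on X (fun r => \sum_i wgt i * F i r) /\
    volint X (fun r => \sum_i wgt i * F i r) +
      \sum_i wgt i * face_flux n (dir i) (fc 0 i) (vc i) = 0.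
  move=> hvc; pose F i r := - fc 0 i r * dot (dir i) (cellwise_grad M (vc i) r) +
      sigt r * (fc 1 i r - Phic 1 r) * vc i r.
  exists F => //.
  have IF i : integrable_on X (F i).
    apply: (integrable_onD openX).
      have mf : dg_space X M 1 (fun r => - fc 0 i r).
        have := dgZ openX meshM (-1) (fc_dg 0 i).
        by under [X in dg_space _ _ _ X]eq_fun do rewrite mulN1r.
      exact (dot_grad_integrable openX meshM (dir i) mf (hvc i)).
    have df := dgB openX meshM (fc_dg 1 i) (Phic_dg 1).
    exact (dg_mul3_integrable openX meshM sigt_dg df (hvc i)).
  have [IS ->] := volint_sum (P := xpredT) openX (index_enum _) (@wgt R Qc)
    (fun i _ => IF i).
  split; first exact IS.
  rewrite -big_split /=; under eq_bigr do rewrite -mulrDr.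
  rewrite H0c// big1// => i _; rewrite (source0 1%R 1%N) ?mulr0//.
have pPhi := dg_cellpoly (Phic_dg 0).
(* the isotropic test function Phic 0 leaves only its own squared jumps *)
have jump0 : forall e p, e \in @faces R M -> facepoly e p ->
    faceint e (fun r => jump n (Phic 0) e r * p r) = 0.
  apply: (jump_orthogonal KmP KpP nn pPhi fc0).
  have [F FE [IF]] := order0 (fun=> Phic 0) (fun=> Phic_dg 0).
  rewrite (volint_dg_eq0 openX meshM (integrable_on_measurable IF)) ?add0r//.
  move=> K KC r Kr; under eq_bigr do rewrite FE (fc0 _ K KC r Kr) mulrDr.
  rewrite big_split /=.
  rewrite (eq_bigr (fun i => - Phic 0 r *
    (wgt i * dot (dir i) (cellwise_grad M (Phic 0) r)))); last by move=> i _; ring.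
  rewrite -mulr_sumr quadrature_dot mulr0 add0r.
  rewrite (eq_bigr (fun i => sigt r * Phic 0 r * (wgt i * (fc 1 i r - Phic 1 r)))).
    by rewrite -mulr_sumr fluct mulr0.
  by move=> i _; ring.
(* testing with dir . phi brings in the second moments *)
pose psi : angular Qc R := fun i r => \sum_a crd (dir i) a * ph a r.
have hpsi : ang_space X M 1 psi by move=> i; exact: (dg_sum openX meshM).
have [F FE [IF volF]] := order0 psi hpsi.
have FK K r : K \in cells M -> cell_pts K r -> \sum_i wgt i * F i r =
    - (4 * pi / 3 * (Phic 0 r * \sum_a d a a r)) +
    sigt r * \sum_a crd (J r) a * ph a r.
  move=> KC Kr; under eq_bigr do rewrite FE (fc0 _ K KC r Kr) mulrDr.
  rewrite big_split /=; congr (_ + _).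
    have -> : 4 * pi / 3 * (Phic 0 r * \sum_a d a a r) =
        \sum_a Phic 0 r * \sum_b d a b r * (4 * pi / 3 * (a == b)%:R).
      rewrite !mulr_sumr; apply: eq_bigr => a _.
      rewrite (bigD1 a)//= eqxx big1 => [|b ba]; first by rewrite addr0 mulr1; ring.
      by rewrite eq_sym (negPf ba) !mulr0.
    rewrite -sumrN.
    transitivity (\sum_(i < qsize Qc) \sum_(a < 3) \sum_(b < 3)
        (- Phic 0 r * d a b r *
          (wgt i * (crd (@dir R Qc i) a * crd (@dir R Qc i) b)))).
      apply: eq_bigr => i _; rewrite mulrCA /dot !mulr_sumr; apply: eq_bigr => a _.
      rewrite /psi (cellwise_grad_sum openX meshM _ _ _ hphi KC Kr) !mulr_sumr.
      by apply: eq_bigr => b _; rewrite /d; ring.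
    rewrite exchange_big; apply: eq_bigr => a _; rewrite exchange_big /=.
    rewrite mulr_sumr -sumrN; apply: eq_bigr => b _.
    by rewrite -mulr_sumr quadrature_crd2; ring.
  rewrite (eq_bigr (fun i => \sum_a sigt r * ph a r *
    (wgt i * fc 1 i r * crd (dir i) a - Phic 1 r * (wgt i * crd (dir i) a)))).
    rewrite exchange_big mulr_sumr; apply: eq_bigr => a _ /=.
    rewrite -mulr_sumr sumrB -mulr_sumr quadrature_crd mulr0 subr0 /J crd_sum.
    rewrite [X in _ = _ * X]mulrC mulrA; congr (_ * _).
    by apply: eq_bigr => i _; rewrite !crdZ mulrA.
  by move=> i _; rewrite /psi !mulr_sumr; apply: eq_bigr => a _; ring.
(* without jumps of Phi, the difference of Phi^- [[phi]] and [[Phi phi]], which is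
   [[Phi]] phi^+, integrates to zero *)
pose A e a := faceint e (fun r => trace_minus n (Phic 0) e r * jump n (ph a) e r).
have AE e a : e \in @faces R M -> A e a =
    faceint e (fun r => trace_minus n (Phic 0) e r * trace_minus n (ph a) e r) -
    faceint e (fun r => trace_plus n (Phic 0) e r * trace_plus n (ph a) e r).
  move=> eF.
  have m1 := trace_minus_facepoly KmP pPhi eF.
  have m2 := trace_minus_facepoly KmP (pph a) eF.
  have p1 := trace_plus_facepoly KpP pPhi eF.
  have p2 := trace_plus_facepoly KpP (pph a) eF.
  have jP := jump_facepoly KmP KpP pPhi eF.
  have mm := facepolyM m1 m2; have pp := facepolyM p1 p2.
  have jp := facepolyM jP p2.
  rewrite -[LHS]addr0 -(jump0 e _ eF p2) -faceintB// -faceintD//; last first.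
    exact: facepolyM m1 (jump_facepoly KmP KpP (pph a) eF).
  by apply: eq_faceint => r _; rewrite /jump; ring.
have fluxE : \sum_i wgt i * face_flux n (dir i) (fc 0 i) (psi i) =
    \sum_a 4 * pi / 3 * volint X (fun r => crd (cellwise_grad M (Phic 0) r) a * ph a r +
      Phic 0 r * d a a r).
  transitivity (\sum_(i < qsize Qc) \sum_(e in @faces R M) \sum_(a < 3)
      (A e a * (wgt i * (dot (@dir R Qc i) (n e) * crd (@dir R Qc i) a)))).
    apply: eq_bigr => i _.
    rewrite (flux_split KmP KpP _ pPhi (fc0 i) (dg_cellpoly (hpsi i))) mulr_sumr.
    apply: eq_bigr => e eF.
    rewrite jump0 ?mulr0 ?addr0//; last first.
      exact: (jump_facepoly KmP KpP (dg_cellpoly (hpsi i)) eF).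
    have pA a : facepoly e (fun r => trace_minus n (Phic 0) e r * jump n (ph a) e r).
      exact: facepolyM (trace_minus_facepoly KmP pPhi eF)
        (jump_facepoly KmP KpP (pph a) eF).
    have -> : faceint e (fun r => trace_minus n (Phic 0) e r * jump n (psi i) e r) =
        \sum_a crd (dir i) a * A e a.
      rewrite -(faceint_sum (index_enum _) (fun a => crd (@dir R Qc i) a) pA).2.
      apply: eq_faceint => r rF.
      have [_ ->] := jump_sum KmP KpP (index_enum _)
        (fun a => crd (@dir R Qc i) a) pph eF rF.
      by rewrite mulr_sumr; apply: eq_bigr => a _; ring.
    by rewrite !mulr_sumr; apply: eq_bigr => a _; ring.
  rewrite exchange_big /=.
  transitivity (\sum_(e in @faces R M) \sum_a A e a * (4 * pi / 3 * crd (n e) a)).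
    apply: eq_bigr => e _; rewrite exchange_big; apply: eq_bigr => a _ /=.
    by rewrite -mulr_sumr quadrature_dot_crd.
  rewrite exchange_big; apply: eq_bigr => a _ /=.
  rewrite (green openX meshM KmP KpP gaussP a (Phic_dg 0) (hphi a)) mulr_sumr.
  by apply: eq_bigr => e eF; rewrite -AE//; ring.
have IG a : integrable_on X (fun r => crd (cellwise_grad M (Phic 0) r) a * ph a r +
    Phic 0 r * d a a r).
  apply: (cellpoly_integrable openX meshM).
    apply: measurable_funD; apply: measurable_funM.
    - exact: (cellwise_grad_measurable meshM a (Phic_dg 0)).
    - exact: dg_measurable (hphi a).
    - exact: dg_measurable (Phic_dg 0).
    - exact: (cellwise_grad_measurable meshM a (hphi a)).
  apply: cellpolyD; apply: cellpolyM => //.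
  - exact: (cellwise_grad_cellpoly meshM a (Phic_dg 0)).
  - exact: (cellwise_grad_cellpoly meshM a (hphi a)).
have [IGs GsE] := volint_sum (P := xpredT) openX (index_enum _) (fun=> 4 * pi / 3)
  (fun a _ => IG a).
rewrite fluxE -GsE -(volintD openX IF IGs) in volF.
rewrite -[RHS]volF; apply: (eq_volint openX meshM); last first.
- move=> K KC r Kr; rewrite (FK K r KC Kr).
  rewrite dotC dotDr (dotZr _ (4 * pi / 3)) (dotZr _ (sigt r)) ![dot (phi r) _]dotC.
  rewrite -[X in _ = _ + X]mulr_sumr big_split /= -mulr_sumr.
  have -> : \sum_a crd (cellwise_grad M (Phic 0) r) a * ph a r =
    dot (cellwise_grad M (Phic 0) r) (phi r) by [].
  have -> : \sum_a crd (J r) a * ph a r = dot (J r) (phi r) by [].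
  by ring.
- exact (integrable_onD openX IF IGs).
have I1 a : integrable_on X (fun r => crd (cellwise_grad M (Phic 0) r) a * ph a r).
  apply: (cellpoly_integrable openX meshM).
    exact: measurable_funM (cellwise_grad_measurable meshM a (Phic_dg 0))
      (dg_measurable (hphi a)).
  exact: cellpolyM (cellwise_grad_cellpoly meshM a (Phic_dg 0)) (pph a).
have [IS1 _] := volint_sum (P := xpredT) openX (index_enum _) (fun=> 4 * pi / 3)
  (fun a _ => I1 a).
have I2 i : integrable_on X (fun r => sigt r * fc 1 i r * psi i r).
  exact (dg_mul3_integrable openX meshM sigt_dg (fc_dg 1 i) (hpsi i)).
have [IS2 _] := volint_sum (P := xpredT) openX (index_enum _) (@wgt R Qc)
  (fun i _ => I2 i).
have := integrable_onD openX IS1 IS2.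
apply: eq_integrable => [|r _ /=]; [exact: domain_measurable|congr EFin].
rewrite dotC dotDr (dotZr _ (4 * pi / 3)) (dotZr _ (sigt r)) ![dot (phi r) _]dotC.
rewrite -mulr_sumr; congr (_ + _).
rewrite /J dot_sum mulr_sumr; apply: eq_bigr => i _.
by rewrite !dotZl /psi /dot; ring.
Qed.
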